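(* Let $H$ be a Hopf algebra over a field $k$ with bijective antipode and $A$ a right coideal subalgebra of $H$. Suppose that all objects of $\mathcal M_A^H$ are flat $A$-modules. Then: (i) All nonzero objects of $\mathcal M_A^H$ are projective generators in the category $\mathcal M_A$ of right $A$-modules. (ii) $H$ is left and right faithfully flat over $A$.
   Context: $\Delta$ is the comultiplication of $H$, $\Delta(x)=\sum x_{(1)}\otimes x_{(2)}$. A right coideal subalgebra is a subalgebra $A\subset H$ with $\Delta(A)\subset A\otimes H$. $\mathcal M_A^H$ is the category of right $A$-modules $M$ equipped with a right $H$-comodule structure $\rho:M\to M\otimes H$ such that $\rho(ma)=\sum m_{(0)}a_{(1)}\otimes m_{(1)}a_{(2)}$ for $m\in M$, $a\in A$; morphisms are $A$-linear $H$-colinear maps. $H$ is a left and right $A$-module by multiplication. *)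

(* Defs.v *)
From HB Require Import structures.
From mathcomp Require Import all_boot all_algebra.
From mathcomp Require Import boolp.

Set Implicit Arguments.
Unset Strict Implicit.
Unset Printing Implicit Defensive.

Import GRing.Theory.
Local Open Scope ring_scope.
Local Open Scope quotient_scope.

(* MathComp has no tensor product of infinite dimensional modules.  [btens]
   is the abelian group generated by symbols m (x) n, subject to biadditivity
   and to (m.s) (x) n = m (x) (s.n), where S acts on M and N through actM and
   actN.  A sequence of pairs stands for the formal sum of its members; the
   symbol (- m) (x) n is the opposite of m (x) n, so that formal sums with
   natural coefficients suffice. *)

Section Balanced.
Variables (S : Type) (M N : zmodType) (actM : S -> M -> M) (actN : S -> N -> N).

Inductive tens_eq : seq (M * N) -> seq (M * N) -> Prop :=
| tens_refl s : tens_eq s s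
| tens_sym s t : tens_eq s t -> tens_eq t s
| tens_trans s t u : tens_eq s t -> tens_eq t u -> tens_eq s u
| tens_cat s s' t t' :
    tens_eq s s' -> tens_eq t t' -> tens_eq (s ++ t) (s' ++ t')
| tens_catC s t : tens_eq (s ++ t) (t ++ s)
| tens_0l n : tens_eq [:: (0, n)] [::]
| tens_Dl m m' n : tens_eq [:: (m + m', n)] [:: (m, n); (m', n)]
| tens_Dr m n n' : tens_eq [:: (m, n + n')] [:: (m, n); (m, n')]
| tens_bal a m n : tens_eq [:: (actM a m, n)] [:: (m, actN a n)].

Definition tens_rel : rel (seq (M * N)) := fun s t => `[< tens_eq s t >].

Lemma tens_rel_refl : reflexive tens_rel.
Proof. by move=> s; apply/asboolP; exact: tens_refl. Qed.

Lemma tens_rel_sym : symmetric tens_rel.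
Proof. by move=> s t; apply/asboolP/asboolP; exact: tens_sym. Qed.

Lemma tens_rel_trans : transitive tens_rel.
Proof.
by move=> t s u /asboolP st /asboolP tu; apply/asboolP; exact: tens_trans st tu.
Qed.

Canonical tens_equiv := EquivRel tens_rel tens_rel_refl tens_rel_sym
  tens_rel_trans.

Definition btens : Type := {eq_quot tens_equiv}.
HB.instance Definition _ := Choice.on btens.
HB.instance Definition _ := EqQuotient.on btens.

Definition tclass (s : seq (M * N)) : btens := \pi s.
Definition trepr (x : btens) : seq (M * N) := repr x.

Lemma treprK x : tclass (trepr x) = x.
Proof. exact: reprK. Qed.

Lemma btens_piP s t : reflect (tens_eq s t) (tclass s == tclass t).
Proof. by rewrite [_ == _]eqmodE; exact: asboolP. Qed.

Lemma btens_eq s t : tens_eq s t -> tclass s = tclass t.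
Proof. by move=> st; apply/eqP/btens_piP. Qed.

Lemma tclassW (Q : btens -> Prop) : (forall s, Q (tclass s)) -> forall x, Q x.
Proof. by move=> h x; rewrite -[x]treprK. Qed.

Lemma btens_reprP s : tens_eq (trepr (tclass s)) s.
Proof. by apply/btens_piP; rewrite treprK. Qed.

Definition tpure (m : M) (n : N) : btens := tclass [:: (m, n)].
Definition btens_zero : btens := tclass [::].
Definition btens_add (x y : btens) : btens := tclass (trepr x ++ trepr y).
Definition btens_opp (x : btens) : btens :=
  tclass [seq (- p.1, p.2) | p <- trepr x].

Lemma btens_add_pi s t :
  btens_add (tclass s) (tclass t) = tclass (s ++ t).
Proof. by apply/btens_eq/tens_cat; exact: btens_reprP. Qed.

Lemma btens_addA : associative btens_add.
Proof.
elim/tclassW=> s; elim/tclassW=> t; elim/tclassW=> u.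
by rewrite !btens_add_pi catA.
Qed.

Lemma btens_addC : commutative btens_add.
Proof.
elim/tclassW=> s; elim/tclassW=> t.
by rewrite !btens_add_pi; exact/btens_eq/tens_catC.
Qed.

Lemma btens_add0 : left_id btens_zero btens_add.
Proof. by elim/tclassW=> s; rewrite btens_add_pi. Qed.

Lemma tens_eq_opp s : tens_eq ([seq (- p.1, p.2) | p <- s] ++ s) [::].
Proof.
elim: s => [|[m n] s IH] /=; first exact: tens_refl.
set t := [seq _ | _ <- s] in IH *.
apply: (@tens_trans _ ([:: (- m, n); (m, n)] ++ (t ++ s))).
  rewrite -cat1s -[(m, n) :: s]cat1s.
  rewrite -[[:: (- m, n); (m, n)]]/([:: (- m, n)] ++ [:: (m, n)]) -catA.
  apply: tens_cat; first exact: tens_refl.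
  rewrite !catA; apply: tens_cat; last exact: tens_refl.
  exact: tens_catC.
rewrite -[[::]]/([::] ++ [::] : seq (M * N)).
apply: tens_cat => //; apply: tens_trans (tens_0l n).
by apply: tens_sym; rewrite -[X in [:: (X, n)]](addNr m); exact: tens_Dl.
Qed.

Lemma btens_addN : left_inverse btens_zero btens_opp btens_add.
Proof.
move=> x; rewrite -[in X in btens_add _ X](treprK x) btens_add_pi.
exact/btens_eq/tens_eq_opp.
Qed.

HB.instance Definition _ :=
  GRing.isZmodule.Build btens
    btens_addA btens_addC btens_add0 btens_addN.

Lemma btens_piD s t : tclass (s ++ t) = tclass s + tclass t.
Proof. by rewrite -btens_add_pi. Qed.

Lemma btens_piE s : tclass s = \sum_(p <- s) tpure p.1 p.2.
Proof.
elim: s => [|[m n] s IH]; first by rewrite big_nil.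
by rewrite -cat1s btens_piD IH big_cons.
Qed.

Lemma btensE (x : btens) : x = \sum_(p <- trepr x) tpure p.1 p.2.
Proof. by rewrite -btens_piE treprK. Qed.

Lemma tpureDl m m' n : tpure (m + m') n = tpure m n + tpure m' n.
Proof. by rewrite -btens_piD; exact/btens_eq/tens_Dl. Qed.

Lemma tpureDr m n n' : tpure m (n + n') = tpure m n + tpure m n'.
Proof. by rewrite -btens_piD; exact/btens_eq/tens_Dr. Qed.

Lemma tpure_bal a m n : tpure (actM a m) n = tpure m (actN a n).
Proof. exact/btens_eq/tens_bal. Qed.

Definition balanced (P : zmodType) (f : M -> N -> P) : Prop :=
  [/\ forall m m' n, f (m + m') n = f m n + f m' n,
      forall m n n', f m (n + n') = f m n + f m n'
    & forall a m n, f (actM a m) n = f m (actN a n)].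

Lemma tpure_balanced : balanced tpure.
Proof. by split; [exact: tpureDl|exact: tpureDr|exact: tpure_bal]. Qed.

(* The additive map sending m (x) n to f m n; meaningful when f is balanced,
   see [tliftE] and [tliftD]. *)
Definition tlift (P : zmodType) (f : M -> N -> P) (x : btens) : P :=
  \sum_(p <- trepr x) f p.1 p.2.

Lemma tlift_pi (P : zmodType) (f : M -> N -> P) s :
  balanced f -> tlift f (tclass s) = \sum_(p <- s) f p.1 p.2.
Proof.
case=> fDl fDr fbal; rewrite /tlift.
have h u v : tens_eq u v -> \sum_(p <- u) f p.1 p.2 = \sum_(p <- v) f p.1 p.2.
  elim=> {u v} //=.
  - by move=> s1 s2 t _ -> _ ->.
  - by move=> s1 s2 t1 t2 _ e1 _ e2; rewrite !big_cat /= e1 e2.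
  - by move=> s1 s2; rewrite !big_cat /= addrC.
  - move=> n; rewrite big_seq1 big_nil /=.
    by apply: (addrI (f 0 n)); rewrite -fDl !addr0.
  - by move=> m m' n; rewrite big_seq1 !big_cons big_nil addr0 fDl.
  - by move=> m n n'; rewrite big_seq1 !big_cons big_nil addr0 fDr.
  - by move=> a m n; rewrite !big_seq1 fbal.
exact/h/btens_reprP.
Qed.

Lemma tliftE (P : zmodType) (f : M -> N -> P) m n :
  balanced f -> tlift f (tpure m n) = f m n.
Proof. by move=> bf; rewrite tlift_pi // big_seq1. Qed.

Lemma tliftD (P : zmodType) (f : M -> N -> P) :
  balanced f -> {morph tlift f : x y / x + y}.
Proof.
move=> bf; elim/tclassW=> s; elim/tclassW=> t.
by rewrite -btens_piD !tlift_pi // big_cat.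
Qed.

Lemma btens_ind (Q : btens -> Prop) :
  Q 0 -> (forall m n x, Q x -> Q (tpure m n + x)) -> forall x, Q x.
Proof.
move=> Q0 QD x; rewrite [x]btensE; elim: (trepr x) => [|p s IH].
  by rewrite big_nil.
by rewrite big_cons; exact: QD.
Qed.

End Balanced.

(* f (x) g, for additive f and g compatible with the actions. *)
Definition tmap (S : Type) (M N M' N' : zmodType)
    (actM : S -> M -> M) (actN : S -> N -> N)
    (actM' : S -> M' -> M') (actN' : S -> N' -> N')
    (f : M -> M') (g : N -> N')
    (x : btens actM actN) : btens actM' actN' :=
  tlift (fun m n => tpure actM' actN' (f m) (g n)) x.
Arguments tmap {S M N M' N' actM actN actM' actN'} f g x.

Section TmapTheory.
Variables (S : Type) (M N M' N' : zmodType).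
Variables (actM : S -> M -> M) (actN : S -> N -> N).
Variables (actM' : S -> M' -> M') (actN' : S -> N' -> N').
Variables (f : {additive M -> M'}) (g : {additive N -> N'}).
Hypothesis f_act : forall a m, f (actM a m) = actM' a (f m).
Hypothesis g_act : forall a n, g (actN a n) = actN' a (g n).

Lemma tmap_balanced :
  balanced actM actN (fun m n => tpure actM' actN' (f m) (g n)).
Proof.
split=> [m m' n|m n n'|a m n].
- by rewrite raddfD tpureDl.
- by rewrite raddfD tpureDr.
- by rewrite f_act g_act tpure_bal.
Qed.

Lemma tmapE m n :
  tmap f g (tpure actM actN m n) = tpure actM' actN' (f m) (g n).
Proof. exact/tliftE/tmap_balanced. Qed.

Lemma tmapD (x y : btens actM actN) :
  tmap f g (x + y) = tmap f g x + tmap f g y :> btens actM' actN'.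
Proof. exact/tliftD/tmap_balanced. Qed.

End TmapTheory.

Section TensorOverField.
Variable k : fieldType.

Definition tens (M N : lmodType k) : Type :=
  @btens k M N ( *:%R) ( *:%R).

Section LmodStructure.
Variables M N : lmodType k.
HB.instance Definition _ := GRing.Zmodule.on (tens M N).

Definition tensor (m : M) (n : N) : tens M N := tpure _ _ m n.

Definition tens_scale (c : k) (x : tens M N) : tens M N :=
  tlift (fun m n => tensor (c *: m) n) x.

Lemma tens_scale_bal c :
  balanced ( *:%R : k -> M -> M) ( *:%R : k -> N -> N)
    (fun m n => tensor (c *: m) n).
Proof.
split=> [m m' n|m n n'|a m n]; rewrite /tensor.
- by rewrite scalerDr tpureDl.
- by rewrite tpureDr.
- by rewrite scalerA mulrC -scalerA tpure_bal.
Qed.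

Lemma tens_scaleE c m n : tens_scale c (tensor m n) = tensor (c *: m) n.
Proof. by rewrite /tens_scale tliftE //; exact: tens_scale_bal. Qed.

Lemma tens_scaleDr : right_distributive tens_scale +%R.
Proof. by move=> c; exact: (tliftD (tens_scale_bal c)). Qed.

Lemma tens_scale0 c : tens_scale c 0 = 0.
Proof. by apply: (addrI (tens_scale c 0)); rewrite -tens_scaleDr !addr0. Qed.

Lemma tens_scaleA a b x : tens_scale a (tens_scale b x) = tens_scale (a * b) x.
Proof.
elim/btens_ind: x => [|m n x IH]; first by rewrite !tens_scale0.
by rewrite !tens_scaleDr IH !tens_scaleE scalerA.
Qed.

Lemma tens_scale1 : left_id 1 tens_scale.
Proof.
elim/btens_ind=> [|m n x IH]; first by rewrite tens_scale0.
by rewrite tens_scaleDr IH tens_scaleE scale1r.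
Qed.

Lemma tens_scaleDl x : {morph tens_scale^~ x : a b / a + b}.
Proof.
move=> a b; elim/btens_ind: x => [|m n x IH].
  by rewrite !tens_scale0 addr0.
by rewrite !tens_scaleDr IH !tens_scaleE scalerDl {1}/tensor tpureDl addrACA.
Qed.

HB.instance Definition _ := GRing.Zmodule_isLmodule.Build k (tens M N)
  tens_scaleA tens_scale1 tens_scaleDr tens_scaleDl.

Lemma tensorZl c m n : c *: tensor m n = tensor (c *: m) n.
Proof. exact: tens_scaleE. Qed.

Lemma tensorZr c m n : c *: tensor m n = tensor m (c *: n).
Proof. by rewrite tensorZl /tensor tpure_bal. Qed.

End LmodStructure.

Definition kbilinear (M N P : lmodType k) (f : M -> N -> P) : Prop :=
  (forall n, linear (f^~ n)) /\ (forall m, linear (f m)).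

Lemma bilinear_balanced (M N P : lmodType k) (f : M -> N -> P) :
  kbilinear f -> balanced ( *:%R : k -> M -> M) ( *:%R : k -> N -> N) f.
Proof.
case=> fl fr.
have fl0 n : f 0 n = 0.
  by apply: (addrI (f 0 n)); have := fl n 1 0 0; rewrite !scale1r !addr0.
have fr0 m : f m 0 = 0.
  by apply: (addrI (f m 0)); have := fr m 1 0 0; rewrite !scale1r !addr0.
split=> [m m' n|m n n'|a m n].
- by have := fl n 1 m m'; rewrite !scale1r.
- by have := fr m 1 n n'; rewrite !scale1r.
- have := fl n a m 0; have := fr m a n 0.
  by rewrite !addr0 fl0 fr0 !addr0 => -> ->.
Qed.

Lemma tensor_bilinear (M N : lmodType k) : kbilinear (@tensor M N).
Proof.
split=> [n|m] a x y.
- by rewrite tensorZl /tensor tpureDl.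
- by rewrite tensorZr /tensor tpureDr.
Qed.

Lemma tlift_tensor (M N P : lmodType k) (f : M -> N -> P) m n :
  kbilinear f -> tlift f (tensor m n) = f m n.
Proof. by move=> bf; exact/tliftE/bilinear_balanced. Qed.

Lemma tlift_linear (M N P : lmodType k) (f : M -> N -> P) :
  kbilinear f -> linear (tlift f : tens M N -> P).
Proof.
move=> bf a x y; have /= bal := bilinear_balanced bf.
rewrite [LHS](tliftD bal); congr (_ + _).
have lift0 : tlift f (0 : tens M N) = 0.
  by apply: (addrI (tlift f (0 : tens M N))); rewrite -[LHS](tliftD bal) !addr0.
elim/btens_ind: x => [|m n x IH]; first by rewrite scaler0 lift0 scaler0.
rewrite -[tpure _ _ m n]/(tensor m n) [a *: _]scalerDr.
rewrite [LHS](tliftD bal) IH [in RHS](tliftD bal) scalerDr; congr (_ + _).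
rewrite tensorZl !tlift_tensor //; case: bf => fl _.
have fl0 : f 0 n = 0.
  by apply: (addrI (f 0 n)); have := fl n 1 0 0; rewrite !scale1r !addr0.
by have := fl n a m 0; rewrite !addr0 fl0 addr0.
Qed.

Definition tassoc (U V W : lmodType k) (x : tens (tens U V) W) :
    tens U (tens V W) :=
  tlift (fun (uv : tens U V) (w : W) =>
    tlift (fun (u : U) (v : V) => tensor u (tensor v w)) uv) x.

(* The bilinear map (u (x) v, u' (x) v') |-> f u u' (x) g v v', for bilinear
   f and g. *)
Definition tmap2 (U U' U'' V V' V'' : lmodType k)
    (f : U -> U' -> U'') (g : V -> V' -> V'')
    (x : tens U V) (y : tens U' V') : tens U'' V'' :=
  tlift (fun (u : U) (v : V) =>
    tlift (fun (u' : U') (v' : V') => tensor (f u u') (g v v')) y) x.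

Lemma tassoc_inner_bilinear (U V W : lmodType k) (w : W) :
  kbilinear (fun (u : U) (v : V) => tensor u (tensor v w)).
Proof.
have lt (M N : lmodType k) := tensor_bilinear M N.
split=> [v|u] a x y; first by rewrite (proj1 (lt _ _)).
by rewrite (proj1 (lt V W)) (proj2 (lt _ _)).
Qed.

Lemma tlift_fun_linear (M N P Q : lmodType k) (f : Q -> M -> N -> P) :
  (forall m n, linear (fun q => f q m n)) ->
  forall x : tens M N, linear (fun q => tlift (f q) x).
Proof.
move=> fl x a q q'; rewrite /tlift scaler_sumr -big_split /=.
by apply: eq_bigr => p _; rewrite fl.
Qed.

Lemma tassoc_bilinear (U V W : lmodType k) :
  kbilinear (fun (uv : tens U V) (w : W) =>
    tlift (fun (u : U) (v : V) => tensor u (tensor v w)) uv).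
Proof.
split=> [w|uv]; first exact/tlift_linear/tassoc_inner_bilinear.
apply: (tlift_fun_linear (f := fun w u v => tensor u (tensor v w))) => u v.
move=> a w w'; rewrite (proj2 (tensor_bilinear V W)).
by rewrite (proj2 (tensor_bilinear _ _)).
Qed.

Lemma tassocE (U V W : lmodType k) (u : U) (v : V) (w : W) :
  tassoc (tensor (tensor u v) w) = tensor u (tensor v w).
Proof.
rewrite /tassoc tlift_tensor; last exact: tassoc_bilinear.
by rewrite tlift_tensor //; exact: tassoc_inner_bilinear.
Qed.

Section Tmap2Theory.
Variables (U U' U'' V V' V'' : lmodType k).
Variables (f : U -> U' -> U'') (g : V -> V' -> V'').
Hypotheses (bf : kbilinear f) (bg : kbilinear g).

Lemma tmap2_inner_bilinear u v :
  kbilinear (fun (u' : U') (v' : V') => tensor (f u u') (g v v')).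
Proof.
split=> [v'|u'] a x y; first by rewrite (proj2 bf) (proj1 (tensor_bilinear _ _)).
by rewrite (proj2 bg) (proj2 (tensor_bilinear _ _)).
Qed.

Lemma tmap2_outer_bilinear (y : tens U' V') :
  kbilinear (fun (u : U) (v : V) =>
    tlift (fun (u' : U') (v' : V') => tensor (f u u') (g v v')) y).
Proof.
split=> [v|u].
- apply: (tlift_fun_linear (f := fun u u' v' => tensor (f u u') (g v v'))).
  by move=> u' v' a x z; rewrite (proj1 bf) (proj1 (tensor_bilinear _ _)).
- apply: (tlift_fun_linear (f := fun v u' v' => tensor (f u u') (g v v'))).
  by move=> u' v' a x z; rewrite (proj1 bg) (proj2 (tensor_bilinear _ _)).
Qed.

Lemma tmap2E u v u' v' :
  tmap2 f g (tensor u v) (tensor u' v') = tensor (f u u') (g v v').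
Proof.
rewrite /tmap2 tlift_tensor; last exact: tmap2_outer_bilinear.
by rewrite tlift_tensor //; exact: tmap2_inner_bilinear.
Qed.

Lemma tmap2_bilinear : kbilinear (tmap2 f g).
Proof.
split=> [y|x]; first exact/tlift_linear/tmap2_outer_bilinear.
apply: (tlift_fun_linear (f := fun (y : tens U' V') (u : U) (v : V) =>
  tlift (fun (u' : U') (v' : V') => tensor (f u u') (g v v')) y)) => u v.
exact/tlift_linear/tmap2_inner_bilinear.
Qed.
End Tmap2Theory.

End TensorOverField.

Section Hopf.
Variable k : fieldType.

Record hopfAlgebra (H : algType k) := HopfAlgebra {
  comul : {linear H -> tens H H};
  counit : {linear H -> k^o};
  antipode : {linear H -> H};
  comulA : forall x, tassoc (tmap comul id (comul x) : tens (tens H H) H) =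
                     tmap id comul (comul x);
  counitl : forall x, tlift (fun a b : H => (counit a : k) *: b) (comul x) = x;
  counitr : forall x, tlift (fun a b : H => (counit b : k) *: a) (comul x) = x;
  comulM : forall x y,
    comul (x * y) = tmap2 (fun a a' : H => a * a') (fun b b' : H => b * b')
                      (comul x) (comul y);
  comul1 : comul 1 = tensor 1 1;
  counitM : forall x y, counit (x * y) = (counit x : k) * (counit y : k);
  counit1 : counit 1 = 1;
  antipodel : forall x,
    tlift (fun a b : H => antipode a * b) (comul x) = (counit x : k)%:A;
  antipoder : forall x,
    tlift (fun a b : H => a * antipode b) (comul x) = (counit x : k)%:A
}.

Record comodule (H : algType k) (hH : hopfAlgebra H) (M : lmodType k) :=
  Comodule {
  coact : {linear M -> tens M H};
  coactA : forall m, tassoc (tmap coact id (coact m) : tens (tens M H) H) =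
                     tmap id (comul hH) (coact m);
  coact_counit : forall m,
    tlift (fun (x : M) (h : H) => (counit hH h : k) *: x) (coact m) = m
}.

Section Inclusion.
Variables (H : algType k) (P : {pred H}) (A : subAlgType P).
Definition incl_fun (a : A) : H := \val a.
HB.instance Definition _ := GRing.RMorphism.copy incl_fun (val : A -> H).
HB.instance Definition _ := GRing.Linear.copy incl_fun (val : A -> H).
Definition incl : {lrmorphism A -> H} := incl_fun.
End Inclusion.

(* The inclusion A (x) H -> H (x) H is iota (x) id, where iota is the
   inclusion of A. *)
Definition right_coideal (H : algType k) (hH : hopfAlgebra H) (A : algType k)
    (iota : {lrmorphism A -> H}) : Prop :=
  forall a : A, exists t : tens A H, tmap iota id t = comul hH (iota a).

End Hopf.

(* A right module over A is a left module over the converse ring A^c, so m.a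
   is written (a : A^c) *: m. *)

Notation rmodType A := (lmodType A^c).

Definition rtimes (A : pzRingType) (M : rmodType A) (m : M) (a : A) : M :=
  (a : A^c) *: m.

(* The vector space underlying a right module over a k-algebra. *)
Definition kspace (k : fieldType) (A : algType k) (M : rmodType A) : Type := M.

Section Kspace.
Variables (k : fieldType) (A : algType k) (M : rmodType A).
HB.instance Definition _ := GRing.Zmodule.on (kspace M).

Definition kspace_scale (c : k) (m : kspace M) : kspace M :=
  rtimes (m : M) c%:A.

Lemma kspace_scaleA a b m :
  kspace_scale a (kspace_scale b m) = kspace_scale (a * b) m.
Proof.
rewrite /kspace_scale /rtimes scalerA; congr (_ *: _).
rewrite -[LHS]/((b%:A : A) * a%:A).
by rewrite -scalerAl mul1r scalerA mulrC.
Qed.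

Lemma kspace_scale1 : left_id 1 kspace_scale.
Proof. by move=> m; rewrite /kspace_scale scale1r; exact: scale1r. Qed.

Lemma kspace_scaleDr : right_distributive kspace_scale +%R.
Proof. by move=> c m m'; exact: scalerDr. Qed.

Lemma kspace_scaleDl m : {morph kspace_scale^~ m : a b / a + b}.
Proof. by move=> a b; rewrite /kspace_scale scalerDl; exact: scalerDl. Qed.

HB.instance Definition _ := GRing.Zmodule_isLmodule.Build k (kspace M)
  kspace_scaleA kspace_scale1 kspace_scaleDr kspace_scaleDl.
End Kspace.

(* H as a left and as a right A-module, along iota : A -> H. *)
Definition lregmod (A H : pzRingType) (iota : {rmorphism A -> H}) : Type := H.
Definition rregmod (A H : pzRingType) (iota : {rmorphism A -> H}) : Type := H.

Section RegularModules.
Variables (A H : pzRingType) (iota : {rmorphism A -> H}).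
HB.instance Definition _ := GRing.Zmodule.on (lregmod iota).
HB.instance Definition _ := GRing.Zmodule.on (rregmod iota).

Definition lreg_scale (a : A) (h : lregmod iota) : lregmod iota :=
  iota a * (h : H).
Definition rreg_scale (a : A^c) (h : rregmod iota) : rregmod iota :=
  (h : H) * iota a.

Lemma lreg_scaleA a b h : lreg_scale a (lreg_scale b h) = lreg_scale (a * b) h.
Proof. by rewrite /lreg_scale rmorphM mulrA. Qed.
Lemma lreg_scale1 : left_id 1 lreg_scale.
Proof. by move=> h; rewrite /lreg_scale rmorph1; exact: mul1r. Qed.
Lemma lreg_scaleDr : right_distributive lreg_scale +%R.
Proof. by move=> a h h'; exact: mulrDr. Qed.
Lemma lreg_scaleDl h : {morph lreg_scale^~ h : a b / a + b}.
Proof. by move=> a b; rewrite /lreg_scale rmorphD; exact: mulrDl. Qed.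

HB.instance Definition _ := GRing.Zmodule_isLmodule.Build A (lregmod iota)
  lreg_scaleA lreg_scale1 lreg_scaleDr lreg_scaleDl.

Lemma rreg_scaleA a b h : rreg_scale a (rreg_scale b h) = rreg_scale (a * b) h.
Proof.
rewrite /rreg_scale -mulrA; congr (_ * _).
exact/esym/(rmorphM iota (b : A) (a : A)).
Qed.
Lemma rreg_scale1 : left_id 1 rreg_scale.
Proof.
by move=> h; rewrite -[RHS](mulr1 (h : H)) -(rmorph1 iota).
Qed.
Lemma rreg_scaleDr : right_distributive rreg_scale +%R.
Proof. by move=> a h h'; exact: mulrDl. Qed.
Lemma rreg_scaleDl h : {morph rreg_scale^~ h : a b / a + b}.
Proof.
move=> a b; rewrite /rreg_scale (rmorphD iota (a : A) (b : A)); exact: mulrDr.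
Qed.

HB.instance Definition _ := GRing.Zmodule_isLmodule.Build A^c (rregmod iota)
  rreg_scaleA rreg_scale1 rreg_scaleDr rreg_scaleDl.
End RegularModules.

(* When iota is the inclusion of a subalgebra, iota (x) id is injective, as k
   is a field, so the t below is the unique element of A (x) H representing the comultiplication of a. *)
Record relHopfModule (k : fieldType) (H : algType k) (hH : hopfAlgebra H)
    (A : algType k) (iota : {lrmorphism A -> H}) (M : rmodType A) :=
  RelHopfModule {
  rhm_comodule : comodule hH (kspace M);
  rhm_coactM : forall (m : M) (a : A) (t : tens A H),
    tmap iota id t = comul hH (iota a) ->
    coact rhm_comodule (rtimes m a : M) =
    tmap2 (fun (x : kspace M) (b : A) => rtimes (x : M) b : kspace M)
          (fun h h' : H => h * h') (coact rhm_comodule m) t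
}.

Definition exact_at (X Y Z : zmodType) (u : X -> Y) (v : Y -> Z) : Prop :=
  forall y, v y = 0 <-> exists x, u x = y.

Section Flatness.
Variable A : nzRingType.

Definition tensA (M : rmodType A) (N : lmodType A) : Type :=
  @btens A M N (fun a m => rtimes m a) ( *:%R).
HB.instance Definition _ M N := GRing.Zmodule.on (tensA M N).

Definition tmapA (M M' : rmodType A) (N N' : lmodType A)
    (f : {linear M -> M'}) (g : {linear N -> N'}) (x : tensA M N) :
  tensA M' N' := tmap f g x.

Definition right_flat (M : rmodType A) : Prop :=
  forall (X Y Z : lmodType A) (u : {linear X -> Y}) (v : {linear Y -> Z}),
    exact_at u v ->
    exact_at (tmapA (idfun : {linear M -> M}) u)
             (tmapA (idfun : {linear M -> M}) v).

Definition right_faithfully_flat (M : rmodType A) : Prop :=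
  forall (X Y Z : lmodType A) (u : {linear X -> Y}) (v : {linear Y -> Z}),
    exact_at u v <->
    exact_at (tmapA (idfun : {linear M -> M}) u)
             (tmapA (idfun : {linear M -> M}) v).

Definition left_faithfully_flat (N : lmodType A) : Prop :=
  forall (X Y Z : rmodType A) (u : {linear X -> Y}) (v : {linear Y -> Z}),
    exact_at u v <->
    exact_at (tmapA u (idfun : {linear N -> N}))
             (tmapA v (idfun : {linear N -> N})).

End Flatness.

Definition projective_module (R : pzRingType) (P : lmodType R) : Prop :=
  forall (X Y : lmodType R) (g : {linear X -> Y}) (f : {linear P -> Y}),
    (forall y, exists x, g x = y) ->
    exists h : {linear P -> X}, forall p, g (h p) = f p.

Definition module_generator (R : pzRingType) (P : lmodType R) : Prop :=
  forall (X Y : lmodType R) (f g : {linear X -> Y}),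
    (forall (h : {linear P -> X}) p, f (h p) = g (h p)) -> forall x, f x = g x.

(* Main.v *)
(* Write A+ for the kernel of the counit on A. If L is a subobject of Y in
   M_A^H, then Y/L is flat, so Y/L embeds into (Y/L) (x)_A H. The map
   y (x) h |-> y_(0) (x) S(y_(1)) h from Y (x) H to (Y/L) (x)_A H kills
   Y A+ (x) H, whence a Nakayama lemma: if K is a subobject with
   K <= L + Y A+, then K <= L. Now let V be a finite dimensional subcomodule of
   an object M. The kernel K of V (x) A -> M is generated by a finite
   dimensional subcomodule W with the same image as K in V (x) A / V (x) A+, so
   VA is finitely presented; being flat, it is projective. As this applies to
   all quotients of M, Zorn's lemma on partial lifts defined on subobjects
   shows that M is projective.

   The trace ideal of M <> 0 in A is a nonzero subobject of A, hence not
   contained in A+, hence equal to A by the Nakayama lemma: M is a generator.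
   Being flat, it is then faithfully flat; H itself is such an object.

   For the left module H, the map n (x) h |-> n (x) S(h) identifies N (x)_A H
   with (N (x) H) / (N (x) H) A+, where N (x) H is the object of M_A^H with
   diagonal action. On objects, Y |-> Y / Y A+ is exact by flatness of the
   quotients, and faithful by the Nakayama lemma. *)
Require Import Defs.
From HB Require Import structures.
From mathcomp Require Import all_boot all_algebra.
From mathcomp Require Import boolp.
From mathcomp Require classical_sets.

Set Implicit Arguments.
Unset Strict Implicit.
Unset Printing Implicit Defensive.

Import GRing.Theory.
Local Open Scope ring_scope.
Local Open Scope quotient_scope.

(** Flatness is granted only for modules that carry a coaction, and this shapes every construction.
    Partial lifts live on subobjects because the quotient by the domain must again be an object:
    there the next element is caught by a finite dimensional subcomodule. Finite presentation is the
    hard point, as A need not be noetherian: a kernel in V (x) A is controlled modulo A+, where V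
    (x) A becomes the finite dimensional space V, and Nakayama brings the generators back. An
    arbitrary right module N enters the left-hand statement through N (x) H, which is an object
    whatever N is. Flatness acts through matrices: a relation v B = 0 in a flat module factors as v
    = w C with C B = 0. Since k is a field, a submodule L is a subcomodule exactly when it is stable
    under (id (x) xi) rho for all functionals xi on H, so subobjects are tested inside M rather than
    in M (x) H. *)

(** * Submodules, Zorn's lemma, and functionals on vector spaces *)

Record submodule (R : pzRingType) (V : lmodType R) := Submodule {
  in_sub :> V -> Prop;
  sub0 : in_sub 0;
  subD : forall x y, in_sub x -> in_sub y -> in_sub (x + y);
  subZ : forall a x, in_sub x -> in_sub (a *: x)
}.

Section Submodules.
Variables (R : pzRingType) (V : lmodType R).
Implicit Type S : submodule V.

Lemma subN S x : S x -> S (- x).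
Proof. by move=> Sx; rewrite -scaleN1r; exact: subZ. Qed.

Lemma subB S x y : S x -> S y -> S (x - y).
Proof. by move=> Sx Sy; apply: subD => //; exact: subN. Qed.

Lemma sub_sum S (I : Type) (r : seq I) (P : pred I) (F : I -> V) :
  (forall i, P i -> S (F i)) -> S (\sum_(i <- r | P i) F i).
Proof.
by move=> SF; apply: (big_ind (in_sub S)); [exact: sub0|exact: subD|].
Qed.

Definition sub_zero : submodule V.
Proof.
exists (fun x => x = 0) => // [x y -> ->|a x ->]; first by rewrite addr0.
by rewrite scaler0.
Defined.

Definition sub_add (S T : submodule V) : submodule V.
Proof.
exists (fun x => exists y z, [/\ S y, T z & x = y + z]).
- by exists 0, 0; rewrite addr0; split=> //; exact: sub0.
- move=> _ _ [y [z [Sy Tz ->]]] [y' [z' [Sy' Tz' ->]]].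
  by exists (y + y'), (z + z'); rewrite addrACA; split=> //; exact: subD.
- move=> a _ [y [z [Sy Tz ->]]]; exists (a *: y), (a *: z).
  by rewrite scalerDr; split=> //; exact: subZ.
Defined.

Definition sub_le (S T : submodule V) := forall x, S x -> T x.

(** Zorn's lemma for inclusion. The union of a chain enters as any submodule [U] with the right
    members, which hides its construction; [S0] bounds the empty chain. *)
Lemma zorn_submodule (Q : submodule V -> Prop) (S0 : submodule V) :
  Q S0 ->
  (forall (C : submodule V -> Prop) (U : submodule V),
     (exists S, C S) -> (forall S, C S -> Q S) ->
     (forall S T, C S -> C T -> sub_le S T \/ sub_le T S) ->
     (forall x, U x <-> exists2 S, C S & S x) -> Q U) ->
  exists2 S, Q S & forall T, Q T -> sub_le S T -> sub_le T S.
Proof.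
move=> QS0 Qchain; pose T := {S : submodule V | Q S}.
pose leT (S S' : T) := `[< sub_le (sval S) (sval S') >].
have [||C totC|S maxS] :=
  @classical_sets.ZL_preorder T (exist _ S0 QS0) leT.
- by move=> S; apply/asboolP.
- move=> S S' S'' /asboolP le1 /asboolP le2; apply/asboolP => x Sx.
  exact/le2/le1.
- have [[S CS]|C0] := pselect (exists s, C s); last first.
    by exists (exist _ S0 QS0) => s Cs; case: C0; exists s.
  pose inU x := exists2 s, C s & sval s x.
  have tot (S1 S2 : T) : C S1 -> C S2 ->
      sub_le (sval S1) (sval S2) \/ sub_le (sval S2) (sval S1).
    by move=> C1 C2; have [/asboolP|/asboolP] := totC _ _ C1 C2; [left|right].
  have U0 : inU 0 by exists S => //; exact: sub0.
  have UD x y : inU x -> inU y -> inU (x + y).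
    move=> [S1 C1 S1x] [S2 C2 S2y]; have [le|le] := tot _ _ C1 C2.
      by exists S2 => //; apply: subD => //; exact: le.
    by exists S1 => //; apply: subD => //; exact: le.
  have UZ a x : inU x -> inU (a *: x).
    by move=> [S1 C1 S1x]; exists S1 => //; exact: subZ.
  pose U := Submodule U0 UD UZ.
  have QU : Q U.
    apply: (Qchain (fun S => exists2 s, C s & S = sval s)).
    - by exists (sval S); exists S.
    - by move=> _ [S' _ ->]; case: S'.
    - by move=> _ _ [S1 C1 ->] [S2 C2 ->]; exact: tot.
    - move=> x; split=> [[S' CS' S'x]|[_ [S' CS' ->] S'x]].
        by exists (sval S') => //; exists S'.
      by exists S'.
  by exists (exist _ U QU) => S' CS'; apply/asboolP => x S'x; exists S'.
- exists (sval S); first by case: (S).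
  move=> S' QS' le1; have := maxS (exist _ S' QS').
  by move=> /(_ _)/asboolP; apply; apply/asboolP.
Qed.

End Submodules.

Arguments sub_zero {R V}.

Section Span.
Variables (R : pzRingType) (V : lmodType R).

Definition span_sub (n : nat) (v : 'I_n -> V) : submodule V.
Proof.
exists (fun x => exists c : 'I_n -> R, x = \sum_i c i *: v i).
- by exists (fun=> 0); rewrite big1 // => i _; rewrite scale0r.
- move=> _ _ [c ->] [d ->]; exists (fun i => c i + d i).
  by rewrite -big_split; apply: eq_bigr => i _; rewrite scalerDl.
- move=> a _ [c ->]; exists (fun i => a * c i).
  by rewrite scaler_sumr; apply: eq_bigr => i _; rewrite scalerA.
Defined.

Lemma span_gen (n : nat) (v : 'I_n -> V) i : span_sub v (v i).
Proof.
exists (fun j => (j == i)%:R);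
  rewrite (bigD1 i) //= eqxx scale1r big1 ?addr0 //.
by move=> j /negPf->; rewrite scale0r.
Qed.

Lemma span_le (n : nat) (v : 'I_n -> V) (S : submodule V) :
  (forall i, S (v i)) -> sub_le (span_sub v) S.
Proof. by move=> Sv _ [c ->]; apply: sub_sum => i _; exact: subZ. Qed.

End Span.

Section Functionals.
Variable k : fieldType.

(** Among the subspaces that contain [U] and avoid [v], a maximal one is a complement of the line k
    v; [f] is the coordinate along [v]. *)
Lemma sub_separation (V : lmodType k) (U : submodule V) (v : V) :
  ~ U v -> exists2 f : {linear V -> k^o}, f v = 1 & forall u, U u -> f u = 0.
Proof.
move=> Uv.
have [|C W [S0 CS0] CQ _ CW|S [US Sv] maxS] :=
  @zorn_submodule _ _ (fun S => sub_le U S /\ ~ S v) U.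
- by split.
- split=> [u Uu|/CW[S CS Sv]]; last by case: (CQ _ CS).
  by apply/CW; exists S0 => //; case: (CQ _ CS0) => + _; exact.
have ex x : exists c : k, S (x - c *: v).
  have [Sx|Sx] := pselect (S x); first by exists 0; rewrite scale0r subr0.
  have in1 : span_sub (fun _ : 'I_1 => x) x.
    exact: (span_gen (fun _ : 'I_1 => x) ord0).
  pose T := sub_add S (span_sub (fun _ : 'I_1 => x)).
  have ST : sub_le S T.
    by move=> y Sy; exists y, 0; rewrite addr0; split=> //; exact: sub0.
  have Tx : T x by exists 0, x; rewrite add0r; split=> //; exact: sub0.
  have [[s [_ [Ss [c ->] vE]]]|Tv] := pselect (T v); last first.
    case: Sx; apply: (maxS T) => //; split=> // u Uu; exact/ST/US.
  move: vE; rewrite big_ord1; set d := c _ => vE.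
  have d0 : d != 0.
    by apply/eqP => d0; case: Sv; rewrite vE d0 scale0r addr0.
  exists d^-1; rewrite vE scalerDr scalerA mulVf // scale1r.
  by rewrite opprD addrCA subrr addr0; apply/subN/subZ.
have uniq c d x : S (x - c *: v) -> S (x - d *: v) -> c = d.
  move=> Sc Sd; apply: contrapT => /eqP; rewrite -subr_eq0 => cd0; case: Sv.
  have := subZ (c - d)^-1 (subB Sd Sc).
  by rewrite opprB [X in _ *: X]addrC addrA subrK -scalerBl scalerA mulVf //
    scale1r.
have [f fP] := choice ex.
have flin : linear (f : V -> k^o).
  move=> a x y; apply: (uniq _ _ (a *: x + y)) => //.
  change (S (a *: x + y - (a * f x + f y) *: v)).
  rewrite scalerDl -scalerA opprD addrACA -scalerBr; apply: subD => //;
    exact: subZ.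
pose M := GRing.isLinear.Build _ _ _ _ (f : V -> k^o) flin.
pose g : {linear V -> k^o} := HB.pack (f : V -> k^o) M.
exists g => [|u Uu].
- by apply: (uniq _ _ v) => //; rewrite scale1r subrr; exact: sub0.
- by apply: (uniq _ _ u) => //; rewrite scale0r subr0; exact: US.
Qed.

(** The identity on the given vectors is realized by a map of finite rank. The vectors fixed by such
    a map form a subspace [U]; if the next vector [x] is outside, a functional that vanishes on [U]
    and is 1 at [x], times the defect of [x], corrects the map at [x] without disturbing [U]. *)
Lemma finite_dual (V : lmodType k) (s : seq V) :
  exists l : seq ({linear V -> k^o} * V),
    {in s, forall v, v = \sum_(p <- l) (p.1 v : k) *: p.2}.
Proof.
elim: s => [|x s [l lP]]; first by exists [::].
have fix0 : 0 = \sum_(p <- l) (p.1 0 : k) *: p.2 :> V.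
  by rewrite big1 // => p _; rewrite linear0 scale0r.
have fixD u v : u = \sum_(p <- l) (p.1 u : k) *: p.2 ->
    v = \sum_(p <- l) (p.1 v : k) *: p.2 ->
    u + v = \sum_(p <- l) (p.1 (u + v) : k) *: p.2.
  move=> {1}-> {1}->; rewrite -big_split; apply: eq_bigr => p _.
  by rewrite linearD scalerDl.
have fixZ c v : v = \sum_(p <- l) (p.1 v : k) *: p.2 ->
    c *: v = \sum_(p <- l) (p.1 (c *: v) : k) *: p.2.
  move=> {1}->; rewrite scaler_sumr; apply: eq_bigr => p _.
  by rewrite scalerA [p.1 (c *: v)]linearZ.
pose U := Submodule fix0 fixD fixZ.
have [Ux|Ux] := pselect (U x).
  by exists l => v; rewrite inE => /orP[/eqP->|/lP].
have [f fx fU] := sub_separation Ux.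
exists ((f, x - \sum_(p <- l) (p.1 x : k) *: p.2) :: l) => v.
rewrite inE big_cons /= => /orP[/eqP->|vs].
  by rewrite fx scale1r subrK.
by rewrite fU ?scale0r ?add0r; exact: lP.
Qed.

End Functionals.

(** * Tensor products over a field *)

(* The target may be a mere abelian group, such as a tensor product over A,
   for which the [kbilinear] of Defs makes no sense. *)
Notation kbal f := (balanced ( *:%R ) ( *:%R ) f).

Section TensorToolkit.
Variable k : fieldType.

Section Binary.
Variables (M N : lmodType k) (P : zmodType).
Implicit Types (f g : M -> N -> P) (t : tens M N).

Lemma tliftT f m n : kbal f -> tlift f (tensor m n) = f m n.
Proof. by move=> bf; exact: tliftE. Qed.

Lemma tliftDr f t u : kbal f -> tlift f (t + u) = tlift f t + tlift f u.
Proof. by move=> bf; exact: (tliftD bf). Qed.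

Lemma tlift0 f : kbal f -> tlift f (0 : tens M N) = 0.
Proof. by move=> bf; apply: (addrI (tlift f (0 : tens M N)));
  rewrite -tliftDr // !addr0. Qed.

Lemma tlift_sum f (I : Type) (r : seq I) (Q : pred I) (F : I -> tens M N) :
  kbal f -> tlift f (\sum_(i <- r | Q i) F i) = \sum_(i <- r | Q i) tlift f (F
    i).
Proof.
move=> bf; apply: (big_morph (tlift f)) => [x y|]; first exact: tliftDr.
exact: tlift0.
Qed.

Lemma eq_tlift f g t : (forall m n, f m n = g m n) -> tlift f t = tlift g t.
Proof. by move=> fg; apply: eq_bigr => p _; exact: fg. Qed.

Lemma tlift_comp (Q : zmodType) (phi : {additive P -> Q}) f t :
  phi (tlift f t) = tlift (fun m n => phi (f m n)) t.
Proof. exact: raddf_sum. Qed.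

Lemma tliftDf f g t :
  tlift (fun m n => f m n + g m n) t = tlift f t + tlift g t.
Proof. exact: big_split. Qed.

Lemma tlift_sumf (I : Type) (r : seq I) (Q : pred I) (F : I -> M -> N -> P) t :
  tlift (fun m n => \sum_(i <- r | Q i) F i m n) t =
  \sum_(i <- r | Q i) tlift (F i) t.
Proof. exact: exchange_big. Qed.

End Binary.

Lemma tlift_zero (M N : lmodType k) (P : zmodType) (t : tens M N) :
  tlift (fun _ _ => 0 : P) t = 0.
Proof. exact: big1. Qed.

Section Rules.
Variables (M N : lmodType k).
Implicit Types (m : M) (n : N).

Lemma tensorDl m m' n : tensor (m + m') n = tensor m n + tensor m' n.
Proof. exact: tpureDl. Qed.
Lemma tensorDr m n n' : tensor m (n + n') = tensor m n + tensor m n'.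
Proof. exact: tpureDr. Qed.
Lemma tensorZl' c m n : tensor (c *: m) n = c *: tensor m n.
Proof. by rewrite tensorZl. Qed.
Lemma tensorZr' c m n : tensor m (c *: n) = c *: tensor m n.
Proof. by rewrite tensorZr. Qed.

Lemma tensor_kbal : kbal (@tensor k M N).
Proof. exact: tpure_balanced. Qed.

Lemma tensor0l n : tensor (0 : M) n = 0.
Proof. by rewrite -(scale0r (0 : M)) tensorZl' scale0r. Qed.
Lemma tensor0r m : tensor m (0 : N) = 0.
Proof. by rewrite -(scale0r (0 : N)) tensorZr' scale0r. Qed.

Lemma map_tensor_kbal (L : lmodType k) (f : {linear L -> M}) :
  kbal (fun l n => tensor (f l) n).
Proof.
split=> [l l' n|l n n'|a l n]; first by rewrite linearD tensorDl.
- exact: tensorDr.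
- by rewrite linearZ tensorZl' tensorZr'.
Qed.

Lemma tensor_suml (I : Type) (r : seq I) (Q : pred I) (F : I -> M) n :
  tensor (\sum_(i <- r | Q i) F i) n = \sum_(i <- r | Q i) tensor (F i) n.
Proof.
apply: (big_morph (fun m => tensor m n)) => [x y|]; first exact: tensorDl.
exact: tensor0l.
Qed.

Lemma tensor_sumr (I : Type) (r : seq I) (Q : pred I) m (F : I -> N) :
  tensor m (\sum_(i <- r | Q i) F i) = \sum_(i <- r | Q i) tensor m (F i).
Proof.
apply: (big_morph (tensor m)) => [x y|]; first exact: tensorDr.
exact: tensor0r.
Qed.

Lemma tlift_tensorK (t : tens M N) : tlift (@tensor k M N) t = t.
Proof. by rewrite [RHS]btensE. Qed.

Lemma tliftZ (P : zmodType) (f : M -> N -> P) c (t : tens M N) :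
  kbal f -> tlift f (c *: t) = tlift (fun m n => f (c *: m) n) t.
Proof.
move=> bf; have {1}-> : t = \sum_(p <- trepr t) tensor p.1 p.2 by exact: btensE.
rewrite scaler_sumr tlift_sum //.
by apply: eq_bigr => p _; rewrite tensorZl tliftT.
Qed.

End Rules.

Lemma tensor_tliftr (M N U V : lmodType k) (m : M) (f : U -> V -> N)
    (t : tens U V) :
  tensor m (tlift f t) = tlift (fun u v => tensor m (f u v)) t.
Proof. exact: tensor_sumr. Qed.

Lemma tensor_tliftl (M N U V : lmodType k) (n : N) (f : U -> V -> M)
    (t : tens U V) :
  tensor (tlift f t) n = tlift (fun u v => tensor (f u v) n) t.
Proof. exact: tensor_suml. Qed.

Lemma tlift_tlift (M N U V : lmodType k) (P : zmodType) (g : U -> V -> P)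
    (f : M -> N -> tens U V) (t : tens M N) :
  kbal g -> tlift g (tlift f t) = tlift (fun m n => tlift g (f m n)) t.
Proof. exact: tlift_sum. Qed.

Lemma tlift_exchange (M N U V : lmodType k) (P : zmodType)
    (f : M -> N -> U -> V -> P) (t : tens M N) (u : tens U V) :
  tlift (fun m n => tlift (f m n) u) t =
  tlift (fun x y => tlift (fun m n => f m n x y) t) u.
Proof. exact: exchange_big. Qed.

Lemma tlift_tmap (M N M' N' : lmodType k) (P : zmodType) (g : M' -> N' -> P)
    (a : M -> M') (b : N -> N') (t : tens M N) :
  kbal g ->
  tlift g (tmap a b t : tens M' N') = tlift (fun m n => g (a m) (b n)) t.
Proof.
by move=> bg; rewrite [LHS]tlift_tlift //; apply: eq_tlift => m n;
  exact: tliftT.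
Qed.

Lemma tmapk (M N M' : lmodType k) (f : M -> M') (t : tens M N) :
  tmap f id t = tlift (fun m n => tensor (f m) n) t :> tens M' N.
Proof. by []. Qed.

Lemma tlift_tmap2 (U U' U'' V V' V'' : lmodType k) (P : zmodType)
    (g : U'' -> V'' -> P) (a : U -> U' -> U'') (b : V -> V' -> V'')
    (t : tens U V) (t' : tens U' V') :
  kbal g ->
  tlift g (tmap2 a b t t') =
  tlift (fun u v => tlift (fun u' v' => g (a u u') (b v v')) t') t.
Proof.
move=> bg; rewrite [LHS]tlift_tlift //; apply: eq_tlift => u v.
by rewrite tlift_tlift //; apply: eq_tlift => u' v'; exact: tliftT.
Qed.

(** Trilinearity over k, split into the two balancedness conditions that iterated [tlift] asks for
    in either bracketing of a threefold tensor product. *)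
Definition ktri (M N Q : lmodType k) (P : zmodType) (f : M -> N -> Q -> P) :=
  (forall q, kbal (fun m n => f m n q)) /\ (forall m, kbal (f m)).

Lemma kbal_tlift (M N U V : lmodType k) (P : zmodType)
    (f : M -> N -> U -> V -> P) (t : tens U V) :
  (forall u v, kbal (fun m n => f m n u v)) ->
  kbal (fun m n => tlift (f m n) t).
Proof.
move=> bf; split=> [m m' n|m n n'|a m n]; rewrite -?tliftDf;
  by apply: eq_tlift => u v; case: (bf u v).
Qed.

Lemma kbal_tlift_tens (M U V : lmodType k) (P : zmodType)
    (f : M -> U -> V -> P) :
  ktri f -> kbal (fun m (t : tens U V) => tlift (f m) t).
Proof.
case=> f1 f2; split=> [m m' t|m t t'|a m t].
- by rewrite -tliftDf; apply: eq_tlift => u v; case: (f1 v) => + _ _; apply.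
- exact/tliftDr/f2.
- rewrite tliftZ //; apply: eq_tlift => u v.
  by case: (f1 v) => _ _; apply.
Qed.

Lemma kbal_tlift_linr (M N U V : lmodType k) (P : zmodType)
    (f : M -> U -> V -> P) (D : {linear N -> tens U V}) :
  ktri f -> kbal (fun m n => tlift (f m) (D n)).
Proof.
move=> /kbal_tlift_tens[f1 f2 f3]; split=> [m m' n|m n n'|a m n].
- exact: f1.
- by rewrite linearD; exact: f2.
- by rewrite linearZ; exact: f3.
Qed.

Lemma kbal_tlift_linl (N M U V : lmodType k) (P : zmodType)
    (f : U -> V -> N -> P) (D : {linear M -> tens U V}) :
  ktri f -> kbal (fun m n => tlift (fun u v => f u v n) (D m)).
Proof.
case=> f1 f2; split=> [m m' n|m n n'|a m n].
- by rewrite linearD tliftDr.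
- by rewrite -tliftDf; apply: eq_tlift => u v; case: (f2 u).
- rewrite linearZ /= tliftZ //; apply: eq_tlift => u v.
  case: (f2 u) => _ _ <-.
  by case: (f1 n) => _ _ ->.
Qed.

Section Sweedler.
Variables (M H : lmodType k) (rho : M -> tens M H) (Delta : H -> tens H H).

(* [tlift f (rho m)] is the Sweedler sum of the f m_(0) m_(1). *)
Lemma tlift_coassoc (P : zmodType) (f : M -> H -> H -> P) (m : M) :
  tassoc (tmap rho id (rho m) : tens (tens M H) H) = tmap id Delta (rho m) ->
  ktri f ->
  tlift (fun m h => tlift (fun m0 h1 => f m0 h1 h) (rho m)) (rho m) =
  tlift (fun m h => tlift (f m) (Delta h)) (rho m).
Proof.
move=> /(congr1 (tlift (fun m (t : tens H H) => tlift (f m) t))) eqA tf.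
have bf := kbal_tlift_tens tf; have [f1 f2] := tf.
rewrite [RHS in _ = RHS]tlift_tmap // in eqA; rewrite -{}eqA.
rewrite /tassoc /tmap (tlift_tlift _ _ (bilinear_balanced (tassoc_bilinear _ _
  _))).
rewrite tlift_tlift //; apply: eq_tlift => u h.
rewrite [X in _ = tlift _ X](tliftT _ _ (bilinear_balanced (tassoc_bilinear _ _
  _))).
rewrite tlift_tlift //; apply: eq_tlift => v h'.
by rewrite !tliftT.
Qed.

(** Converse of [tlift_coassoc]: it is enough to test on the universal trilinear map m, h, h' |-> m
    (x) (h (x) h'). Coassociativity of every object built below is proved this way. *)
Lemma coassoc_tlift (m : M) :
  (forall f : M -> H -> H -> tens M (tens H H), ktri f ->
   tlift (fun m h => tlift (fun m0 h1 => f m0 h1 h) (rho m)) (rho m) =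
   tlift (fun m h => tlift (f m) (Delta h)) (rho m)) ->
  tassoc (tmap rho id (rho m) : tens (tens M H) H) = tmap id Delta (rho m).
Proof.
move=> eqf; rewrite /tassoc /tmap.
rewrite (tlift_tlift _ _ (bilinear_balanced (tassoc_bilinear _ _ _))).
transitivity (tlift (fun m h =>
    tlift (fun m0 h1 => tensor m0 (tensor h1 h)) (rho m)) (rho m)).
  apply: eq_tlift => u h.
  by rewrite (tliftT _ _ (bilinear_balanced (tassoc_bilinear _ _ _))).
rewrite (eqf (fun m h h' => tensor m (tensor h h'))).
  apply: eq_tlift => u h; rewrite -[in RHS](tlift_tensorK (Delta h)).
  by rewrite -tensor_tliftr.
split=> [h'|u].
  split=> *; rewrite ?tensorDl ?tensorDr ?tensorZl' ?tensorZr' //.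
by split=> *; rewrite ?tensorDl ?tensorDr ?tensorZl' ?tensorZr' // tensorDr.
Qed.

End Sweedler.

Section Slices.
Variables (M H : lmodType k).
Implicit Types (xi : {linear H -> k^o}) (t : tens M H).

(** The contraction id (x) xi. Over a field these contractions separate tensors ([slice_inj]), and
    every tensor can be rebuilt from its own slices ([slice_rep]). *)
Definition slice xi t : M := tlift (fun m h => (xi h : k) *: m) t.

Lemma slice_kbal xi : kbal (fun (m : M) (h : H) => (xi h : k) *: m).
Proof.
split=> [m m' n|m n n'|a m n]; first exact: scalerDr.
- by rewrite linearD scalerDl.
- by rewrite [xi (a *: n)]linearZ scalerA mulrC.
Qed.

Lemma sliceT xi m h : slice xi (tensor m h) = (xi h : k) *: m.
Proof. exact/tliftT/slice_kbal. Qed.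

Lemma slice_is_linear xi : linear (slice xi).
Proof.
move=> a t u; rewrite /slice tliftDr ?tliftZ; try exact: slice_kbal.
congr (_ + _); rewrite /tlift scaler_sumr; apply: eq_bigr => p _.
by rewrite !scalerA mulrC.
Qed.

HB.instance Definition _ xi :=
  GRing.isLinear.Build _ _ _ _ (slice xi) (slice_is_linear xi).

Lemma slice_sum xi (I : Type) (r : seq I) (Q : pred I) (F : I -> tens M H) :
  slice xi (\sum_(i <- r | Q i) F i) = \sum_(i <- r | Q i) slice xi (F i).
Proof. exact/tlift_sum/slice_kbal. Qed.

Lemma slice0 xi : slice xi 0 = 0.
Proof. exact: linear0. Qed.
Lemma sliceB xi t u : slice xi (t - u) = slice xi t - slice xi u.
Proof. exact: linearB. Qed.
Lemma sliceZ xi c t : slice xi (c *: t) = c *: slice xi t.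
Proof. exact: linearZ. Qed.

Lemma slice_tlift (U V : lmodType k) xi (f : U -> V -> tens M H)
    (t : tens U V) :
  slice xi (tlift f t) = tlift (fun u v => slice xi (f u v)) t.
Proof. exact/tlift_tlift/slice_kbal. Qed.

(** The right factors of a representative are fixed by a finite rank map, by [finite_dual];
    inserting that map in the second factor and regrouping makes the slices appear on the left. *)
Lemma slice_rep t :
  exists l : seq ({linear H -> k^o} * H),
    t = \sum_(p <- l) tensor (slice p.1 t) p.2.
Proof.
have [l lP] := finite_dual (map snd (trepr t)); exists l.
have {1}-> : t = \sum_(q <- trepr t)
    \sum_(p <- l) tensor ((p.1 q.2 : k) *: q.1) p.2.
  rewrite [LHS]btensE; apply: eq_big_seq => q qt.
  rewrite -/(tensor _ _) {1}(lP q.2) ?map_f //.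
  by rewrite tensor_sumr; apply: eq_bigr => p _; rewrite tensorZr' tensorZl'.
rewrite exchange_big; apply: eq_bigr => p _.
by rewrite -tensor_suml.
Qed.

Lemma slice_inj t u : (forall xi, slice xi t = slice xi u) -> t = u.
Proof.
move=> tu; apply/eqP; rewrite -subr_eq0; apply/eqP.
have [l ->] := slice_rep (t - u); rewrite big1 // => p _.
by rewrite linearB /= tu subrr tensor0l.
Qed.

End Slices.

Lemma slice_tmap (M H M' : lmodType k) xi (f : {linear M -> M'}) (t : tens M H)
  :
  slice xi (tmap f id t : tens M' H) = f (slice xi t).
Proof.
rewrite /slice tlift_tmap; last exact: slice_kbal.
by rewrite tlift_comp; apply: eq_tlift => m h; rewrite /= linearZ.
Qed.

(** Vector spaces are flat: slices commute with f (x) id and separate tensors. *)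
Lemma tmap_inj (M H M' : lmodType k) (f : {linear M -> M'}) :
  injective f -> injective (tmap f id : tens M H -> tens M' H).
Proof.
move=> f_inj t u tu; apply: slice_inj => xi; apply: f_inj.
by rewrite -!slice_tmap tu.
Qed.

End TensorToolkit.

(** * The antipode and the coideal subalgebra *)

Section HopfCalculus.
Variables (k : fieldType) (H : algType k) (hH : hopfAlgebra H).

Local Notation Delta := (comul hH).
Local Notation S := (antipode hH).

Definition eps (x : H) : k := counit hH x.

Lemma epsD x y : eps (x + y) = eps x + eps y.
Proof. by rewrite /eps linearD. Qed.
Lemma epsZ c x : eps (c *: x) = c * eps x.
Proof. by rewrite /eps linearZ. Qed.
Lemma epsM x y : eps (x * y) = eps x * eps y.
Proof. exact: counitM. Qed.
Lemma eps1 : eps 1 = 1.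
Proof. exact: counit1. Qed.
Lemma antiD x y : S (x + y) = S x + S y.
Proof. exact: linearD. Qed.
Lemma antiZ c x : S (c *: x) = c *: S x.
Proof. exact: linearZ. Qed.
Lemma algZl c (x y : H) : (c *: x) * y = c *: (x * y).
Proof. by rewrite scalerAl. Qed.
Lemma algZr c (x y : H) : x * (c *: y) = c *: (x * y).
Proof. by rewrite scalerAr. Qed.

Lemma comul_coassoc (P : zmodType) (f : H -> H -> H -> P) x : ktri f ->
  tlift (fun y h => tlift (fun a b => f a b h) (Delta y)) (Delta x) =
  tlift (fun y h => tlift (f y) (Delta h)) (Delta x).
Proof. exact/tlift_coassoc/comulA. Qed.

Section Additive.
Variables (P : zmodType) (g : H -> P) (gD : forall x y, g (x + y) = g x + g y).

Lemma additive_tlift (M N : lmodType k) (f : M -> N -> H) (t : tens M N) :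
  g (tlift f t) = tlift (fun m n => g (f m n)) t.
Proof.
apply: (big_morph g) => //; apply: (addrI (g 0)); by rewrite -gD !addr0.
Qed.

(** The Hopf algebra axioms are restated under an additive map [g], so that they apply inside any
    expression additive in one Sweedler factor, including expressions with values in a tensor
    product over A. *)
Lemma comul_counitl x : tlift (fun a b => g (eps a *: b)) (Delta x) = g x.
Proof. by rewrite -additive_tlift counitl. Qed.

Lemma comul_counitr x : tlift (fun a b => g (eps b *: a)) (Delta x) = g x.
Proof. by rewrite -additive_tlift counitr. Qed.

Lemma comul_antipodel x :
  tlift (fun a b => g (S a * b)) (Delta x) = g (eps x)%:A.
Proof. by rewrite -additive_tlift antipodel. Qed.

Lemma comul_antipoder x :
  tlift (fun a b => g (a * S b)) (Delta x) = g (eps x)%:A.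
Proof. by rewrite -additive_tlift antipoder. Qed.

End Additive.

Lemma antipode1 : S 1 = 1.
Proof.
have := antipodel hH 1; rewrite comul1 tliftT; last first.
  by split=> *; rewrite ?antiD ?mulrDl ?mulrDr // antiZ algZl algZr.
by rewrite mulr1 => ->; rewrite [counit _ _]eps1 scale1r.
Qed.

Definition hrules :=
  (mulrDl, mulrDr, antiD, epsD, algZl, algZr, antiZ, epsZ, scalerDl, scalerDr).

Ltac kb := split=> *; rewrite /= ?hrules ?scalerA //.
Ltac kbs := repeat (apply: kbal_tlift => ? ?); kb.

(* S(xy) and S(y)S(x) are both convolution inverses of multiplication in
   Hom(H (x) H, H). *)
Lemma antipodeM x y : S (x * y) = S y * S x.
Proof.
(* Summed over the Sweedler factors of x and y, [K] is the triple convolution product of S(xy), xy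
   and S(y)S(x). Contracting the last two factors leaves S(xy), contracting the first two leaves
   S(y)S(x). *)
pose K (a c b1 d1 b2 d2 : H) : H := S (a * c) * (b1 * d1) * (S d2 * S b2).
pose G (a b1 b2 : H) : H := tlift (fun c d : H =>
  tlift (fun d1 d2 : H => K a c b1 d1 b2 d2) (Delta d)) (Delta y).
have KG a b1 b2 : G a b1 b2 = tlift (fun q d2 =>
    tlift (fun c d1 => K a c b1 d1 b2 d2) (Delta q)) (Delta y).
  rewrite comul_coassoc //.
  by split=> ?; rewrite /K; kb.
have Gtri : ktri G.
  by split=> ?; rewrite /G /K; kbs.
transitivity (tlift (fun a b => tlift (G a) (Delta b)) (Delta x)).
  transitivity (tlift (fun a b => tlift (fun c d =>
      eps d *: (eps b *: S (a * c))) (Delta y)) (Delta x)).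
    rewrite -[LHS](@comul_counitr _ (fun a => S (a * y))); last first.
      by move=> *; rewrite !hrules.
    apply: eq_tlift => a b.
    rewrite -(@comul_counitr _ (fun c => S (eps b *: a * c))); last first.
      by move=> *; rewrite !hrules.
    by apply: eq_tlift => c d; rewrite !hrules !scalerA mulrC.
  apply: eq_tlift => a b; rewrite /G tlift_exchange; apply: eq_tlift => c d.
  transitivity (tlift (fun b1 b2 => eps d *: (S (a * c) * (b1 * S b2))) (Delta
    b)).
    rewrite (@comul_antipoder _ (fun z => eps d *: (S (a * c) * z))).
      by rewrite algZr mulr1.
    by move=> *; rewrite !hrules.
  apply: eq_tlift => b1 b2.
  transitivity (S (a * c) * (b1 * (eps d)%:A * S b2)).
    by rewrite algZr mulr1 algZl algZr.
  rewrite -(@comul_antipoder _ (fun z => S (a * c) * (b1 * z * S b2))).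
    by apply: eq_tlift => d1 d2; rewrite /K !mulrA.
  by move=> *; rewrite !hrules.
rewrite -comul_coassoc //.
transitivity (tlift (fun p b2 => tlift (fun q d2 =>
    (eps (p * q))%:A * (S d2 * S b2)) (Delta y)) (Delta x)).
  apply: eq_tlift => p b2.
  transitivity (tlift (fun a b1 => tlift (fun q d2 =>
      tlift (fun c d1 => K a c b1 d1 b2 d2) (Delta q)) (Delta y)) (Delta p)).
    by apply: eq_tlift => a b1; rewrite KG.
  rewrite tlift_exchange; apply: eq_tlift => q d2.
  rewrite -(@comul_antipodel _ (fun z => z * (S d2 * S b2))); last first.
    by move=> *; rewrite !hrules.
  by rewrite comulM tlift_tmap2 //; kb.
transitivity (tlift (fun p b2 => S y * S (eps p *: b2)) (Delta x)).
  apply: eq_tlift => p b2.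
  rewrite -(@comul_counitl _ (fun z => S z * S (eps p *: b2))).
    by apply: eq_tlift => q d2; rewrite epsM !hrules mul1r scalerA mulrC.
  by move=> *; rewrite !hrules.
by rewrite (@comul_counitl _ (fun z => S y * S z)) // => *; rewrite !hrules.
Qed.

End HopfCalculus.

Section RightModules.
Variables (k : fieldType) (A : algType k) (M : rmodType A).
Implicit Types (m : M) (a b : A).

Lemma rtimesDl m m' a : rtimes (m + m') a = rtimes m a + rtimes m' a.
Proof. exact: scalerDr. Qed.
Lemma rtimesDr m a b : rtimes m (a + b) = rtimes m a + rtimes m b.
Proof. exact: scalerDl. Qed.
Lemma rtimesA m a b : rtimes (rtimes m a) b = rtimes m (a * b).
Proof. exact: scalerA. Qed.
Lemma rtimes1 m : rtimes m 1 = m.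
Proof. exact: scale1r. Qed.
Lemma rtimes0r m : rtimes m 0 = 0.
Proof. exact: scale0r. Qed.
Lemma rtimesNr m a : rtimes m (- a) = - rtimes m a.
Proof. exact: scaleNr. Qed.
Lemma rtimesBl m m' a : rtimes (m - m') a = rtimes m a - rtimes m' a.
Proof. exact: scalerBr. Qed.
Lemma rtimes_suml (I : Type) (r : seq I) (Q : pred I) (F : I -> M) a :
  rtimes (\sum_(i <- r | Q i) F i) a = \sum_(i <- r | Q i) rtimes (F i) a.
Proof. exact: scaler_sumr. Qed.
Lemma rtimes_sumr (I : Type) (r : seq I) (Q : pred I) (F : I -> A) m :
  rtimes m (\sum_(i <- r | Q i) F i) = \sum_(i <- r | Q i) rtimes m (F i).
Proof. exact: scaler_suml. Qed.

Lemma kspaceE c (m : kspace M) : c *: m = rtimes (m : M) c%:A.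
Proof. by []. Qed.
Lemma rtimesZr c m a : rtimes m (c *: a) = c *: (rtimes m a : kspace M).
Proof. by rewrite kspaceE rtimesA -scalerAr mulr1. Qed.
Lemma rtimesZl c (m : kspace M) a :
  rtimes (c *: m : M) a = c *: (rtimes (m : M) a : kspace M).
Proof. by rewrite !kspaceE !rtimesA -scalerAr mulr1 -scalerAl mul1r. Qed.

Lemma rtimes_bilinear :
  kbilinear (fun (x : kspace M) (b : A) => rtimes (x : M) b : kspace M).
Proof.
split=> [b|x] c u v; first by rewrite -rtimesZl; exact: rtimesDl.
by rewrite -rtimesZr; exact: rtimesDr.
Qed.

End RightModules.

Lemma mul_bilinear (k : fieldType) (H : algType k) :
  kbilinear (fun h h' : H => h * h').
Proof.
split=> [h|h] c x y; first by rewrite mulrDl -scalerAl.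
by rewrite mulrDr -scalerAr.
Qed.

Lemma tmap_linear (k : fieldType) (M M' N : lmodType k) (f : {linear M -> M'}) :
  linear (tmap f id : tens M N -> tens M' N).
Proof.
apply: (tlift_linear (f := fun (m : M) (n : N) => tensor (f m) n)).
split=> [n|m] c x y; first by rewrite linearP tensorDl tensorZl'.
by rewrite tensorDr tensorZr'.
Qed.

Section Coideal.
Variables (k : fieldType) (H : algType k) (hH : hopfAlgebra H).
Variables (A : algType k) (iota : {lrmorphism A -> H}).
Hypothesis iota_inj : injective iota.
Hypothesis hA : right_coideal hH iota.

Local Notation Delta := (comul hH).
Local Notation S := (antipode hH).
Local Notation eps := (eps hH).

Lemma coideal_tmap_inj :
  injective (tmap iota id : tens A H -> tens H H).
Proof. exact: (@tmap_inj _ _ _ _ (iota : {linear A -> H})). Qed.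

Lemma iotaZ c a : iota (c *: a) = c *: iota a.
Proof. exact: linearZ. Qed.

Lemma iota_tensor_kbal : kbal (fun (b : A) (h : H) => tensor (iota b) h).
Proof.
split=> *; rewrite ?rmorphD ?iotaZ ?tensorDl ?tensorDr //.
by rewrite tensorZl' tensorZr'.
Qed.

(* The comultiplication of A, with values in A (x) H. *)
Definition delta_fun (a : A) : tens A H := sval (cid (hA a)).

Lemma delta_funE a : tmap iota id (delta_fun a) = Delta (iota a).
Proof. by rewrite /delta_fun; case: cid. Qed.

Lemma delta_linear : linear delta_fun.
Proof.
move=> c a b; apply: coideal_tmap_inj.
rewrite delta_funE [RHS](tmap_linear (iota : {linear A -> H})) !delta_funE.
by rewrite !linearP.
Qed.
HB.instance Definition _ :=
  GRing.isLinear.Build _ _ _ _ delta_fun delta_linear.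

Definition delta : {linear A -> tens A H} := delta_fun.

Lemma deltaE a : tmap iota id (delta a) = Delta (iota a).
Proof. exact: delta_funE. Qed.

Lemma delta_unique a t : tmap iota id t = Delta (iota a) -> t = delta a.
Proof. by move=> eq_t; apply: coideal_tmap_inj; rewrite eq_t deltaE. Qed.

Lemma tlift_delta (P : zmodType) (f : H -> H -> P) a : kbal f ->
  tlift (fun b h => f (iota b) h) (delta a) = tlift f (Delta (iota a)).
Proof. by move=> bf; rewrite -deltaE tlift_tmap. Qed.

Lemma deltaM a b :
  delta (a * b) = tmap2 (fun x y : A => x * y) (fun x y : H => x * y)
                        (delta a) (delta b).
Proof.
apply/esym/delta_unique; rewrite rmorphM comulM -!deltaE.
have bm := tensor_kbal H H.
rewrite /tmap2 [RHS]tlift_tmap; last first.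
  by apply/bilinear_balanced/tmap2_outer_bilinear; exact: mul_bilinear.
rewrite [LHS]tlift_tmap2.
  apply: eq_tlift => u v; rewrite tlift_tmap.
    by apply: eq_tlift => u' v'; rewrite rmorphM.
  by apply/bilinear_balanced/tmap2_inner_bilinear; exact: mul_bilinear.
exact: iota_tensor_kbal.
Qed.

Lemma delta1 : delta 1 = tensor 1 1.
Proof.
apply/esym/delta_unique; rewrite rmorph1 comul1 [LHS]tliftT ?rmorph1 //.
exact: iota_tensor_kbal.
Qed.

(** The injection iota (x) id turns the identity into coassociativity of H at [iota a]. *)
Lemma delta_coassoc (P : zmodType) (f : A -> H -> H -> P) a : ktri f ->
  tlift (fun x h => tlift (fun b h1 => f b h1 h) (delta x)) (delta a) =
  tlift (fun x h => tlift (f x) (Delta h)) (delta a).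
Proof.
apply: tlift_coassoc.
apply: (@tmap_inj _ _ _ _ (iota : {linear A -> H}) iota_inj).
pose g (x y z : H) := tensor x (tensor y z).
have gtri : ktri g.
  by split=> ?; split=> *; rewrite /g ?tensorDl ?tensorDr ?tensorZl' ?tensorZr'
    ?tensorDr ?tensorZr'.
have gtri' : ktri (fun b h h' => g (iota b) h h').
  split=> ?; split=> *; rewrite /g ?rmorphD ?iotaZ ?tensorDl ?tensorDr
    ?tensorZl' ?tensorZr' ?tensorDr ?tensorZr' //.
have bi : kbal (fun (b : A) (t : tens H H) => tensor (iota b) t).
  by split=> *; rewrite ?rmorphD ?iotaZ ?tensorDl ?tensorDr ?tensorZl'
    ?tensorZr'.
transitivity (tlift (fun x h => tlift (fun b h1 => g b h1 h) (Delta x))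
                    (Delta (iota a))).
  rewrite -tlift_delta; last exact: kbal_tlift_linl gtri.
  rewrite /tassoc {1}/tmap.
  rewrite (tlift_tlift _ _ (bilinear_balanced (tassoc_bilinear _ _ _))).
  rewrite tlift_tlift //; apply: eq_tlift => x h.
  rewrite (tliftT _ _ (bilinear_balanced (tassoc_bilinear _ _ _))).
  rewrite tlift_tlift // -tlift_delta; last by case: gtri.
  by apply: eq_tlift => b h1; rewrite tliftT.
rewrite comul_coassoc // -tlift_delta; last exact: kbal_tlift_linr gtri.
rewrite {1}/tmap tlift_tmap //; apply: eq_tlift => x h.
by rewrite -tensor_tliftr tlift_tensorK.
Qed.

Lemma delta_counitr (P : zmodType) (g : A -> P) a :
  (forall x y, g (x + y) = g x + g y) ->
  tlift (fun b h => g (eps h *: b)) (delta a) = g a.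
Proof.
move=> gD.
have -> : tlift (fun b h => g (eps h *: b)) (delta a) =
    g (tlift (fun b h => eps h *: b) (delta a)).
  apply/esym; apply: (big_morph g) => //.
  by apply: (addrI (g 0)); rewrite -gD !addr0.
congr g; apply: iota_inj; rewrite -[RHS](counitr hH).
rewrite -tlift_delta; last exact: slice_kbal.
rewrite [LHS](raddf_sum iota); apply: eq_bigr => p _; exact: iotaZ.
Qed.

Lemma delta_counitl (P : zmodType) (g : H -> P) a :
  (forall x y, g (x + y) = g x + g y) ->
  tlift (fun b h => g (eps (iota b) *: h)) (delta a) = g (iota a).
Proof.
move=> gD; rewrite -(comul_counitl hH gD (iota a)) -tlift_delta //.
by split=> *; rewrite ?epsD ?scalerDl ?scalerDr -?gD // epsZ scalerA mulrC.
Qed.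

Lemma delta_antipoder (P : zmodType) (g : H -> P) a :
  (forall x y, g (x + y) = g x + g y) ->
  tlift (fun b h => g (iota b * S h)) (delta a) = g (eps (iota a))%:A.
Proof.
move=> gD; rewrite -(comul_antipoder hH gD (iota a)) -tlift_delta //.
split=> *; rewrite ?antiD ?mulrDl ?mulrDr -?gD // antiZ.
by rewrite algZl algZr.
Qed.

Section InverseAntipode.
Variable T : H -> H.
Hypotheses (ST : cancel S T) (TS : cancel T S).

Lemma invantiD x y : T (x + y) = T x + T y.
Proof. by apply: (can_inj ST); rewrite antiD !TS. Qed.
Lemma invantiZ c x : T (c *: x) = c *: T x.
Proof. by apply: (can_inj ST); rewrite antiZ !TS. Qed.
Lemma invantiM x y : T (x * y) = T y * T x.
Proof. by apply: (can_inj ST); rewrite antipodeM !TS. Qed.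

(** S is injective and sends T(b) a to S(a) b, which turns the sum into the antipode axiom. *)
Lemma comul_invantipode (P : zmodType) (g : H -> P) x :
  (forall x y, g (x + y) = g x + g y) ->
  tlift (fun a b => g (T b * a)) (Delta x) = g (eps x)%:A.
Proof.
move=> gD; rewrite -(additive_tlift gD); congr g; apply: (can_inj ST).
rewrite [LHS](raddf_sum S) antiZ antipode1 -[RHS](antipodel hH).
by apply: eq_bigr => p _; rewrite /= antipodeM TS.
Qed.

End InverseAntipode.

End Coideal.

(** * Relative Hopf modules *)

Section Quotient.
Variables (R : pzRingType) (V : lmodType R) (S : submodule V).

Definition quot_rel : rel V := fun x y => `[< S (x - y) >].

Lemma quot_rel_refl : reflexive quot_rel.
Proof. by move=> x; apply/asboolP; rewrite subrr; exact: sub0. Qed.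
Lemma quot_rel_sym : symmetric quot_rel.
Proof.
by move=> x y; apply/asboolP/asboolP => /subN; rewrite opprB.
Qed.
Lemma quot_rel_trans : transitive quot_rel.
Proof.
move=> y x z /asboolP xy /asboolP yz; apply/asboolP.
by rewrite -(subrK y x) -addrA; exact: subD.
Qed.
Canonical quot_equiv :=
  EquivRel quot_rel quot_rel_refl quot_rel_sym quot_rel_trans.

Definition quot : Type := {eq_quot quot_equiv}.
HB.instance Definition _ := Choice.on quot.
HB.instance Definition _ := EqQuotient.on quot.

Definition qproj_fun (x : V) : quot := \pi x.
Definition qrepr (q : quot) : V := repr q.

Lemma qreprK q : qproj_fun (qrepr q) = q.
Proof. exact: reprK. Qed.

Lemma qproj_funP x y : qproj_fun x = qproj_fun y <-> S (x - y).
Proof.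
split=> [/eqP|Sxy]; first by rewrite [_ == _]eqmodE => /asboolP.
by apply/eqP; rewrite [_ == _]eqmodE; apply/asboolP.
Qed.

Lemma qrepr_proj x : S (qrepr (qproj_fun x) - x).
Proof. by apply/qproj_funP; rewrite qreprK. Qed.

Lemma quotW (Q : quot -> Prop) : (forall x, Q (qproj_fun x)) -> forall q, Q q.
Proof. by move=> h q; rewrite -[q]qreprK. Qed.

Definition quot_add (p q : quot) : quot := qproj_fun (qrepr p + qrepr q).
Definition quot_opp (p : quot) : quot := qproj_fun (- qrepr p).
Definition quot_scale a (p : quot) : quot := qproj_fun (a *: qrepr p).

Lemma quot_addE x y : quot_add (qproj_fun x) (qproj_fun y) = qproj_fun (x + y).
Proof.
apply/qproj_funP; rewrite opprD addrACA.
by apply: subD; exact: qrepr_proj.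
Qed.
Lemma quot_oppE x : quot_opp (qproj_fun x) = qproj_fun (- x).
Proof. by apply/qproj_funP; rewrite -opprD; exact/subN/qrepr_proj. Qed.
Lemma quot_scaleE a x : quot_scale a (qproj_fun x) = qproj_fun (a *: x).
Proof. by apply/qproj_funP; rewrite -scalerBr; exact/subZ/qrepr_proj. Qed.

Lemma quot_addA : associative quot_add.
Proof. by do 3!elim/quotW=> ?; rewrite !quot_addE addrA. Qed.
Lemma quot_addC : commutative quot_add.
Proof. by do 2!elim/quotW=> ?; rewrite !quot_addE addrC. Qed.
Lemma quot_add0 : left_id (qproj_fun 0) quot_add.
Proof. by elim/quotW=> ?; rewrite quot_addE add0r. Qed.
Lemma quot_addN : left_inverse (qproj_fun 0) quot_opp quot_add.
Proof. by elim/quotW=> ?; rewrite quot_oppE quot_addE addNr. Qed.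
HB.instance Definition _ :=
  GRing.isZmodule.Build quot quot_addA quot_addC quot_add0 quot_addN.

Lemma quot_scaleA a b q : quot_scale a (quot_scale b q) = quot_scale (a * b) q.
Proof. by elim/quotW: q => ?; rewrite !quot_scaleE scalerA. Qed.
Lemma quot_scale1 : left_id 1 quot_scale.
Proof. by elim/quotW=> ?; rewrite quot_scaleE scale1r. Qed.
Lemma quot_scaleDr : right_distributive quot_scale +%R.
Proof.
move=> a; do 2!elim/quotW=> ?.
by rewrite [_ + _]quot_addE !quot_scaleE scalerDr -quot_addE.
Qed.
Lemma quot_scaleDl q : {morph quot_scale^~ q : a b / a + b}.
Proof.
by move=> a b; elim/quotW: q => ?; rewrite !quot_scaleE scalerDl -quot_addE.
Qed.
HB.instance Definition _ := GRing.Zmodule_isLmodule.Build R quot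
  quot_scaleA quot_scale1 quot_scaleDr quot_scaleDl.

Lemma qproj_linear : linear qproj_fun.
Proof. by move=> a x y; rewrite -quot_addE -quot_scaleE. Qed.
HB.instance Definition _ :=
  GRing.isLinear.Build _ _ _ _ qproj_fun qproj_linear.

Definition qproj : {linear V -> quot} := qproj_fun.

Lemma qproj_eq0 x : qproj x = 0 <-> S x.
Proof.
rewrite -(linear0 qproj); split=> [/qproj_funP|Sx].
  by rewrite subr0.
by apply/qproj_funP; rewrite subr0.
Qed.

Lemma qproj_surj q : exists x, qproj x = q.
Proof. by exists (qrepr q); exact: qreprK. Qed.

End Quotient.

Section KLinear.
Variables (k : fieldType) (A : algType k) (M M' : rmodType A).
Variable f : {linear M -> M'}.

Lemma rtimes_linear m a : f (rtimes m a) = rtimes (f m) a.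
Proof. exact: linearZ. Qed.

Definition klinear_fun : kspace M -> kspace M' := f.
Lemma klinear_is_linear : linear klinear_fun.
Proof. by move=> c x y; exact: (linearP f). Qed.
HB.instance Definition _ :=
  GRing.isLinear.Build _ _ _ _ klinear_fun klinear_is_linear.
Definition klinear : {linear kspace M -> kspace M'} := klinear_fun.

End KLinear.

Section Objects.
Variables (k : fieldType) (H : algType k) (hH : hopfAlgebra H).
Variables (A : algType k) (iota : {lrmorphism A -> H}).
Hypothesis iota_inj : injective iota.
Hypothesis hA : right_coideal hH iota.

Local Notation Delta := (comul hH).
Local Notation S := (antipode hH).
Local Notation eps := (eps hH).
Local Notation delta := (delta iota_inj hA).
Local Notation hobj := (relHopfModule hH iota).

Definition rt (M : rmodType A) (x : kspace M) (b : A) : kspace M :=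
  rtimes (x : M) b.

(* (m (x) h) a = m a_(1) (x) h a_(2) *)
Definition diag_act (M : rmodType A) (t : tens (kspace M) H) (a : A) :
    tens (kspace M) H :=
  tmap2 (@rt M) (fun h h' : H => h * h') t (delta a).

Lemma diag_act_bilinear M : kbilinear (@diag_act M).
Proof.
have [b1 b2] := tmap2_bilinear (rtimes_bilinear M) (mul_bilinear H).
split=> [a|t]; first exact: b1.
by move=> c x y; rewrite /diag_act linearP b2.
Qed.

Lemma diag_act1 M (t : tens (kspace M) H) : diag_act t 1 = t.
Proof.
rewrite /diag_act delta1 // -[RHS]tlift_tensorK; apply: eq_tlift => u v.
rewrite tliftT; first by rewrite /rt rtimes1 mulr1.
apply/bilinear_balanced/tmap2_inner_bilinear; last exact: mul_bilinear.
exact: rtimes_bilinear.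
Qed.

Lemma diag_act_tmap (M M' : rmodType A) (f : {linear M -> M'})
    (t : tens (kspace M) H) a :
  tmap (klinear f) id (diag_act t a) =
  diag_act (tmap (klinear f) id t : tens (kspace M') H) a.
Proof.
rewrite /diag_act {1}/tmap tlift_tmap2; last exact: map_tensor_kbal.
rewrite {1}/tmap2 tlift_tmap; last first.
  apply/bilinear_balanced/tmap2_outer_bilinear; last exact: mul_bilinear.
  exact: rtimes_bilinear.
apply: eq_tlift => u v; apply: eq_tlift => b g.
by congr tensor; exact: rtimes_linear.
Qed.

Section MakeObject.
Variables (M : rmodType A) (rho : kspace M -> tens (kspace M) H).
Hypothesis rhoD : forall x y, rho (x + y) = rho x + rho y.
Hypothesis rho_act : forall m a, rho (rtimes (m : M) a) = diag_act (rho m) a.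
Hypothesis rhoA : forall m,
  tassoc (tmap rho id (rho m) : tens (tens (kspace M) H) H) =
  tmap id Delta (rho m).
Hypothesis rho_counit : forall m, slice (counit hH) (rho m) = m.

(** A scalar c acts on M as the element c 1 of A, so homogeneity is a case of compatibility with the
    action. *)
Lemma mk_rho_linear : linear rho.
Proof.
move=> c x y; rewrite rhoD kspaceE rho_act; congr (_ + _).
rewrite -[X in diag_act _ X]addr0 (proj2 (diag_act_bilinear M)) diag_act1.
rewrite -[X in _ + X]/(diag_act (rho x) 0).
have [_ b2] := diag_act_bilinear M.
by have := b2 (rho x) (-1) 0 0; rewrite scaler0 addr0 scaleN1r addNr => ->;
  rewrite addr0.
Qed.

Definition mk_obj : hobj M.
Proof.
pose L := GRing.isLinear.Build _ _ _ _ rho mk_rho_linear.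
pose r : {linear kspace M -> tens (kspace M) H} := HB.pack rho L.
apply: (@RelHopfModule _ _ hH A iota M (@Comodule _ H hH _ r rhoA rho_counit)).
move=> m a t /(delta_unique iota_inj hA) ->.
exact: rho_act.
Defined.

End MakeObject.

Section ObjectTheory.
Variables (M : rmodType A) (hM : hobj M).

Definition coac : {linear kspace M -> tens (kspace M) H} :=
  coact (rhm_comodule hM).

Lemma coac_act (m : M) a : coac (rtimes m a) = diag_act (coac m) a.
Proof. exact/rhm_coactM/deltaE. Qed.

Lemma coac_coassoc (P : zmodType) (f : kspace M -> H -> H -> P) m : ktri f ->
  tlift (fun x h => tlift (fun y h1 => f y h1 h) (coac x)) (coac m) =
  tlift (fun x h => tlift (f x) (Delta h)) (coac m).
Proof. exact/tlift_coassoc/coactA. Qed.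

Lemma coac_counit m : slice (counit hH) (coac m) = m.
Proof. exact: coact_counit. Qed.

Lemma coac_counitr (P : zmodType) (g : kspace M -> P) m :
  (forall x y, g (x + y) = g x + g y) ->
  tlift (fun x h => g (eps h *: x)) (coac m) = g m.
Proof.
move=> gD; rewrite -{2}(coac_counit m); apply/esym.
apply: (big_morph g) => //.
by apply: (addrI (g 0)); rewrite -gD !addr0.
Qed.

Lemma tlift_coac_act (P : zmodType) (f : kspace M -> H -> P) m a : kbal f ->
  tlift f (coac (rtimes (m : M) a)) =
  tlift (fun x h => tlift (fun b g => f (rt x b) (h * g)) (delta a)) (coac m).
Proof. by move=> bf; rewrite coac_act tlift_tmap2. Qed.

(* As k is a field, this says that the coaction maps L into L (x) H. *)
Definition costable (L : submodule M) : Prop :=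
  forall m, L m -> forall xi, L (slice xi (coac m)).

Lemma costable_rep (L : submodule M) m : costable L -> L m ->
  exists (I : Type) (l : seq I) (F : I -> kspace M) (h : I -> H),
    (forall i, L (F i)) /\ coac m = \sum_(i <- l) tensor (F i) (h i).
Proof.
move=> cL Lm; have [l lE] := slice_rep (coac m).
exists ({linear H -> k^o} * H)%type, l, (fun p => slice p.1 (coac m)), snd.
by split=> // p; exact: cL.
Qed.

Section QuotientObject.
Variables (L : submodule M) (cL : costable L).

Local Notation pi := (klinear (qproj L)).

Definition quot_coac (q : kspace (quot L)) : tens (kspace (quot L)) H :=
  tmap pi id (coac (qrepr q)).

(** Independence of the representative: the slices of the coaction of an element of L lie in L,
    hence vanish in the quotient. *)
Lemma quot_coac_proj m : quot_coac (pi m) = tmap pi id (coac m).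
Proof.
rewrite /quot_coac; set m' := qrepr _.
have Lm : L (m' - m) by exact: qrepr_proj.
apply/eqP; rewrite -subr_eq0; apply/eqP; apply: slice_inj => xi.
rewrite slice0 sliceB !slice_tmap -linearB -sliceB -linearB.
by apply/qproj_eq0/cL.
Qed.

Lemma tlift_quot_coac (P : zmodType) (f : kspace (quot L) -> H -> P) m :
  kbal f ->
  tlift f (quot_coac (pi m)) = tlift (fun x h => f (pi x) h) (coac m).
Proof. by move=> bf; rewrite quot_coac_proj tlift_tmap. Qed.

Lemma quot_piW (Q : kspace (quot L) -> Prop) : (forall x, Q (pi x)) -> forall
  q, Q q.
Proof. by move=> piQ q; rewrite -(qreprK q); exact: piQ. Qed.

Lemma quot_coac_linear : linear quot_coac.
Proof.
move=> c; elim/quot_piW=> x; elim/quot_piW=> y.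
by rewrite -linearP !quot_coac_proj linearP tmap_linear.
Qed.
HB.instance Definition _ :=
  GRing.isLinear.Build _ _ _ _ quot_coac quot_coac_linear.

Definition quot_obj : hobj (quot L).
Proof.
apply: (@mk_obj _ quot_coac).
- exact: linearD.
- elim/quot_piW=> x a.
  have -> : rtimes (pi x : quot L) a = pi (rtimes (x : M) a).
    by rewrite -[RHS]/(qproj L _) rtimes_linear.
  by rewrite !quot_coac_proj coac_act diag_act_tmap.
- elim/quot_piW=> x; apply: coassoc_tlift => f tf.
  rewrite tlift_quot_coac; last exact: (kbal_tlift_linl quot_coac tf).
  rewrite tlift_quot_coac; last exact: (kbal_tlift_linr (comul hH) tf).
  rewrite -coac_coassoc.
    by apply: eq_tlift => y h; rewrite tlift_quot_coac //; exact: (proj1 tf).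
  have [t1 t2] := tf.
  split=> [h|y]; last exact: t2.
  by split=> *; case: (t1 h) => b1 b2 b3;
    rewrite ?linearD ?linearZ //= ?b1 ?b2 ?b3.
- by elim/quot_piW=> x; rewrite quot_coac_proj slice_tmap coac_counit.
Defined.

End QuotientObject.
End ObjectTheory.

Lemma coac_quotE (M : rmodType A) (hM : hobj M) (L : submodule M)
    (cL : costable hM L) m :
  coac (quot_obj cL) (klinear (qproj L) m) =
  tmap (klinear (qproj L)) id (coac hM m).
Proof. exact: quot_coac_proj. Qed.

End Objects.

Section RegularObject.
Variables (k : fieldType) (H : algType k) (hH : hopfAlgebra H).
Variables (A : algType k) (iota : {lrmorphism A -> H}).
Hypothesis iota_inj : injective iota.
Hypothesis hA : right_coideal hH iota.
Local Notation Delta := (comul hH).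

(* The identity: the two k-module structures are equal, but not convertible. *)
Definition reg_fun (h : H) : kspace (rregmod iota) := h.
Lemma reg_linear : linear reg_fun.
Proof.
move=> c x y; congr (_ + _); rewrite -[LHS]mulr1 -scalerAl scalerAr.
by rewrite -(rmorph1 iota) -linearZ.
Qed.
HB.instance Definition _ := GRing.isLinear.Build _ _ _ _ reg_fun reg_linear.
Definition reg : {linear H -> kspace (rregmod iota)} := reg_fun.

Definition reg_coac (h : kspace (rregmod iota)) :
    tens (kspace (rregmod iota)) H :=
  tmap reg id (Delta (h : H)).

Lemma reg_coac_linear : linear reg_coac.
Proof.
move=> c x y; rewrite -[x]/(reg x) -[y]/(reg y) -linearP /reg_coac.
by rewrite -[X in Delta X]/(c *: (x : H) + (y : H)) linearP tmap_linear.
Qed.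
HB.instance Definition _ :=
  GRing.isLinear.Build _ _ _ _ reg_coac reg_coac_linear.

Lemma tlift_reg_coac (P : zmodType) (f : kspace (rregmod iota) -> H -> P) h :
  kbal f ->
  tlift f (reg_coac (reg h)) = tlift (fun x h => f (reg x) h) (Delta h).
Proof. by move=> bf; rewrite [LHS]tlift_tmap. Qed.

Definition reg_obj : relHopfModule hH iota (rregmod iota).
Proof.
apply: (@mk_obj _ _ _ _ _ iota_inj hA _ reg_coac).
- by move=> x y; rewrite linearD.
- move=> h a; rewrite -[LHS]/(tmap reg id (Delta ((h : H) * iota a))).
  rewrite comulM tmapk tlift_tmap2; last exact: map_tensor_kbal.
  rewrite /diag_act /tmap2 [RHS]tlift_tmap; last first.
    apply/bilinear_balanced/tmap2_outer_bilinear; last exact: mul_bilinear.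
    exact: rtimes_bilinear.
  apply: eq_tlift => u v.
  rewrite -(tlift_delta iota_inj hA) //.
  split=> *; rewrite ?mulrDr ?linearD ?tensorDl ?tensorDr //.
  by rewrite -!scalerAr linearZ tensorZl' tensorZr'.
- move=> h; apply: coassoc_tlift => f tf.
  rewrite -[h]/(reg h).
  rewrite tlift_reg_coac; last exact: (kbal_tlift_linl reg_coac tf).
  rewrite tlift_reg_coac; last exact: (kbal_tlift_linr (comul hH) tf).
  rewrite -comul_coassoc.
    by apply: eq_tlift => y g; rewrite tlift_reg_coac //; exact: (proj1 tf).
  have [t1 t2] := tf.
  split=> [g|y]; last exact: t2.
  by split=> *; case: (t1 g) => b1 b2 b3;
    rewrite ?linearD ?linearZ //= ?b1 ?b2 ?b3.
- by move=> h; rewrite slice_tmap; exact: (congr1 reg (counitr hH h)).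
Defined.

End RegularObject.

Section TensorObject.
Variables (k : fieldType) (H : algType k) (hH : hopfAlgebra H).
Variables (A : algType k) (iota : {lrmorphism A -> H}).
Hypothesis iota_inj : injective iota.
Hypothesis hA : right_coideal hH iota.
Variable N : rmodType A.

Local Notation Delta := (comul hH).
Local Notation delta := (delta iota_inj hA).
Local Notation diag_act := (diag_act iota_inj hA).

(** The two properties are parameters of the type because the module structure put on it, the
    diagonal action, is built from them through [delta]. *)
Definition tensH (i : injective iota) (c : right_coideal hH iota) : Type :=
  tens (kspace N) H.
Local Notation NH := (tensH iota_inj hA).
HB.instance Definition _ := GRing.Zmodule.on NH.

Lemma diag_actA (t : tens (kspace N) H) a b :
  diag_act (diag_act t a) b = diag_act t (a * b).
Proof.
have bal2 := tmap2_outer_bilinear (rtimes_bilinear N) (mul_bilinear H).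
have bal1 := tmap2_inner_bilinear (rtimes_bilinear N) (mul_bilinear H).
rewrite /diag_act deltaM {1}/tmap2 tlift_tmap2;
  last exact/bilinear_balanced/bal2.
rewrite {1}/tmap2; apply: eq_tlift => u v.
rewrite tlift_tmap2; last exact/bilinear_balanced/bal1.
apply: eq_tlift => b1 h1; apply: eq_tlift => b2 h2.
by rewrite /rt rtimesA mulrA.
Qed.

Definition tensH_scale (a : A^c) (t : NH) : NH := diag_act t a.

Lemma tensH_scaleA a b t :
  tensH_scale a (tensH_scale b t) = tensH_scale (a * b) t.
Proof. exact: diag_actA. Qed.
Lemma tensH_scale1 : left_id 1 tensH_scale.
Proof. by move=> t; exact: diag_act1. Qed.
Lemma tensH_scaleDr : right_distributive tensH_scale +%R.
Proof.
move=> a t u; have := proj1 (diag_act_bilinear iota_inj hA N) a 1 t u.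
by rewrite !scale1r.
Qed.
Lemma tensH_scaleDl t : {morph tensH_scale^~ t : a b / a + b}.
Proof.
move=> a b; have := proj2 (diag_act_bilinear iota_inj hA N) t 1 a b.
by rewrite !scale1r.
Qed.
HB.instance Definition _ := GRing.Zmodule_isLmodule.Build A^c NH
  tensH_scaleA tensH_scale1 tensH_scaleDr tensH_scaleDl.

(* The identity, as for [reg_fun]. *)
Definition inH_fun (t : tens (kspace N) H) : kspace NH := t.
Lemma inH_linear : linear inH_fun.
Proof.
move=> c x y; congr (_ + _).
have b2 := proj2 (diag_act_bilinear iota_inj hA N) x.
rewrite -[RHS]/(diag_act x c%:A).
have /= e0 := b2 (-1) 0 0; rewrite scaler0 addr0 scaleN1r addNr in e0.
have := b2 c 1 0; rewrite addr0 => ->.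
by rewrite e0 addr0 diag_act1.
Qed.
HB.instance Definition _ := GRing.isLinear.Build _ _ _ _ inH_fun inH_linear.
Definition inH : {linear tens (kspace N) H -> kspace NH} := inH_fun.

Definition inH_tensor (n : kspace N) (h g : H) := tensor (inH (tensor n h)) g.

Lemma inH_tri : ktri inH_tensor.
Proof.
split=> [g|n]; split=> *; rewrite /inH_tensor ?tensorDl ?tensorDr ?linearD
  ?tensorDl ?tensorDr //.
  by rewrite tensorZl' tensorZr'.
by rewrite tensorZr' linearZ /= tensorZl' tensorZr'.
Qed.

(** The coaction id (x) Delta. It involves no coaction on N, so that any right A-module gives rise
    to an object. *)
Definition inH_coac_fun (t : tens (kspace N) H) : tens (kspace NH) H :=
  tlift (fun n h => tlift (inH_tensor n) (Delta h)) t.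

Lemma inH_coac_kbal : kbal (fun n h => tlift (inH_tensor n) (Delta h)).
Proof. exact: (kbal_tlift_linr (comul hH) inH_tri). Qed.

Lemma inH_coac_linear : linear inH_coac_fun.
Proof.
move=> c t u; rewrite /inH_coac_fun tliftDr ?tliftZ; try exact: inH_coac_kbal.
congr (_ + _); rewrite /tlift scaler_sumr; apply: eq_bigr => p _.
rewrite scaler_sumr; apply: eq_bigr => q _.
by rewrite /inH_tensor tensorZl' linearZ /= tensorZl'.
Qed.
HB.instance Definition _ :=
  GRing.isLinear.Build _ _ _ _ inH_coac_fun inH_coac_linear.
Definition tensH_coac_fun (t : kspace NH) : tens (kspace NH) H :=
  inH_coac_fun t.

Lemma tensH_coac_linear : linear tensH_coac_fun.
Proof.
move=> c x y; rewrite -[x]/(inH x) -[y]/(inH y) -linearP.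
exact: (linearP inH_coac_fun).
Qed.
HB.instance Definition _ :=
  GRing.isLinear.Build _ _ _ _ tensH_coac_fun tensH_coac_linear.

Lemma tlift_tensH_coac (P : zmodType) (f : kspace NH -> H -> P)
    (t : tens (kspace N) H) : kbal f ->
  tlift f (tensH_coac_fun (inH t)) =
  tlift (fun n h => tlift (fun h1 h2 => f (inH (tensor n h1)) h2) (Delta h)) t.
Proof.
move=> bf; rewrite [LHS]tlift_tlift //; apply: eq_tlift => n h.
by rewrite tlift_tlift //; apply: eq_tlift => h1 h2; exact: tliftT.
Qed.

Definition tensH_obj : relHopfModule hH iota NH.
Proof.
apply: (@mk_obj _ _ _ _ _ iota_inj hA _ tensH_coac_fun).
- by move=> x y; rewrite linearD.
- move=> t a.
  rewrite -[LHS]/(inH_coac_fun (diag_act t a)) /inH_coac_fun.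
  rewrite tlift_tmap2; last exact: inH_coac_kbal.
  rewrite [RHS]tlift_tensH_coac; last first.
    apply/bilinear_balanced/tmap2_outer_bilinear; last exact: mul_bilinear.
    exact: rtimes_bilinear.
  apply: eq_tlift => u v.
  pose f v1 v2 b h1 h2 := inH_tensor (rt u b) (v1 * h1) (v2 * h2).
  transitivity (tlift (fun v1 v2 => tlift (fun b g =>
      tlift (f v1 v2 b) (Delta g)) (delta a)) (Delta v)).
    rewrite tlift_exchange; apply: eq_tlift => b g.
    by rewrite comulM tlift_tmap2 //; exact: (proj2 inH_tri).
  apply: eq_tlift => v1 v2.
  (* The coaction splits the H-factor of [delta a] and the action splits its A-factor;
     coassociativity of [delta] identifies the two. *)
  rewrite -delta_coassoc; last first.
    split=> [h|b]; split=> *; rewrite /f /inH_tensor /rt.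
    + by rewrite rtimesDr tensorDl linearD tensorDl.
    + by rewrite mulrDr tensorDr linearD tensorDl.
    + by rewrite rtimesZr -scalerAr tensorZr' tensorZl'.
    + by rewrite mulrDr tensorDr linearD tensorDl.
    + by rewrite mulrDr tensorDr.
    + by rewrite -!scalerAr tensorZr' linearZ /= tensorZr' tensorZl'.
  apply: eq_tlift => b g.
  have -> : rt (inH (tensor u v1)) b = inH (diag_act (tensor u v1) b) by [].
  rewrite /diag_act /tmap2 tliftT; last first.
    apply/bilinear_balanced/tmap2_outer_bilinear; last exact: mul_bilinear.
    exact: rtimes_bilinear.
  by rewrite tlift_comp tensor_tliftl.
- move=> t; apply: coassoc_tlift => f tf; rewrite -[t]/(inH t).
  rewrite tlift_tensH_coac; last exact: (kbal_tlift_linl tensH_coac_fun tf).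
  rewrite tlift_tensH_coac; last exact: (kbal_tlift_linr (comul hH) tf).
  have [t1 t2] := tf.
  apply: eq_tlift => n h.
  rewrite -(comul_coassoc hH (f := fun a b c => f (inH (tensor n a)) b c)).
    apply: eq_tlift => h1 h2; rewrite tlift_tensH_coac; last exact: (t1 h2).
    rewrite tliftT //.
    apply: (kbal_tlift_linr (comul hH) (f := fun n a b => f (inH (tensor n a))
      b h2)).
    split=> *; split=> *; case: (t1 h2) => b1 b2 b3.
    + by rewrite tensorDl linearD b1.
    + by rewrite tensorDr linearD b1.
    + by rewrite tensorZl' tensorZr'.
    + by rewrite tensorDr linearD b1.
    + by rewrite b2.
    + by rewrite tensorZr' linearZ /= b3.
  split=> [g|x]; last exact: t2.
  split=> *; case: (t1 g) => b1 b2 b3.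
  + by rewrite tensorDr linearD b1.
  + by rewrite b2.
  + by rewrite tensorZr' linearZ /= b3.
- move=> t; rewrite -[t]/(inH t) /slice tlift_tensH_coac;
  last exact: slice_kbal.
  rewrite -[RHS]/(inH t) -[t in RHS]tlift_tensorK (tlift_comp inH).
  apply: eq_tlift => n h.
  rewrite -[RHS](comul_counitr hH (g := fun h => inH (tensor n h))).
    by apply: eq_tlift => h1 h2; rewrite tensorZr' linearZ.
  by move=> *; rewrite tensorDr linearD.
Defined.

Lemma coac_tensH t : coac tensH_obj t = tensH_coac_fun t.
Proof. by []. Qed.

End TensorObject.

(** * The free object V (x) A on a finite dimensional comodule V *)

Section FreeObject.
Variables (k : fieldType) (H : algType k) (hH : hopfAlgebra H).
Variables (A : algType k) (iota : {lrmorphism A -> H}).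
Hypothesis iota_inj : injective iota.
Hypothesis hA : right_coideal hH iota.
Variables (n : nat) (c : 'I_n -> 'I_n -> H).

Local Notation Delta := (comul hH).
Local Notation eps := (eps hH).
Local Notation delta := (delta iota_inj hA).
Local Notation F := ('rV[A^c]_n : rmodType A).

(** Coassociativity and counit for the comodule V with basis e_i and coaction sending e_j to the sum
    over i of e_i (x) c_(i,j). *)
Hypothesis comul_c : forall i j, Delta (c i j) = \sum_l tensor (c i l) (c l j).
Hypothesis eps_c : forall i j, eps (c i j) = (i == j)%:R.

Definition free_coord (i : 'I_n) (x : F) : A := x 0 i.

Lemma free_coordD i x y : free_coord i (x + y) = free_coord i x + free_coord i
  y.
Proof. by rewrite /free_coord mxE. Qed.
Lemma free_coord_act i x a : free_coord i (rtimes x a) = free_coord i x * a.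
Proof. by rewrite /free_coord mxE. Qed.

Lemma free_coord_linear i : linear (free_coord i : kspace F -> A).
Proof.
move=> a x y; rewrite free_coordD; congr (_ + _).
by rewrite kspaceE free_coord_act -scalerAr mulr1.
Qed.
HB.instance Definition _ i :=
  GRing.isLinear.Build _ _ _ _ (free_coord i : kspace F -> A)
    (free_coord_linear i).

Definition free_basis_fun (i : 'I_n) (a : A) : kspace F :=
  rtimes (delta_mx 0 i : F) a.
Lemma free_basis_linear i : linear (free_basis_fun i).
Proof. by move=> a x y; rewrite /free_basis_fun rtimesDr rtimesZr. Qed.
HB.instance Definition _ i :=
  GRing.isLinear.Build _ _ _ _ (free_basis_fun i) (free_basis_linear i).
Definition free_basis i : {linear A -> kspace F} := free_basis_fun i.

Lemma free_coord_basis i j a :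
  free_coord i (free_basis j a) = if i == j then a else 0.
Proof.
rewrite /free_coord mxE mxE eqxx /=; case: (i == j).
  exact: mul1r.
exact: mul0r.
Qed.

Lemma free_basisM i a b : rt (free_basis i a) b = free_basis i (a * b).
Proof. exact: rtimesA. Qed.

Lemma free_expand (x : F) : x = \sum_i free_basis i (free_coord i x).
Proof.
apply/rowP => j; rewrite summxE (bigD1 j) //= [X in _ + X]big1 ?addr0.
  by rewrite -[RHS]/(free_coord j _) free_coord_basis eqxx.
move=> i ij; rewrite -[LHS]/(free_coord j _) free_coord_basis.
by rewrite eq_sym (negPf ij).
Qed.

(* The coaction of the free object maps e_i a to the sum over l of
   e_l a_(1) (x) c_(l,i) a_(2). *)
Definition free_term (l i : 'I_n) (b : A) (h : H) : tens (kspace F) H :=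
  tensor (free_basis l b) (c l i * h).

Lemma free_term_kbal l i : kbal (free_term l i).
Proof.
split=> *; rewrite /free_term ?linearD ?mulrDr ?tensorDl ?tensorDr //.
by rewrite linearZ algZr tensorZl' tensorZr'.
Qed.

Definition free_coac (x : kspace F) : tens (kspace F) H :=
  \sum_i \sum_l tlift (free_term l i) (delta (free_coord i x)).

Lemma free_coac_linear : linear free_coac.
Proof.
move=> a x y; rewrite /free_coac scaler_sumr -big_split; apply: eq_bigr => i _.
rewrite scaler_sumr -big_split; apply: eq_bigr => l _ /=.
rewrite linearP linearP tliftDr ?tliftZ; try exact: free_term_kbal.
congr (_ + _); rewrite /tlift scaler_sumr; apply: eq_bigr => p _.
by rewrite /free_term linearZ tensorZl'.
Qed.
HB.instance Definition _ :=
  GRing.isLinear.Build _ _ _ _ free_coac free_coac_linear.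

Lemma tlift_free_coac (P : zmodType) (f : kspace F -> H -> P) x : kbal f ->
  tlift f (free_coac x) =
  \sum_i \sum_l tlift (fun b h => f (free_basis l b) (c l i * h))
                      (delta (free_coord i x)).
Proof.
move=> bf; rewrite /free_coac tlift_sum //; apply: eq_bigr => i _.
rewrite tlift_sum //; apply: eq_bigr => l _.
by rewrite tlift_tlift //; apply: eq_tlift => b h; rewrite tliftT.
Qed.

Lemma tlift_free_coac_basis (P : zmodType) (f : kspace F -> H -> P) j a :
  kbal f ->
  tlift f (free_coac (free_basis j a)) =
  \sum_l tlift (fun b h => f (free_basis l b) (c l j * h)) (delta a).
Proof.
move=> bf; rewrite tlift_free_coac // (bigD1 j) //= [X in _ + X]big1 ?addr0.
  by rewrite [free_coord _ _]free_coord_basis eqxx.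
move=> i /negPf ij; rewrite big1 // => l _.
rewrite [free_coord _ _]free_coord_basis ij (linear0 delta) tlift0 //.
case: bf => b1 b2 b3; split=> *.
- by rewrite linearD b1.
- by rewrite mulrDr b2.
- by rewrite linearZ algZr b3.
Qed.

Definition free_obj : relHopfModule hH iota F.
Proof.
apply: (@mk_obj _ _ _ _ _ iota_inj hA _ free_coac).
- by move=> x y; rewrite linearD.
- move=> x a; rewrite /diag_act /tmap2 tlift_free_coac; last first.
    apply/bilinear_balanced/tmap2_outer_bilinear; last exact: mul_bilinear.
    exact: rtimes_bilinear.
  apply: eq_bigr => i _; apply: eq_bigr => l _.
  rewrite free_coord_act deltaM tlift_tmap2; last exact: free_term_kbal.
  apply: eq_tlift => b h; apply: eq_tlift => b' h'.
  by rewrite /free_term free_basisM mulrA.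
- move=> x; apply: coassoc_tlift => f tf.
  have [t1 t2] := tf.
  rewrite tlift_free_coac; last exact: (kbal_tlift_linl free_coac tf).
  rewrite tlift_free_coac; last exact: (kbal_tlift_linr (comul hH) tf).
  apply: eq_bigr => i _.
  pose g l l' b h1 h2 := f (free_basis l' b) (c l' l * h1) (c l i * h2).
  have gtri l l' : ktri (g l l').
    split=> [h|b].
      case: (t1 (c l i * h)) => b1 b2 b3; split=> *; rewrite /g.
      - by rewrite linearD b1.
      - by rewrite mulrDr b2.
      - by rewrite linearZ algZr b3.
    case: (t2 (free_basis l' b)) => b1 b2 b3; split=> *; rewrite /g.
    - by rewrite mulrDr b1.
    - by rewrite mulrDr b2.
    - by rewrite !algZr b3.
  transitivity (\sum_l \sum_l' tlift (fun b h => tlift (fun b' h' =>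
     g l l' b' h' h) (delta b)) (delta (free_coord i x))).
    apply: eq_bigr => l _; rewrite -tlift_sumf; apply: eq_tlift => b h.
    by rewrite tlift_free_coac_basis; last exact: t1.
  rewrite exchange_big; apply: eq_bigr => l' _.
  transitivity (\sum_l tlift (fun b h => tlift (g l l' b) (Delta h))
                      (delta (free_coord i x))).
    by apply: eq_bigr => l _; rewrite -delta_coassoc.
  rewrite -tlift_sumf; apply: eq_tlift => b h.
  rewrite comulM tlift_tmap2; last exact: t2.
  rewrite comul_c -/(tens H H) tlift_sum; last first.
    apply: kbal_tlift => u v; case: (t2 (free_basis l' b)) => b1 b2 b3.
    split=> *; rewrite ?mulrDl ?b1 ?b2 //.
    by rewrite !algZl b3.
  apply: eq_bigr => l _; rewrite tliftT //.
  apply: kbal_tlift => u v; case: (t2 (free_basis l' b)) => b1 b2 b3.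
  split=> *; rewrite ?mulrDl ?b1 ?b2 //.
  by rewrite !algZl b3.
- move=> x; rewrite /slice tlift_free_coac; last exact: slice_kbal.
  rewrite [RHS]free_expand; apply: eq_bigr => i _.
  rewrite (bigD1 i) //= [X in _ + X]big1 ?addr0.
    rewrite -(delta_counitr iota_inj hA (g := free_basis i)).
      apply: eq_tlift => b h.
      by rewrite -![counit hH _]/(eps _) epsM eps_c eqxx mul1r linearZ.
    by move=> *; rewrite linearD.
  move=> l /negPf li; rewrite -[RHS](tlift_zero _ (delta (free_coord i x))).
  apply: eq_tlift => b h.
  by rewrite -![counit hH _]/(eps _) epsM eps_c li mul0r scale0r.
Defined.

Lemma coac_free x : coac free_obj x = free_coac x.
Proof. by []. Qed.

End FreeObject.

(** * Flatness *)

Section BalancedTensor.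
Variables (A : nzRingType) (M : rmodType A) (N : lmodType A).

Definition pureA (m : M) (n : N) : tensA M N := tpure _ _ m n.

Lemma pureADl m m' n : pureA (m + m') n = pureA m n + pureA m' n.
Proof. exact: tpureDl. Qed.
Lemma pureADr m n n' : pureA m (n + n') = pureA m n + pureA m n'.
Proof. exact: tpureDr. Qed.
Lemma pureA_bal m a n : pureA (rtimes m a) n = pureA m (a *: n).
Proof. exact: tpure_bal. Qed.
Lemma pureA0l n : pureA 0 n = 0.
Proof. by apply: (addrI (pureA 0 n)); rewrite -pureADl !addr0. Qed.
Lemma pureA0r m : pureA m 0 = 0.
Proof. by apply: (addrI (pureA m 0)); rewrite -pureADr !addr0. Qed.
Lemma pureA_suml (I : Type) (r : seq I) (P : pred I) (F : I -> M) n :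
  pureA (\sum_(i <- r | P i) F i) n = \sum_(i <- r | P i) pureA (F i) n.
Proof.
apply: (big_morph (fun m => pureA m n)) => [x y|]; first exact: pureADl.
exact: pureA0l.
Qed.
Lemma pureA_sumr (I : Type) (r : seq I) (P : pred I) m (F : I -> N) :
  pureA m (\sum_(i <- r | P i) F i) = \sum_(i <- r | P i) pureA m (F i).
Proof.
apply: (big_morph (pureA m)) => [x y|]; first exact: pureADr.
exact: pureA0r.
Qed.
Lemma pureA_expand (x : tensA M N) : x = \sum_(p <- trepr x) pureA p.1 p.2.
Proof. exact: btensE. Qed.

Definition balA (P : zmodType) (f : M -> N -> P) :=
  balanced (fun (a : A) m => rtimes m a) ( *:%R ) f.

Lemma tliftA_sum (P : zmodType) (f : M -> N -> P) (I : Type) (r : seq I)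
    (Q : pred I) (F : I -> tensA M N) : balA f ->
  tlift f (\sum_(i <- r | Q i) F i) = \sum_(i <- r | Q i) tlift f (F i).
Proof.
move=> bf; apply: (big_morph (tlift f)) => [x y|]; first exact: (tliftD bf).
by apply: (addrI (tlift f (0 : tensA M N))); rewrite -(tliftD bf) !addr0.
Qed.
Lemma tliftA0 (P : zmodType) (f : M -> N -> P) : balA f ->
  tlift f (0 : tensA M N) = 0.
Proof.
move=> bf.
by apply: (addrI (tlift f (0 : tensA M N))); rewrite -(tliftD bf) !addr0.
Qed.
Lemma tliftA_pure (P : zmodType) (f : M -> N -> P) m n : balA f ->
  tlift f (pureA m n) = f m n.
Proof. by move=> bf; exact: tliftE. Qed.

End BalancedTensor.

Section TmapA.
Variables (A : nzRingType) (M M' : rmodType A) (N N' : lmodType A).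
Variables (f : {linear M -> M'}) (g : {linear N -> N'}).

Lemma tmapA_balA : balA (fun m n => pureA (f m) (g n)).
Proof.
split=> [m m' n|m n n'|a m n]; rewrite ?linearD ?pureADl ?pureADr //.
by rewrite [g (a *: n)]linearZ -pureA_bal; congr pureA; exact: linearZ.
Qed.
Lemma tmapA_pure m n : tmapA f g (pureA m n) = pureA (f m) (g n).
Proof. exact/tliftE/tmapA_balA. Qed.
Lemma tmapA_sum (I : Type) (r : seq I) (Q : pred I) (F : I -> tensA M N) :
  tmapA f g (\sum_(i <- r | Q i) F i) = \sum_(i <- r | Q i) tmapA f g (F i).
Proof. exact/tliftA_sum/tmapA_balA. Qed.
Lemma tmapAE x : tmapA f g x = \sum_(p <- trepr x) pureA (f p.1) (g p.2).
Proof. by []. Qed.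
End TmapA.

Section Kernel.
Variables (R : pzRingType) (U V : lmodType R) (f : {linear U -> V}).

Definition ker_pred : {pred U} := [pred x | f x == 0].
Lemma ker_submod : submod_closed ker_pred.
Proof.
split=> [|a x y]; rewrite !inE ?linear0 //.
by rewrite linearP => /eqP-> /eqP->; rewrite scaler0 addr0.
Qed.
HB.instance Definition _ := GRing.isSubmodClosed.Build R U ker_pred ker_submod.
Definition kerT : Type := {x : U | x \in ker_pred}.
HB.instance Definition _ := SubChoice.on kerT.
HB.instance Definition _ := [SubChoice_isSubLmodule of kerT by <:].
Definition ker_incl : {linear kerT -> U} := val.
Lemma ker_inclP x : f (ker_incl x) = 0.
Proof. by apply/eqP; exact: (valP x). Qed.
Lemma ker_exact : exact_at ker_incl f.
Proof.
move=> y; split=> [/eqP fy|[x <-]]; last exact: ker_inclP.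
by exists (exist _ y fy).
Qed.
End Kernel.

Section FlatCriterion.
Variables (k : fieldType) (A : algType k) (M : rmodType A).

(** The product v C of a row of elements of M by a matrix over A; [combA] is its associativity. *)
Definition comb (m n : nat) (v : 'I_m -> M) (C : 'M[A]_(m, n)) (j : 'I_n) : M :=
  \sum_i rtimes (v i) (C i j).

Lemma combA m n p (v : 'I_m -> M) (C : 'M[A]_(m, n)) (D : 'M[A]_(n, p)) j :
  comb (comb v C) D j = comb v (C *m D) j.
Proof.
rewrite /comb; under eq_bigr do rewrite rtimes_suml.
rewrite exchange_big; apply: eq_bigr => i _; rewrite mxE rtimes_sumr.
by apply: eq_bigr => l _; rewrite rtimesA.
Qed.

Lemma eq_comb m n (v w : 'I_m -> M) (C : 'M[A]_(m, n)) j :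
  v =1 w -> comb v C j = comb w C j.
Proof. by move=> vw; apply: eq_bigr => i _; rewrite vw. Qed.

Lemma comb0 m n (v : 'I_m -> M) j : comb v (0 : 'M[A]_(m, n)) j = 0.
Proof. by rewrite /comb big1 // => i _; rewrite mxE rtimes0r. Qed.

Hypothesis flatM : right_flat M.

Section Relation.
Variables (m r : nat) (v : 'I_m -> M) (B : 'M[A]_(m, r)).

Definition rel_fun (x : 'rV[A]_m) : 'rV[A]_r := x *m B.
Lemma rel_linear : linear rel_fun.
Proof. by move=> a x y; rewrite /rel_fun mulmxDl -scalemxAl. Qed.
HB.instance Definition _ := GRing.isLinear.Build _ _ _ _ rel_fun rel_linear.
Definition relm : {linear 'rV[A]_m -> 'rV[A]_r} := rel_fun.

(** The equational criterion for flatness. As v B = 0, the sum of the v_i (x) e_i dies in M (x)_A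
    A^r, so it comes from M (x)_A Ker B; the terms w_l (x) y_l of a preimage provide [w] and the
    rows of [C]. *)
Lemma flat_equational : (forall j, comb v B j = 0) ->
  exists (p : nat) (w : 'I_p -> M) (C : 'M[A]_(p, m)),
    (forall i, v i = comb w C i) /\ C *m B = 0.
Proof.
move=> vB.
pose tau : tensA M 'rV[A]_m := \sum_i pureA (v i) (delta_mx 0 i).
have [x xE] : exists x, tmapA idfun (ker_incl relm) x = tau.
  apply/(flatM (ker_exact relm)); rewrite /tau tmapA_sum.
  transitivity (\sum_i \sum_j pureA (v i) (B i j *: (delta_mx 0 j : 'rV[A]_r))).
    apply: eq_bigr => i _; rewrite tmapA_pure -pureA_sumr; congr pureA.
    rewrite -[LHS]/(delta_mx 0 i *m B) -rowE [LHS]row_sum_delta.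
    by apply: eq_bigr => j _; rewrite mxE.
  rewrite exchange_big big1 // => j _.
  under eq_bigr do rewrite -pureA_bal.
  by rewrite -pureA_suml [X in pureA X _]vB pureA0l.
pose s := in_tuple (trepr x).
exists (size (trepr x)), (fun l => (tnth s l).1).
exists (\matrix_(l, i) ker_incl relm (tnth s l).2 0 i); split=> [i|].
  have bal : balA (fun (n : M) (y : 'rV[A]_m) => rtimes n (y 0 i)).
    split=> *; rewrite ?rtimesDl ?mxE ?rtimesDr //.
    by rewrite rtimesA.
  transitivity (tlift (fun (n : M) (y : 'rV[A]_m) => rtimes n (y 0 i)) tau).
    rewrite /tau tliftA_sum // (bigD1 i) //= big1 ?addr0 => [|j ji]; last first.
      by rewrite tliftA_pure // mxE eq_sym (negPf ji) andbF rtimes0r.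
    by rewrite tliftA_pure // mxE !eqxx rtimes1.
  rewrite -xE.
  rewrite tmapAE tliftA_sum // big_tnth; apply: eq_bigr => l _.
  by rewrite tliftA_pure // mxE.
apply/row_matrixP => l; rewrite row_mul row0.
rewrite -[RHS](ker_inclP (tnth s l).2); congr (_ *m _).
by apply/rowP => i; rewrite !mxE.
Qed.

End Relation.
End FlatCriterion.

Section FlatQuotient.
Variables (k : fieldType) (A : algType k) (M : rmodType A) (L : submodule M).
Hypothesis flatQ : right_flat (quot L).

Lemma qproj_comb m n (v : 'I_m -> M) (C : 'M[A]_(m, n)) j :
  qproj L (comb v C j) = comb (fun i => qproj L (v i)) C j.
Proof. by rewrite /comb linear_sum; apply: eq_bigr => i _; exact: linearZ. Qed.

(** Purity of L in M. In M/L the classes of v factor as z C with C B = 0; subtracting u C, for lifts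
    u of z, brings v into L and leaves v B unchanged. *)
Lemma flat_quotient_relation m r (v : 'I_m -> M) (B : 'M[A]_(m, r)) :
  (forall j, L (comb v B j)) ->
  exists2 w : 'I_m -> M, (forall i, L (w i)) &
    forall j, comb v B j = comb w B j.
Proof.
move=> LvB.
have [|p [z [C [zC CB]]]] := @flat_equational _ _ _ flatQ _ _ (fun i => qproj L
  (v i)) B.
  by move=> j; rewrite -qproj_comb; exact/qproj_eq0.
pose u l := qrepr (z l).
have uz l : qproj L (u l) = z l by exact: qreprK.
exists (fun i => v i - comb u C i) => [i|j].
  apply/qproj_eq0; rewrite linearB qproj_comb zC.
  by rewrite (eq_comb _ _ uz) subrr.
transitivity (comb v B j - comb (comb u C) B j).
  by rewrite combA CB comb0 subr0.
by rewrite /comb -sumrB; apply: eq_bigr => i _; rewrite rtimesBl.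
Qed.

End FlatQuotient.

(* The module generated by [v] need not be known to be flat: flatness of M and
   of its quotient suffices. *)
Lemma flat_finite_section (k : fieldType) (A : algType k) (M : rmodType A)
    n r (v : 'I_n -> M) (B : 'M[A]_(n, r)) :
  right_flat M -> right_flat (quot (span_sub v)) ->
  (forall j, comb v B j = 0) ->
  exists E : 'M[A]_n, (forall j, v j = comb v E j) /\ E *m B = 0.
Proof.
move=> flatM flatQ /(flat_equational flatM)[p [z [C [vE CB]]]].
(* The z may lie outside the span of v. As z C = v lies in it, purity of the span provides w = v G
   with w C = v, whence E = G C. *)
have [j|w Lw wE] := @flat_quotient_relation _ _ _ _ flatQ _ _ z C.
  by rewrite -vE; exact: span_gen.
have [G GE] := choice Lw.
exists ((\matrix_(i, l) (G l i : A)) *m C); rewrite -mulmxA CB mulmx0;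
  split=> // j.
rewrite -combA vE wE; apply: eq_comb => l.
by rewrite GE /comb; apply: eq_bigr => i _; rewrite mxE.
Qed.

(** * The augmentation ideal and the Nakayama lemma *)

Section Augmentation.
Variables (k : fieldType) (H : algType k) (hH : hopfAlgebra H).
Variables (A : algType k) (iota : {lrmorphism A -> H}).
Local Notation eps := (eps hH).

(* The submodule Y A+, where A+ is the kernel of the counit on A. *)
Definition aug_sub (Y : rmodType A) : submodule Y.
Proof.
exists (fun y => exists n (v : 'I_n -> Y) (a : 'I_n -> A),
  (forall i, eps (iota (a i)) = 0) /\ y = \sum_i rtimes (v i) (a i)).
- by exists 0%N, (fun=> 0), (fun=> 0); rewrite big_ord0; split=> // -[].
- move=> _ _ [n [v [a [a0 ->]]]] [p [w [b [b0 ->]]]].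
  exists (n + p)%N, (fun i => match split i with inl j => v j | inr j => w j
    end).
  exists (fun i => match split i with inl j => a j | inr j => b j end).
  split=> [i|]; first by case: (split i).
  rewrite big_split_ord /=; congr (_ + _); apply: eq_bigr => i _.
    by rewrite -[lshift p i]/(unsplit (inl i)) unsplitK.
  by rewrite -[rshift n i]/(unsplit (inr i)) unsplitK.
- move=> b _ [n [v [a [a0 ->]]]]; exists n, v, (fun i => a i * (b : A)).
  split=> [i|]; first by rewrite rmorphM epsM a0 mul0r.
  by rewrite scaler_sumr; apply: eq_bigr => i _; exact: rtimesA.
Defined.

Lemma aug_sub_in (Y : rmodType A) (y : Y) a :
  eps (iota a) = 0 -> aug_sub Y (rtimes y a).
Proof.
by exists 1%N, (fun=> y), (fun=> a); split=> //; rewrite big_ord1.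
Qed.

End Augmentation.

(** M (x)_A - keeps 0 -> A -> H exact at A, and m (x) a |-> m a recovers M from M (x)_A A. The zero
    endomorphism of A plays the part of the map 0 -> A. *)
Lemma flat_incl_inj (k : fieldType) (H A : algType k)
    (iota : {lrmorphism A -> H}) (M : rmodType A) (m : M) :
  injective iota -> right_flat M ->
  pureA m (1 : lregmod iota) = 0 -> m = 0.
Proof.
move=> iota_inj flatM m0.
have inc_lin : linear (fun a : A^o => iota a : lregmod iota).
  by move=> a x y; rewrite rmorphD; congr (_ + _); exact: rmorphM.
pose I := GRing.isLinear.Build _ _ _ _ (fun a : A^o => iota a : lregmod iota)
  inc_lin.
pose inc : {linear A^o -> lregmod iota} := HB.pack (fun a : A^o => iota a :
  lregmod iota) I.
pose z : {linear A^o -> A^o} := \0.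
have ex : exact_at z inc.
  move=> y; split=> [y0|[x <-]]; last exact: linear0.
  by exists 0; apply/esym/iota_inj; rewrite rmorph0.
have [] := flatM _ _ _ z inc ex (pureA m (1 : A^o)).
case=> [|x xE _]; first by rewrite tmapA_pure /= -[inc _]/(iota 1) rmorph1.
have bal : balA (fun (n : M) (a : A^o) => rtimes n a).
  split=> *; rewrite ?rtimesDl ?rtimesDr //.
  by rewrite rtimesA.
have := congr1 (tlift (fun (n : M) (a : A^o) => rtimes n a)) xE.
rewrite [X in _ = X](tliftA_pure _ _ bal) rtimes1 => <-.
rewrite tmapAE big1 ?(tliftA0 bal) // => p _; exact: pureA0r.
Qed.

Section Nakayama.
Variables (k : fieldType) (H : algType k) (hH : hopfAlgebra H).
Variables (A : algType k) (iota : {lrmorphism A -> H}).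
Hypothesis iota_inj : injective iota.
Hypothesis hA : right_coideal hH iota.
Variables (Y : rmodType A) (hY : relHopfModule hH iota Y).
Variables (L : submodule Y) (cL : costable hY L).
Hypothesis flatQ : right_flat (quot L).

Local Notation Delta := (comul hH).
Local Notation S := (antipode hH).
Local Notation eps := (eps hH).
Local Notation Q := (quot L).
Local Notation T := (tensA Q (lregmod iota)).

(* theta (y (x) h) = y_(0) (x) S(y_(1)) h kills Y A+ (x) H and L (x) H, and
   sends the coaction of x to x (x) 1. *)
Definition theta0 (y : kspace Y) (g h : H) : T :=
  pureA (qproj L y) (S g * h : lregmod iota).

Lemma theta0_tri : ktri theta0.
Proof.
have cZ c (q : kspace Q) (g : H) :
    pureA (c *: q : Q) (g : lregmod iota) = pureA (q : Q) (c *: g : lregmod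
      iota).
  rewrite [c *: q]kspaceE pureA_bal; congr pureA.
  by rewrite -[LHS]/(iota c%:A * g) linearZ /= rmorph1 -scalerAl mul1r.
have qZ c (y : kspace Y) : qproj L (c *: y : kspace Y) =
    (c *: (qproj L y : kspace Q) : kspace Q).
  by rewrite !kspaceE -rtimes_linear.
split=> [h|y]; split=> *; rewrite /theta0.
- by rewrite linearD pureADl.
- by rewrite antiD mulrDl -pureADr.
- by rewrite qZ cZ antiZ algZl.
- by rewrite antiD mulrDl -pureADr.
- by rewrite mulrDr -pureADr.
- by rewrite antiZ algZl algZr.
Qed.

Definition theta (y : kspace Y) (h : H) : T :=
  tlift (fun y0 g => theta0 y0 g h) (coac hY y).

Lemma theta_kbal : kbal theta.
Proof. exact: (kbal_tlift_linl (coac hY) theta0_tri). Qed.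

(** As S reverses products, y_(0) a_(1) (x) S(y_(1) a_(2)) h equals y_(0) (x) a_(1) S(a_(2))
    S(y_(1)) h once a_(1) crosses the tensor sign over A; there the antipode axiom applies. *)
Lemma theta_act y a h :
  theta (rtimes (y : Y) a) h =
  tlift (fun y0 g => pureA (qproj L y0)
           ((eps (iota a))%:A * (S g * h) : lregmod iota)) (coac hY y).
Proof.
rewrite /theta (tlift_coac_act iota_inj hA); last exact: (proj1 theta0_tri).
apply: eq_tlift => y0 g.
rewrite -(delta_antipoder iota_inj hA
  (g := fun z => pureA (qproj L y0) (z * (S g * h) : lregmod iota))).
  apply: eq_tlift => b f; rewrite /theta0 rtimes_linear pureA_bal.
  by rewrite antipodeM; congr pureA; rewrite -!mulrA.
by move=> u v; rewrite mulrDl -pureADr.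
Qed.

Lemma theta_aug y h : aug_sub hH iota Y y -> theta y h = 0.
Proof.
have [tD _ _] := theta_kbal => -[n [v [a [a0 ->]]]].
rewrite (big_morph (fun y => theta y h) (id1 := 0) (op1 := +%R)).
- rewrite big1 // => i _; rewrite theta_act a0 /tlift big1 // => p _.
  by rewrite scale0r mul0r pureA0r.
- by move=> x z; exact: tD.
- by apply: (addrI (theta 0 h)); rewrite -tD !addr0.
Qed.

Lemma theta_sub y h : L y -> theta y h = 0.
Proof.
move=> /(costable_rep cL)[I [l [F [g [LF yE]]]]].
have b0 := proj1 theta0_tri h.
rewrite /theta yE tlift_sum // big1 // => i _; rewrite tliftT // /theta0.
by rewrite (proj2 (qproj_eq0 L _)) // pureA0l.
Qed.

(** Coassociativity brings S(y_(1)) and y_(2) together, and they cancel. *)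
Lemma theta_coac x :
  tlift theta (coac hY x) = pureA (qproj L x) (1 : lregmod iota).
Proof.
rewrite (coac_coassoc _ _ theta0_tri).
rewrite -(coac_counitr hY (g := fun y => pureA (qproj L y) (1 : lregmod iota))).
  apply: eq_tlift => y h.
  rewrite /theta0 (comul_antipodel hH
    (g := fun z => pureA (qproj L y) (z : lregmod iota))).
    have := proj1 theta0_tri 1 => -[_ _ /(_ (eps h) y 1)].
    by rewrite /theta0 antiZ antipode1 !mulr1 => <-.
  by move=> u v; rewrite -pureADr.
by move=> u v; rewrite linearD pureADl.
Qed.

(** By [theta_coac], x (x) 1 is the sum of the theta (F i) (h i), all of which vanish; flatness of
    Y/L concludes. Only the left factors of one expression of the coaction matter, so the argument
    also serves for a single element. *)
Lemma nakayama_rep (I : Type) (l : seq I) (F : I -> kspace Y) (h : I -> H) (x :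
  Y) :
  coac hY x = \sum_(i <- l) tensor (F i) (h i) ->
  (forall i, sub_add L (aug_sub hH iota Y) (F i)) -> L x.
Proof.
move=> xE LF; apply/qproj_eq0; apply: (flat_incl_inj iota_inj flatQ).
have bt := theta_kbal; have [tD _ _] := bt.
rewrite -theta_coac xE tlift_sum // big1 // => i _; rewrite tliftT //.
have [y [z [Ly Az ->]]] := LF i.
by rewrite tD theta_sub // theta_aug // addr0.
Qed.

Lemma nakayama (K : submodule Y) : costable hY K ->
  sub_le K (sub_add L (aug_sub hH iota Y)) -> sub_le K L.
Proof.
move=> cK KL x /(costable_rep cK)[I [l [F [h [KF xE]]]]].
by apply: (nakayama_rep xE) => i; exact: KL.
Qed.

End Nakayama.

(** * Finitely generated subobjects *)

Section Concatenation.
Variables (R : pzRingType) (V : lmodType R) (n p : nat).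
Variables (v : 'I_n -> V) (w : 'I_p -> V).

Definition cat_fam (i : 'I_(n + p)) : V :=
  match split i with inl j => v j | inr j => w j end.

Lemma cat_fam_l j : cat_fam (lshift p j) = v j.
Proof. by rewrite /cat_fam -[lshift p j]/(unsplit (inl j)) unsplitK. Qed.
Lemma cat_fam_r j : cat_fam (rshift n j) = w j.
Proof. by rewrite /cat_fam -[rshift n j]/(unsplit (inr j)) unsplitK. Qed.

Lemma cat_famP (Q : V -> Prop) :
  (forall j, Q (v j)) -> (forall j, Q (w j)) -> forall i, Q (cat_fam i).
Proof. by move=> Qv Qw i; rewrite /cat_fam; case: (split i). Qed.

Lemma span_cat_l : sub_le (span_sub v) (span_sub cat_fam).
Proof. by apply: span_le => j; rewrite -cat_fam_l; exact: span_gen. Qed.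
Lemma span_cat_r : sub_le (span_sub w) (span_sub cat_fam).
Proof. by apply: span_le => j; rewrite -cat_fam_r; exact: span_gen. Qed.
End Concatenation.

Section Independence.
Variables (k : fieldType) (V : lmodType k).

Definition indep n (v : 'I_n -> V) : Prop :=
  forall c : 'I_n -> k, \sum_i c i *: v i = 0 -> forall i, c i = 0.

(** A family of minimal length with the same span is independent, since a nontrivial relation would
    express one member through the others. *)
Lemma exists_basis n (v : 'I_n -> V) :
  exists m (u : 'I_m -> V), [/\ indep u, sub_le (span_sub v) (span_sub u)
    & sub_le (span_sub u) (span_sub v)].
Proof.
pose Q m := `[< exists u : 'I_m -> V,
  sub_le (span_sub v) (span_sub u) /\ sub_le (span_sub u) (span_sub v) >].
have exQ : exists m, Q m by exists n; apply/asboolP; exists v; split.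
case: (ex_minnP exQ) => m /asboolP[u [vu uv]] minm; exists m, u;
  split=> // c c0 i.
apply: contrapT => /eqP ci.
case: m u vu uv minm c c0 i ci => [|m] u vu uv minm c c0 i ci;
  first by case: i ci.
suff /minm : Q m by rewrite ltnn.
apply/asboolP; exists (fun j => u (lift i j)).
have uu j : span_sub (fun j => u (lift i j)) (u j).
  have gen j' : span_sub (fun j => u (lift i j)) (u (lift i j')).
    exact: (span_gen (fun j => u (lift i j))).
  case: (unliftP i j) => [j' ->|->]; first exact: gen.
  have -> : u i = - ((c i)^-1 *: \sum_(j | j != i) c j *: u j).
    move: c0; rewrite (bigD1 i) //= => /eqP; rewrite addrC addr_eq0 => /eqP->.
    by rewrite scalerN opprK scalerA mulVf // scale1r.
  apply/subN/subZ/sub_sum => j' ; rewrite eq_sym => /unlift_some[j'' -> _].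
  exact: subZ.
split=> x; first by move=> /vu; exact: span_le.
by move=> xu; apply: uv; move: x xu; apply: span_le => j; exact: span_gen.
Qed.

Lemma indep_dual n (v : 'I_n -> V) : indep v ->
  forall i, exists f : {linear V -> k^o}, forall j, f (v j) = (i == j)%:R.
Proof.
(* Replacing v_i by 0 gives the span of the other members without reindexing. *)
move=> iv i; pose w j := if j == i then 0 else v j.
have vi : ~ span_sub w (v i).
  move=> [c cE].
  suff /(_ i) : forall j, (if j == i then 1 else - c j) = 0.
    by rewrite eqxx => /eqP; rewrite oner_eq0.
  apply: iv; rewrite (bigD1 i) //= eqxx scale1r {1}cE (bigD1 i) //=.
  rewrite {1}/w eqxx scaler0 add0r -big_split big1 //= => j /negPf ji.
  by rewrite /w ji scaleNr subrr.
have [f fi fw] := sub_separation vi; exists f => j.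
have [<-//|ij] := eqVneq i j.
have -> : v j = w j by rewrite /w eq_sym (negPf ij).
by rewrite fw //; exact: span_gen.
Qed.

Lemma indep_tensor n (v : 'I_n -> V) (W : lmodType k) (x y : 'I_n -> W) :
  indep v -> \sum_i tensor (v i) (x i) = \sum_i tensor (v i) (y i) -> x =1 y.
Proof.
move=> iv xy i; have [f fv] := indep_dual iv i.
have bf : kbal (fun (m : V) (w : W) => (f m : k) *: w).
  split=> *; first by rewrite linearD scalerDl.
    exact: scalerDr.
  by rewrite scalerA mulrC [f (_ *: _)]linearZ.
have comp (z : 'I_n -> W) :
    tlift (fun (m : V) (w : W) => (f m : k) *: w) (\sum_i tensor (v i) (z i)) =
      z i.
  rewrite tlift_sum // (bigD1 i) //= big1 ?addr0 => [|j /negPf ji].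
    by rewrite tliftT // fv eqxx scale1r.
  by rewrite tliftT // fv eq_sym ji scale0r.
by rewrite -[LHS]comp xy comp.
Qed.

End Independence.

(** * Finite dimensional subcomodules and their comatrices *)

Section Comatrix.
Variables (k : fieldType) (H : algType k) (hH : hopfAlgebra H).
Variables (A : algType k) (iota : {lrmorphism A -> H}).
Hypothesis iota_inj : injective iota.
Hypothesis hA : right_coideal hH iota.
Local Notation Delta := (comul hH).
Local Notation eps := (eps hH).

Section Finite.
Variables (M : rmodType A) (hM : relHopfModule hH iota M).

(** The fundamental theorem of comodules: the [u] are the left factors in a finite expression of the
    coaction of m, and by coassociativity a slice of some [u i] is a contraction of m_(0) (x)
    Delta(m_(1)), whose left factors are again among the [u]. The third clause keeps the result
    inside a given subobject; it is applied in the kernel of a presentation. *)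
Lemma finite_subcomodule1 (m : M) :
  exists n (u : 'I_n -> kspace M),
    [/\ span_sub u m,
        forall xi i, span_sub u (slice xi (coac hM (u i)))
      & forall L : submodule M, costable hM L -> L m -> forall i, L (u i)].
Proof.
have [l lE] := slice_rep (coac hM m).
pose s := in_tuple l.
pose u (i : 'I_(size l)) := slice (tnth s i).1 (coac hM m).
have mE : coac hM m = \sum_i tensor (u i) (tnth s i).2 by rewrite {1}lE
  big_tnth.
exists (size l), u; split=> [|xi i|L cL Lm i].
- rewrite -[m](coac_counit hM) mE slice_sum; apply: sub_sum => i _.
  by rewrite sliceT; apply: subZ; exact: span_gen.
- pose eta := (tnth s i).1.
  pose f (x : kspace M) (g h : H) := (eta h : k) *: ((xi g : k) *: x).
  have ft : ktri f.
    split=> [h|x]; split=> *; rewrite /f.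
    - by rewrite !scalerDr.
    - by rewrite linearD scalerDl scalerDr.
    - by congr (_ *: _); rewrite scalerA mulrC [xi (_ *: _)]linearZ.
    - by rewrite linearD scalerDl scalerDr.
    - by rewrite linearD scalerDl.
    - rewrite [xi (_ *: _)]linearZ [eta (_ *: _)]linearZ !scalerA.
      by congr (_ *: _); exact: etrans (mulrCA _ _ _) (mulrA _ _ _).
  (* As u_i is the slice of the coaction of m by eta, this is the sum of the eta(m_(2)) xi(m_(1))
     m_(0). *)
  have -> : slice xi (coac hM (u i)) =
      tlift (fun x h => tlift (fun y g => f y g h) (coac hM x)) (coac hM m).
    pose g : {linear kspace M -> kspace M} := slice xi \o coac hM.
    rewrite -[LHS]/(g (\sum_(p <- trepr (coac hM m)) (eta p.2 : k) *: p.1)).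
    rewrite linear_sum; apply: eq_bigr => p _; rewrite linearZ.
    exact: scaler_sumr.
  rewrite coac_coassoc // mE tlift_sum;
    last exact: (kbal_tlift_linr (comul hH) ft).
  apply: sub_sum => j _; rewrite tliftT;
    last exact: (kbal_tlift_linr (comul hH) ft).
  by apply: sub_sum => p _; do 2!apply: subZ; exact: span_gen.
- exact: cL.
Qed.

Lemma finite_subcomodule r (w : 'I_r -> M) :
  exists n (u : 'I_n -> kspace M),
    [/\ forall j, span_sub u (w j),
        forall xi i, span_sub u (slice xi (coac hM (u i)))
      & forall L : submodule M, costable hM L -> (forall j, L (w j)) ->
          forall i, L (u i)].
Proof.
elim: r w => [|r IH] w.
  by exists 0%N, (fun=> 0); split=> [[]//|xi []//|L _ _ []].
have [n [u [uw us uL]]] := IH (fun j => w (lift ord0 j)).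
have [p [v [vw vs vL]]] := finite_subcomodule1 (w ord0).
exists (n + p)%N, (cat_fam u v); split=> [j|xi|L cL Lw].
- case: (unliftP ord0 j) => [j' ->|->]; first by apply: span_cat_l; exact: uw.
  by apply: span_cat_r; exact: vw.
- apply: (cat_famP (Q := fun x => span_sub (cat_fam u v) (slice xi (coac hM
  x)))).
    by move=> j; apply: span_cat_l.
  by move=> j; apply: span_cat_r.
- by apply: (cat_famP (Q := L)) => j; [apply: uL => // i;
  exact: Lw|apply: vL => //; exact: Lw].
Qed.

Lemma kspan_span n (u : 'I_n -> kspace M) (x : kspace M) :
  span_sub u x -> span_sub (u : 'I_n -> M) x.
Proof.
move=> [c ->]; exists (fun i => (c i)%:A : A^c).
by apply: eq_bigr => i _; rewrite kspaceE.
Qed.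

(** The coaction of u_i a is the sum of the x a_(1) (x) h a_(2), where the x are slices of the
    coaction of u_i; so stability need only be tested on generators. *)
Lemma span_costable n (u : 'I_n -> M) :
  (forall xi i, span_sub u (slice xi (coac hM (u i)))) ->
  costable hM (span_sub u).
Proof.
move=> us _ [a ->] xi.
rewrite (linear_sum (coac hM)) slice_sum; apply: sub_sum => i _.
rewrite -[a i *: u i]/(rtimes (u i) (a i)) (coac_act iota_inj hA).
have [l lE] := slice_rep (coac hM (u i)).
rewrite lE /diag_act.
rewrite /tmap2 tlift_sum; last first.
  apply/bilinear_balanced/tmap2_outer_bilinear; last exact: mul_bilinear.
  exact: rtimes_bilinear.
rewrite slice_sum; apply: sub_sum => p _; rewrite tliftT; last first.
  apply/bilinear_balanced/tmap2_outer_bilinear; last exact: mul_bilinear.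
  exact: rtimes_bilinear.
rewrite slice_tlift; apply: sub_sum => q _; rewrite sliceT.
by apply: (subZ (_ : A^c)); apply: (subZ (_ : A^c)); exact: us.
Qed.

(** Over an independent family the coefficients of the coaction are unique; comparing those of v_i
    in the comodule axioms gives the identities for c. *)
Lemma comatrix n (v : 'I_n -> kspace M) : indep v ->
  (forall xi i, span_sub v (slice xi (coac hM (v i)))) ->
  exists c : 'I_n -> 'I_n -> H,
    [/\ forall j, coac hM (v j) = \sum_i tensor (v i) (c i j),
        forall i j, Delta (c i j) = \sum_l tensor (c i l) (c l j)
      & forall i j, eps (c i j) = (i == j)%:R].
Proof.
move=> iv vs.
have ex j : exists c : 'I_n -> H, coac hM (v j) = \sum_i tensor (v i) (c i).
  have [l lE] := slice_rep (coac hM (v j)).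
  have [d dE] := choice (fun p : {linear H -> k^o} * H => vs p.1 j).
  exists (fun i => \sum_(p <- l) d p i *: p.2); rewrite lE.
  under eq_bigr do rewrite dE tensor_suml.
  rewrite exchange_big; apply: eq_bigr => i _; rewrite tensor_sumr.
  by apply: eq_bigr => p _; rewrite tensorZl' tensorZr'.
have [c cE] := choice ex; exists (fun i j => c j i); split=> // [i j|i j].
- pose f (x : kspace M) (g h : H) := tensor x (tensor g h).
  have ft : ktri f.
    by split=> ?; split=> *; rewrite /f ?tensorDl ?tensorDr ?tensorZl'
      ?tensorZr'
      ?tensorDr ?tensorZr'.
  have := coac_coassoc hM (v j) ft.
  rewrite cE tlift_sum; last exact: (kbal_tlift_linl (coac hM) ft).
  rewrite tlift_sum; last exact: (kbal_tlift_linr (comul hH) ft).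
  move=> eqA.
  apply: (indep_tensor (x := fun i => Delta (c j i))
    (y := fun i => \sum_l tensor (c l i) (c j l)) iv).
  transitivity (\sum_i tlift (f (v i)) (Delta (c j i))).
    by apply: eq_bigr => i' _; rewrite -tensor_tliftr tlift_tensorK.
  transitivity (\sum_i' \sum_l tensor (v l) (tensor (c i' l) (c j i'))).
    transitivity (\sum_i' tlift (fun y h1 => f y h1 (c j i')) (coac hM (v i'))).
      transitivity (\sum_i' tlift (fun x h => tlift (f x) (Delta h)) (tensor (v
        i') (c j i'))).
        by apply: eq_bigr => i' _; rewrite tliftT //;
          exact: (kbal_tlift_linr (comul hH) ft).
      rewrite -eqA; apply: eq_bigr => i' _; rewrite tliftT //.
      exact: (kbal_tlift_linl (coac hM) ft).
    apply: eq_bigr => i' _; rewrite cE tlift_sum; last exact: (proj1 ft).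
    by apply: eq_bigr => l _; rewrite tliftT //; exact: (proj1 ft).
  by rewrite exchange_big; apply: eq_bigr => l _; rewrite tensor_sumr.
- have /eqP := coac_counit hM (v j); rewrite cE slice_sum => /eqP eq_v.
  apply/eqP; rewrite -subr_eq0; apply/eqP; move: i.
  apply: (iv (fun i => eps (c j i) - (i == j)%:R)).
  under eq_bigr do rewrite scalerBl; rewrite sumrB.
  rewrite [X in _ - X](bigD1 j) //= eqxx scale1r [X in _ - (_ + X)]big1 => [|i
    /negPf->].
    rewrite addr0; apply/eqP; rewrite subr_eq0; apply/eqP; rewrite -[RHS]eq_v.
    by apply: eq_bigr => i _; rewrite sliceT.
  by rewrite scale0r.
Qed.

End Finite.
End Comatrix.

(** The w are chosen so that their images have the largest possible rank, which is bounded by n;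
    appending x cannot raise it. *)
Lemma finite_spanning_image (k : fieldType) (T : Type) (Q : T -> Prop) n
    (e : T -> 'rV[k]_n) :
  exists r (w : 'I_r -> T), (forall i, Q (w i)) /\
    forall x, Q x -> exists d : 'I_r -> k, e x = \sum_i d i *: e (w i).
Proof.
pose mx r (w : 'I_r -> T) : 'M[k]_(r, n) := \matrix_i e (w i).
pose D d := `[< exists r (w : 'I_r -> T), (forall i, Q (w i)) /\ \rank (mx r w)
  = d >].
have exD : exists d, D d.
  have w : 'I_0 -> T by case.
  by exists (\rank (mx 0 w)); apply/asboolP; exists 0%N, w; split=> // -[].
have bD d : D d -> (d <= n)%N.
  by move=> /asboolP[r [w [_ <-]]]; exact: rank_leq_col.
case: (ex_maxnP exD bD) => d /asboolP[r [w [Qw rw]]] maxd.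
exists r, w; split=> // x Qx.
pose w' (i : 'I_(r + 1)) := match split i with inl j => w j | inr _ => x end.
have Dw' : D (\rank (mx _ w')).
  apply/asboolP; exists (r + 1)%N, w'; split=> // i.
  by rewrite /w'; case: (split i).
have sub : (mx r w <= mx _ w')%MS.
  apply/row_subP => i; rewrite rowK.
  have -> : e (w i) = row (lshift 1 i) (mx _ w').
    by rewrite rowK /w' -[lshift 1 i]/(unsplit (inl i)) unsplitK.
  exact: row_sub.
have [_ eqr] := mxrank_leqif_sup sub.
have rk : \rank (mx r w) == \rank (mx _ w').
  by rewrite eqn_leq mxrankS //= rw; exact: maxd.
have xin : (e x <= mx r w)%MS.
  have : (mx _ w' <= mx r w)%MS by rewrite -eqr.
  apply: submx_trans.
  have -> : e x = row (rshift r ord0) (mx _ w').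
    by rewrite rowK /w' -[rshift r ord0]/(unsplit (inr ord0)) unsplitK.
  exact: row_sub.
have [c ->] := submxP xin; exists (fun i => c 0 i).
by rewrite mulmx_sum_row; apply: eq_bigr => i _; rewrite rowK.
Qed.

(** * Finite presentation of generated subobjects *)

Section FinitePresentation.
Variables (k : fieldType) (H : algType k) (hH : hopfAlgebra H).
Variables (A : algType k) (iota : {lrmorphism A -> H}).
Hypothesis iota_inj : injective iota.
Hypothesis hA : right_coideal hH iota.
Hypothesis hflat : forall M : rmodType A,
  relHopfModule hH iota M -> right_flat M.
Variables (M : rmodType A) (hM : relHopfModule hH iota M).
Local Notation eps := (eps hH).

Section Map.
Variables (n : nat) (v : 'I_n -> kspace M).
Local Notation F := ('rV[A^c]_n : rmodType A).

Definition present_fun (x : F) : M := \sum_i rtimes (v i : M) (free_coord i x).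
Lemma present_linear : linear present_fun.
Proof.
move=> a x y; rewrite /present_fun scaler_sumr -big_split;
  apply: eq_bigr => i _.
rewrite free_coordD rtimesDr; congr (_ + _).
by rewrite [free_coord i (a *: x)]free_coord_act -rtimesA.
Qed.
HB.instance Definition _ :=
  GRing.isLinear.Build _ _ _ _ present_fun present_linear.
Definition present : {linear F -> M} := present_fun.

Lemma present_basis i a : present (free_basis A i a) = rtimes (v i : M) a.
Proof.
rewrite -[LHS]/(present_fun _) /present_fun (bigD1 i) //= big1 ?addr0.
  by rewrite [free_coord _ _]free_coord_basis eqxx.
move=> j /negPf ji; rewrite [free_coord _ _]free_coord_basis ji.
exact: rtimes0r.
Qed.

Variable c : 'I_n -> 'I_n -> H.
Hypothesis coac_v : forall j, coac hM (v j) = \sum_i tensor (v i) (c i j).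
Hypothesis comul_c : forall i j,
  comul hH (c i j) = \sum_l tensor (c i l) (c l j).
Hypothesis eps_c : forall i j, eps (c i j) = (i == j)%:R.
Local Notation hF := (free_obj iota_inj hA comul_c eps_c).

(** Colinearity of the map V (x) A -> M; it makes the kernel a subobject. *)
Lemma coac_present x :
  coac hM (present x) = tmap (klinear present) id (coac hF x).
Proof.
rewrite coac_free /free_coac tmapk tlift_sum; last exact: map_tensor_kbal.
rewrite (linear_sum (coac hM)); apply: eq_bigr => i _.
rewrite (coac_act iota_inj hA) coac_v /diag_act.
have bd := bilinear_balanced (tmap2_outer_bilinear (rtimes_bilinear M)
  (mul_bilinear H) _).
rewrite /tmap2 tlift_sum // tlift_sum; last exact: map_tensor_kbal.
apply: eq_bigr => l _; rewrite tliftT // tlift_tlift;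
  last exact: map_tensor_kbal.
apply: eq_tlift => b h.
rewrite /free_term tliftT; last exact: map_tensor_kbal.
congr tensor; exact/esym/present_basis.
Qed.

Lemma slice_present xi x :
  slice xi (coac hM (present x)) = present (slice xi (coac hF x)).
Proof. by rewrite coac_present slice_tmap. Qed.

Definition present_ker : submodule F.
Proof.
exists (fun x => present x = 0); first exact: linear0.
- by move=> x y xE yE; rewrite linearD xE yE addr0.
- by move=> a x xE; rewrite linearZ /= -[present_fun x]/(present x) xE scaler0.
Defined.

Lemma present_ker_costable : costable hF present_ker.
Proof.
move=> x x0 xi; change (present (slice xi (coac hF x)) = 0).
by rewrite -slice_present (x0 : present x = 0) linear0 slice0.
Qed.
End Map.

(* [E] is idempotent, with kernel the module of relations between the [v]: they
   generate a submodule isomorphic to the projective module E A^n. *)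
Lemma finite_generation (m : M) :
  exists n (v : 'I_n -> M) (E : 'M[A]_n),
    [/\ span_sub v m, costable hM (span_sub v), forall j, v j = comb v E j &
      forall p (C : 'M[A]_(n, p)), (forall j, comb v C j = 0) -> E *m C = 0].
Proof.
have [n0 [v0 [v0m v0s _]]] := finite_subcomodule1 hM m.
have [n [v [iv v0v vv0]]] := exists_basis v0.
have vs xi i : span_sub v (slice xi (coac hM (v i))).
  apply: v0v; have [d ->] := vv0 _ (span_gen v i).
  rewrite (linear_sum (coac hM)) slice_sum; apply: sub_sum => j _.
  by rewrite linearZ sliceZ; exact: subZ.
have [c [cv cc ec]] := comatrix iv vs.
pose hF := free_obj iota_inj hA cc ec.
pose K := present_ker v.
have cK : costable hF K := present_ker_costable cv cc ec.
have cZ : costable hM (span_sub (v : 'I_n -> M)).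
  by apply: (span_costable iota_inj hA) => xi i; exact: kspan_span.
(* The row of counits of the coordinates of x is its class in F / F A+ = k^n. Finitely many w in K
   span the image of K there; they are then enlarged to a finite dimensional subcomodule of K. *)
have [r [w [Kw wspan]]] := finite_spanning_image (K : _ -> Prop)
  (fun x => \row_i eps (iota (free_coord i x)) : 'rV[k]_n).
have [q [u [uw us uK]]] := finite_subcomodule hF w.
have Ku i : K (u i) by exact: uK.
pose W := span_sub (u : 'I_q -> 'rV[A^c]_n).
have cW : costable hF W.
  by apply: (span_costable iota_inj hA) => xi i; exact: kspan_span.
have flatQ : right_flat (quot W) := hflat (quot_obj iota_inj hA cW).
have KW : sub_le K W.
  (* A combination y of the w with the same image as x leaves a difference whose coordinates all lie
     in A+. *)
  apply: (nakayama iota_inj hA cW flatQ cK) => x /wspan[d dE].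
  pose y : kspace 'rV[A^c]_n := \sum_i d i *: (w i : kspace _).
  exists y, ((x : kspace _) - y); split; last by rewrite addrC subrK.
    by apply: sub_sum => i _; apply: (subZ (_ : A^c)); exact/kspan_span/uw.
  set z := (x : kspace _) - y; rewrite (free_expand z).
  apply: sub_sum => i _; apply: aug_sub_in.
  have := congr1 (fun z : 'rV[k]_n => z 0 i) dE; rewrite mxE summxE => eE.
  pose phi : {linear kspace 'rV[A^c]_n -> k^o} :=
    counit hH \o ((iota : {linear A -> H}) \o free_coord i).
  rewrite -[LHS]/(phi z) linearB -[phi x]/(eps (iota (free_coord i x))) eE.
  rewrite linear_sum; apply/eqP; rewrite subr_eq0; apply/eqP.
  by apply: eq_bigr => l _; rewrite linearZ !mxE.
(* The columns of B generate all relations among the v, so any C with v C = 0 is a multiple of B,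
   and E B = 0 is all that is required of E. *)
pose B : 'M[A]_(n, q) := \matrix_(i, l) free_coord i (u l).
have vB j : comb v B j = 0.
  by rewrite -[RHS](Ku j); apply: eq_bigr => i _; rewrite mxE.
have [E [vE EB]] := flat_finite_section (hflat hM) (hflat (quot_obj iota_inj hA
  cZ)) vB.
exists n, v, E; split=> // [|p C vC].
  by apply: kspan_span; exact: v0v.
have ex j : exists b : 'I_q -> A, forall i, C i j = \sum_l B i l * b l.
  have [b bE] : W (\row_i (C i j : A^c)).
    apply: KW; change (present v (\row_i (C i j : A^c)) = 0).
    rewrite -[RHS](vC j); apply: eq_bigr => i _.
    by rewrite /free_coord mxE.
  exists b => i; have := congr1 (free_coord i) bE.
  rewrite {1}/free_coord mxE => ->.
  rewrite (linear_sum (free_coord i)); apply: eq_bigr => l _.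
  by rewrite [LHS]free_coord_act mxE.
have [b bE] := choice ex.
have -> : C = B *m (\matrix_(l, j) b j l).
  by apply/matrixP => i j; rewrite bE mxE; apply: eq_bigr => l _; rewrite !mxE.
by rewrite mulmxA EB mul0mx.
Qed.

End FinitePresentation.

(** * Projectivity and generators *)

Section Projective.
Variables (k : fieldType) (H : algType k) (hH : hopfAlgebra H).
Variables (A : algType k) (iota : {lrmorphism A -> H}).
Hypothesis iota_inj : injective iota.
Hypothesis hA : right_coideal hH iota.
Hypothesis hflat : forall M : rmodType A,
  relHopfModule hH iota M -> right_flat M.
Local Notation eps := (eps hH).
Local Notation hobj := (relHopfModule hH iota).

Section Lift.
Variables (M : rmodType A) (hM : hobj M) (X Y : rmodType A).
Variables (g : {linear X -> Y}) (f : {linear M -> Y}).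
Hypothesis g_surj : forall y, exists x, g x = y.

(* [G] is the graph of a lift of [f], defined on a subobject of M. *)
Definition partial_lift (G : submodule (M * X)%type) : Prop :=
  [/\ forall m x, G (m, x) -> g x = f m,
      forall x, G (0, x) -> x = 0
    & forall m x xi, G (m, x) -> exists x', G (slice xi (coac hM m), x')].

Definition lift_dom (G : submodule (M * X)%type) : submodule M.
Proof.
exists (fun m => exists x, G (m, x)).
- by exists 0; exact: sub0.
- by move=> m m' [x Gx] [x' Gx']; exists (x + x'); exact: (subD Gx Gx').
- by move=> a m [x Gx]; exists (a *: x); exact: (subZ a Gx).
Defined.

Lemma lift_dom_costable G : partial_lift G -> costable hM (lift_dom G).
Proof. by case=> _ _ G3 m [x Gx] xi; exact: G3 Gx. Qed.

(** With P the domain of G, the class of m lies in a finitely generated subobject of M/P, with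
    generators v and matrix E. Arbitrary preimages y of v, and x of the f(y), are multiplied by E: a
    relation v C = 0 forces E C = 0, so y E and x E satisfy every relation among the v. Adding the
    pairs from y E and x E to G therefore yields a graph again. *)
Lemma partial_lift_extend (G : submodule (M * X)%type) (m : M) :
  partial_lift G ->
  exists2 G', partial_lift G' & sub_le G G' /\ lift_dom G' m.
Proof.
move=> GP; have cP := lift_dom_costable GP; have [G1 G2 G3] := GP.
pose P := lift_dom G; pose hQ := quot_obj iota_inj hA cP.
have [n [v [E [vm cZ vE EC]]]] := finite_generation iota_inj hA hflat hQ (qproj
  P m).
pose y i := qrepr (v i).
have yv i : qproj P (y i) = v i by exact: qreprK.
have [x xE] := choice (fun i => g_surj (f (y i))).
pose y' := comb y E; pose x' := comb x E.
have y'v j : qproj P (y' j) = v j.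
  by rewrite /y' qproj_comb (eq_comb _ _ yv) -vE.
have xy' j : g (x' j) = f (y' j).
  rewrite /x' /y' /comb !linear_sum; apply: eq_bigr => i _.
  by rewrite !rtimes_linear xE.
pose G' := sub_add G (span_sub (fun j => (y' j, x' j) : (M * X)%type)).
have sumE (a : 'I_n -> A^c) : \sum_i a i *: ((y' i, x' i) : (M * X)%type) =
    (\sum_i a i *: y' i, \sum_i a i *: x' i).
  elim/big_rec3: _ => [//|i s1 s2 s3 _ ->]; by [].
have piE (a : 'I_n -> A^c) : qproj P (\sum_i a i *: y' i) = \sum_i a i *: v i.
  by rewrite linear_sum; apply: eq_bigr => i _; rewrite linearZ /= -y'v.
have domG' m' : span_sub v (qproj P m') -> lift_dom G' m'.
  move=> [a aE]; have : P (m' - \sum_i a i *: y' i).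
    by apply/qproj_eq0; rewrite linearB piE aE subrr.
  move=> [x0 Gx0]; exists (x0 + \sum_i a i *: x' i).
  exists (m' - \sum_i a i *: y' i, x0), (\sum_i a i *: y' i, \sum_i a i *: x'
    i).
  split=> //; first by exists a; rewrite sumE.
  by rewrite -[RHS]/(_ - _ + _, _) subrK.
exists G'; last first.
  split; last exact: domG'.
  by move=> z Gz; exists z, 0; rewrite addr0; split=> //; exact: sub0.
split=> [m' z|z|m' z xi].
- move=> [[m1 z1] [_ [Gz [a ->] e]]]; rewrite sumE in e.
  case: e => -> ->; rewrite !linearD (G1 _ _ Gz) !linear_sum; congr (_ + _).
  by apply: eq_bigr => i _; rewrite !linearZ /= xy'.
- move=> [[m1 z1] [_ [Gz [a ->] e]]]; rewrite sumE in e.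
  case: e => m0 ->.
  (* The sum of the y'_i a_i is - m1, which lies in P, so the a_i form a relation among the v; E
     annihilates it, and both sums vanish. *)
  pose C : 'M[A]_(n, 1) := \matrix_(i, _) (a i : A).
  have aC (V : rmodType A) (w : 'I_n -> V) : \sum_i a i *: w i = comb w C ord0.
    by apply: eq_bigr => i _; rewrite mxE.
  have vC j : comb v C j = 0.
    rewrite ord1 -aC -piE; apply/qproj_eq0; exists (- z1).
    have -> : \sum_i a i *: y' i = - m1.
      by apply/eqP; rewrite -addr_eq0 addrC; apply/eqP/esym.
    exact: (subN Gz).
  have := EC _ _ vC => EC0.
  have y0 : \sum_i a i *: y' i = 0 by rewrite aC combA EC0 comb0.
  have x0 : \sum_i a i *: x' i = 0 by rewrite aC combA EC0 comb0.
  rewrite y0 addr0 in m0; rewrite x0 addr0; apply: G2.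
  by rewrite m0.
- move=> [[m1 z1] [_ [Gz [a ->] e]]]; rewrite sumE in e.
  case: e => -> _; apply: domG'.
  set m2 := m1 + _.
  have vm2 : span_sub v (qproj P m2).
    exists a; rewrite /m2 linearD piE (proj2 (qproj_eq0 P m1)) ?add0r //.
    by exists z1.
  have := cZ _ vm2 xi.
  by rewrite [coac _ _](coac_quotE iota_inj hA cP) slice_tmap.
Qed.

Lemma exists_lift : exists h : {linear M -> X}, forall m, g (h m) = f m.
Proof.
have [||G GP maxG] := @zorn_submodule _ _ partial_lift sub_zero.
- split=> [m x e|x e|m x xi e].
  + by rewrite (congr1 fst e : m = 0) (congr1 snd e : x = 0) !linear0.
  + exact: (congr1 snd e).
  + by exists 0; rewrite (congr1 fst e : m = 0) linear0 slice0.
- move=> C U [S0 CS0] CQ _ CU; split=> [m x|x|m x xi] /CU[S CS Sx];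
    have [S1 S2 S3] := CQ _ CS.
  + exact: S1.
  + exact: S2.
  + by have [x' Sx'] := S3 _ _ xi Sx; exists x'; apply/CU; exists S.
have dom m : exists x, G (m, x).
  have [G' GP' [GG' [x Gx]]] := partial_lift_extend m GP.
  by exists x; exact: (maxG _ GP' GG').
have [h hG] := choice dom; have [G1 G2 _] := GP.
have hlin : linear h.
  move=> a x y; apply/eqP; rewrite -subr_eq0; apply/eqP/G2.
  have := subB (hG (a *: x + y)) (subD (subZ a (hG x)) (hG y)).
  by rewrite -[X in G X]/((a *: x + y) - (a *: x + y), _) subrr.
pose I := GRing.isLinear.Build _ _ _ _ h hlin.
pose h' : {linear M -> X} := HB.pack h I.
by exists h' => m; exact: G1 (hG m).
Qed.
End Lift.

Lemma object_projective (M : rmodType A) : hobj M -> projective_module M.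
Proof. by move=> hM X Y g f g_surj; exact: exists_lift. Qed.

Local Notation RA := ('rV[A^c]_1 : rmodType A).

Lemma comul_unit (i j : 'I_1) : comul hH 1 = \sum_(l < 1) tensor 1 1.
Proof. by rewrite comul1 big_ord1. Qed.
Lemma eps_unit (i j : 'I_1) : eps 1 = (i == j)%:R.
Proof. by rewrite eps1 !ord1. Qed.

(** The module A itself, as the free object on the trivial one dimensional comodule; rows of length
    1 stand for elements of A. *)
Definition regular_obj : hobj RA :=
  @free_obj _ _ hH _ _ iota_inj hA 1 (fun _ _ => 1) comul_unit eps_unit.

(** Let Z be the subobject generated by v, which contains m. As M/Z is projective, M projects onto
    Z, and v b |-> E b embeds Z into A^n; some coordinate of the image of m is nonzero. *)
Lemma nonzero_form (M : rmodType A) (m : M) : hobj M -> m <> 0 ->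
  exists (f : {linear M -> RA}) x, f x <> 0.
Proof.
move=> hM m0.
have [n [v [E [vm cZ vE EC]]]] := finite_generation iota_inj hA hflat hM m.
pose Z := span_sub v.
have [s sP] := object_projective (quot_obj iota_inj hA cZ) (idfun : {linear
  quot Z -> quot Z})
  (@qproj_surj _ _ Z).
have rZ x : Z (x - s (qproj Z x)).
  by apply/qproj_eq0; rewrite linearB sP subrr.
have [a aE] := choice rZ.
pose col_ (b : 'I_n -> A) : 'M[A]_(n, 1) := \matrix_(i, _) b i.
have colE (b : 'I_n -> A) j : comb v (col_ b) j = \sum_i (b i : A^c) *: v i.
  by apply: eq_bigr => i _; rewrite mxE.
have Einj (b b' : 'I_n -> A) :
    \sum_i (b i : A^c) *: v i = \sum_i (b' i : A^c) *: v i ->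
    E *m col_ b = E *m col_ b'.
  move=> bb'; apply/eqP; rewrite -subr_eq0 -mulmxBr; apply/eqP/EC => j.
  have -> : col_ b - col_ b' = col_ (fun i => b i - b' i).
    by apply/matrixP => i l; rewrite !mxE.
  rewrite colE; apply/eqP; rewrite -[X in _ == X](subrr (\sum_i (b i : A^c) *:
    v i)).
  rewrite {2}bb' -sumrB; apply/eqP; apply: eq_bigr => i _.
  exact: scalerBl.
(* The projection of x onto Z is v (a x), and E (a x) does not depend on the choice of [a x], by
   [Einj]; linearity follows from this. *)
pose phi j x : RA := \row__ ((E *m col_ (a x)) j ord0 : A^c).
have phi_lin j : linear (phi j).
  move=> c x y.
  pose b i : A := (a x i : A) * (c : A) + (a y i : A).
  have eqb : E *m col_ (a (c *: x + y)) = E *m col_ b.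
    apply: Einj; rewrite -aE linearP linearP opprD addrACA -scalerBr !aE.
    rewrite scaler_sumr -big_split; apply: eq_bigr => i _.
    by rewrite /= scalerA -scalerDl.
  rewrite /phi eqb; apply/rowP => l; rewrite !mxE.
  rewrite -[(c * _ : A^c)]/(_ * (c : A)) mulr_suml -[RHS]big_split.
  by apply: eq_bigr => i _; rewrite !mxE mulrDr mulrA.
apply: contrapT => nf; apply: m0.
have mE : m = \sum_i a m i *: v i.
  by rewrite -aE (proj2 (qproj_eq0 Z m) vm) linear0 subr0.
have Ea0 : E *m col_ (a m) = 0.
  apply/matrixP => j l; rewrite [RHS]mxE ord1.
  pose I := GRing.isLinear.Build _ _ _ _ (phi j) (phi_lin j).
  pose f : {linear M -> RA} := HB.pack (phi j) I.
  have : f m = 0 by apply: contrapT => fm; apply: nf; exists f, m.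
  by move=> /rowP/(_ ord0); rewrite [LHS]mxE [RHS]mxE.
by rewrite mE -(colE _ ord0) (eq_comb _ _ vE) combA Ea0 comb0.
Qed.

End Projective.

(** * The trace ideal, generators and faithful flatness *)

Section Trace.
Variables (k : fieldType) (H : algType k) (hH : hopfAlgebra H).
Variables (A : algType k) (iota : {lrmorphism A -> H}).
Hypothesis iota_inj : injective iota.
Hypothesis hA : right_coideal hH iota.
Local Notation eps := (eps hH).
Local Notation Delta := (comul hH).
Local Notation S := (antipode hH).
Local Notation delta := (delta iota_inj hA).
Local Notation hobj := (relHopfModule hH iota).
Local Notation RA := ('rV[A^c]_1 : rmodType A).
Local Notation hRA := (regular_obj iota_inj hA).

Variables (M : rmodType A) (hM : hobj M).

Definition trace : submodule RA.
Proof.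
exists (fun x => exists s : seq ({linear M -> RA} * M), x = \sum_(p <- s) p.1
  p.2).
- by exists [::]; rewrite big_nil.
- by move=> _ _ [s ->] [t ->]; exists (s ++ t); rewrite big_cat.
- move=> a _ [s ->]; exists [seq (p.1, a *: p.2) | p <- s].
  by rewrite big_map scaler_sumr; apply: eq_bigr => p _; rewrite linearZ.
Defined.

Lemma trace_in (f : {linear M -> RA}) m : trace (f m).
Proof. by exists [:: (f, m)]; rewrite big_seq1. Qed.

Section Twist.
Variable f : {linear M -> RA}.

(* [twist h m] is the sum of the f(m_(0))_(0) (x) f(m_(0))_(1) S(m_(1)) h; it
   is A-linear in m, for the action on the left factor, so that its slices are
   again forms on M. *)
Definition twist0 (m : kspace M) (g h : H) : tens (kspace RA) H :=
  tlift (fun x y => tensor x (y * (S g * h))) (coac hRA (klinear f m)).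

Lemma twist_bal u v : kbal (fun (x : kspace RA) (y : H) => tensor x (y * (S u *
  v))).
Proof.
split=> *; first exact: tensorDl.
  by rewrite mulrDl tensorDr.
by rewrite algZl tensorZl' tensorZr'.
Qed.

Lemma twist0_tri : ktri twist0.
Proof.
split=> [h|m]; rewrite /twist0.
- split=> [m m' g|m g g'|c m g].
  + by rewrite !linearD tliftDr //; exact: twist_bal.
  + by rewrite -tliftDf; apply: eq_tlift => x y;
    rewrite antiD mulrDl mulrDr tensorDr.
  + rewrite !linearZ tliftZ; last exact: twist_bal.
    by apply: eq_tlift => x y;
      rewrite /= ?antiZ !(algZl, algZr) tensorZl' tensorZr'.
- apply: kbal_tlift => x y; split=> *.
  + by rewrite antiD mulrDl mulrDr tensorDr.
  + by rewrite !mulrDr tensorDr.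
  + by rewrite antiZ !(algZl, algZr).
Qed.

Definition twist (h : H) (m : kspace M) : tens (kspace RA) H :=
  tlift (fun y g => twist0 y g h) (coac hM m).

Lemma twist_add h m m' : twist h (m + m') = twist h m + twist h m'.
Proof. by rewrite /twist linearD tliftDr //; exact: (proj1 twist0_tri). Qed.

(** Replacing m by m a inserts a_(1) on the left and a_(2) S(a_(3)) on the right; the latter
    cancels, and a remains on the left. *)
Lemma twist_act h (m : M) a :
  twist h (rtimes m a) =
  tlift (fun x y => tensor (rt x a) y) (twist h m).
Proof.
have br : kbal (fun (x : kspace RA) (y : H) => tensor (rt x a) y).
  split=> *; rewrite /rt; first by rewrite rtimesDl tensorDl.
    exact: tensorDr.
  by rewrite rtimesZl tensorZl' tensorZr'.
rewrite /twist (tlift_coac_act iota_inj hA); last exact: (proj1 twist0_tri).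
rewrite tlift_tlift //; apply: eq_tlift => m0 m1.
rewrite /twist0 tlift_tlift //.
transitivity (tlift (fun x y => tlift (fun b g => tlift (fun b' g' =>
    tensor (rt x b') (y * g' * (S (m1 * g) * h))) (delta b)) (delta a))
    (coac hRA (klinear f m0))).
  rewrite tlift_exchange; apply: eq_tlift => b g.
  have -> : klinear f (rt m0 b) = rtimes (klinear f m0 : RA) b.
    exact: rtimes_linear.
  by rewrite (tlift_coac_act iota_inj hA) //; exact: twist_bal.
apply: eq_tlift => x y; rewrite tliftT //.
pose phi b (g1 g2 : H) := tensor (rt x b) (y * g1 * (S (m1 * g2) * h)).
rewrite (delta_coassoc iota_inj hA (f := phi)); last first.
  split=> [g|b]; split=> *; rewrite /phi /rt.
  - by rewrite rtimesDr tensorDl.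
  - by rewrite mulrDr mulrDl tensorDr.
  - by rewrite rtimesZr !(algZl, algZr) tensorZl' tensorZr'.
  - by rewrite mulrDr mulrDl tensorDr.
  - by rewrite mulrDr antiD mulrDl mulrDr tensorDr.
  - by rewrite !(algZl, algZr, antiZ).
rewrite -(delta_counitr iota_inj hA
  (g := fun a => tensor (rt x a) (y * (S m1 * h)))); last first.
  by move=> u v; rewrite /rt rtimesDr tensorDl.
apply: eq_tlift => b g.
transitivity (tlift (fun g1 g2 => tensor (rt x b) (y * ((g1 * S g2) * (S m1 *
  h))))
   (Delta g)).
  by apply: eq_tlift => g1 g2; rewrite /phi antipodeM !mulrA.
rewrite (comul_antipoder hH (g := fun z => tensor (rt x b) (y * (z * (S m1 *
  h))))).
  by rewrite /rt rtimesZr !(algZl, algZr) mul1r tensorZl' tensorZr'.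
by move=> u v; rewrite mulrDl mulrDr tensorDr.
Qed.

Lemma slice_twist_linear xi h : linear (fun m : M => slice xi (twist h m) : RA).
Proof.
move=> a x y; rewrite [twist h _]twist_add -[a *: x]/(rtimes x a) twist_act.
rewrite (_ : slice xi (_ + _) = slice xi (tlift (fun u v => tensor (rt u a) v)
  (twist h x)) + slice xi (twist h y)); last exact: (linearD (slice xi)).
congr (_ + _); rewrite slice_tlift [slice xi (twist h x)]/slice [in RHS]/tlift.
rewrite scaler_sumr; apply: eq_bigr => p _; rewrite sliceT.
exact/esym/rtimesZl.
Qed.

Lemma trace_twist xi h m : trace (slice xi (twist h m)).
Proof.
pose I := GRing.isLinear.Build _ _ _ _ _ (slice_twist_linear xi h).
pose g : {linear M -> RA} := HB.pack (fun m : M => slice xi (twist h m) : RA) I.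
exact: (trace_in g m).
Qed.

(** Here S(m_(1)) m_(2) cancels. The slices of the coaction of f(m) thus become sums of slices of
    twists, which are values of forms on M: this makes the trace a subobject. *)
Lemma coac_form m :
  coac hRA (klinear f m) = tlift (fun m h => twist h m) (coac hM m).
Proof.
rewrite (coac_coassoc _ _ twist0_tri).
rewrite -(coac_counitr hM (g := fun m => coac hRA (klinear f m))); last first.
  by move=> u v; rewrite !linearD.
apply: eq_tlift => x h.
rewrite /twist0 tlift_exchange.
have -> : coac hRA (klinear f (eps h *: x)) = eps h *: coac hRA (klinear f x).
  by rewrite !linearZ.
set t := coac hRA (klinear f x); rewrite -[t in LHS]tlift_tensorK.
rewrite [X in _ *: X]/tlift scaler_sumr; apply: eq_bigr => p _.
rewrite (comul_antipodel hH (g := fun z => tensor p.1 (p.2 * z))).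
  by rewrite algZr mulr1 tensorZr'.
by move=> u v; rewrite mulrDr tensorDr.
Qed.

End Twist.

Lemma trace_costable : costable hRA trace.
Proof.
move=> _ [s ->] xi; rewrite (linear_sum (coac hRA)) slice_sum.
apply: sub_sum => p _; rewrite -[p.1 p.2]/(klinear p.1 p.2) coac_form
  slice_tlift.
by apply: sub_sum => q _; exact: trace_twist.
Qed.

Hypothesis hflat : forall M : rmodType A,
  relHopfModule hH iota M -> right_flat M.

Lemma trace_full : (exists m : M, m <> 0) -> forall x, trace x.
Proof.
move=> [m m0].
have flat0 : right_flat (quot (sub_zero : submodule RA)).
  apply: hflat; apply: (@quot_obj _ _ _ _ _ iota_inj hA RA hRA) => x -> xi.
  by rewrite linear0 slice0.
have c0 : costable hRA sub_zero by move=> x -> xi; rewrite linear0 slice0.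
(* If the trace lay in A+, Nakayama over the zero subobject would annihilate it, against
   [nonzero_form]. *)
have [t [Tt t1]] : exists t, trace t /\ eps (iota (free_coord ord0 t)) <> 0.
  apply: contrapT => nt.
  have [f [x]] := nonzero_form iota_inj hA hflat hM m0; apply.
  apply: (nakayama iota_inj hA c0 flat0 trace_costable _ (trace_in f x)) => y
    Ty.
  exists 0, y; rewrite add0r; split=> //.
  rewrite (free_expand y) big_ord1; apply: aug_sub_in.
  by apply: contrapT => y0; apply: nt; exists y.
set e := eps _ in t1; have e0 : e != 0 by apply/eqP.
move=> x0; pose K : submodule RA := @Submodule _ RA (fun=> True) I
  (fun _ _ _ _ => I) (fun _ _ _ => I).
have flatT := hflat (quot_obj iota_inj hA trace_costable).
apply: (nakayama iota_inj hA trace_costable flatT (K := K)) => // x _.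
(* The factor e^-1 gives y the same counit as x, so x and y agree modulo A+. *)
pose y := rtimes t (e^-1 *: free_coord ord0 x).
exists y, (x - y); split; [exact: (subZ (_ : A^c))| |by rewrite addrC subrK].
rewrite (free_expand (x - y)) big_ord1; apply: aug_sub_in.
have -> : free_coord ord0 (x - y) =
    free_coord ord0 x - free_coord ord0 t * (e^-1 *: free_coord ord0 x).
  rewrite -free_coord_act; exact: (linearB (free_coord ord0 : {linear kspace RA
    -> A})).
pose c : {linear A -> k^o} := counit hH \o (iota : {linear A -> H}).
rewrite -[LHS]/(c _) linearB -[X in X - _]/(eps (iota (free_coord ord0 x))).
rewrite -[X in _ - X]/(eps (iota _)) rmorphM epsM.
have eZ : eps (iota (e^-1 *: free_coord ord0 x)) = e^-1 * eps (iota (free_coord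
  ord0 x)).
  by rewrite iotaZ epsZ.
rewrite [X in _ * X]eZ mulrA.
by rewrite -/e mulfV // mul1r subrr.
Qed.

Lemma object_generator : (exists m : M, m <> 0) -> exists s : seq ({linear M ->
  RA} * M),
  \sum_(p <- s) free_coord ord0 (p.1 p.2) = 1.
Proof.
move=> /trace_full/(_ (free_basis A ord0 1))[s sE]; exists s.
have := congr1 (free_coord ord0) sE; rewrite free_coord_basis eqxx => ->.
exact/esym/(linear_sum (free_coord ord0 : {linear kspace RA -> A})).
Qed.

Lemma form_hom (X : rmodType A) (x : X) (f : {linear M -> RA}) :
  exists h : {linear M -> X}, forall m, h m = rtimes x (free_coord ord0 (f m)).
Proof.
have lin : linear (fun m => rtimes x (free_coord ord0 (f m))).
  move=> a m m'; rewrite linearP free_coordD rtimesDr; congr (_ + _).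
  by rewrite [free_coord _ (a *: _)]free_coord_act -rtimesA.
pose L := GRing.isLinear.Build _ _ _ _ _ lin.
by exists (HB.pack (fun m => rtimes x (free_coord ord0 (f m))) L : {linear M ->
  X}).
Qed.

Lemma object_module_generator : (exists m : M, m <> 0) -> module_generator M.
Proof.
move=> /object_generator[s s1] X Y f g fg x.
rewrite -[x]rtimes1 -s1 rtimes_sumr !linear_sum; apply: eq_bigr => p _.
by have [h <-] := form_hom x p.1; exact: fg.
Qed.

(** With 1 the sum of the f_p(m_p), an element n is recovered from the m_p (x) n by applying the
    forms. So N is naturally a retract of a finite sum of copies of M (x)_A N, and exactness
    descends. *)
Lemma object_faithfully_flat : (exists m : M, m <> 0) -> right_faithfully_flat
  M.
Proof.
move=> /object_generator[s s1] X Y Z u v; split; first exact: hflat.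
pose ev (N : lmodType A) (f : {linear M -> RA}) (m : M) (n : N) : N :=
  free_coord ord0 (f m) *: n.
have ev_bal N f : balA (ev N f).
  split=> *; rewrite /ev.
  - by rewrite linearD free_coordD scalerDl.
  - exact: scalerDr.
  - by rewrite rtimes_linear free_coord_act scalerA.
have ev_nat (N N' : lmodType A) (w : {linear N -> N'}) f t :
    tlift (ev N' f) (tmapA idfun w t) = w (tlift (ev N f) t).
  rewrite tmapAE (tliftA_sum _ _ _ (ev_bal _ f)) [tlift _ t]/tlift linear_sum.
  by apply: eq_bigr => p _; rewrite tliftA_pure // /ev linearZ.
have recover (N : lmodType A) (n : N) :
    n = \sum_(p <- s) tlift (ev N p.1) (pureA p.2 n).
  rewrite -{1}[n]scale1r -s1 scaler_suml; apply: eq_bigr => p _.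
  by rewrite tliftA_pure.
move=> ex y; split=> [vy|[x <-]].
- have inu p : exists x, u x = tlift (ev Y p.1) (pureA p.2 y).
    have [|t tE] := proj1 (ex (pureA p.2 y)).
      by rewrite tmapA_pure vy pureA0r.
    by exists (tlift (ev X p.1) t); rewrite -ev_nat tE.
  have [x xE] := choice inu.
  exists (\sum_(p <- s) x p); rewrite linear_sum [RHS]recover.
  by apply: eq_bigr => p _; exact: xE.
- rewrite [LHS]recover big1 // => p _.
  have : tmapA idfun v (tmapA idfun u (pureA p.2 x)) = 0 by apply/ex;
    exists (pureA p.2 x).
  by rewrite !tmapA_pure => ->; rewrite tliftA0.
Qed.

End Trace.

Definition sub_image (R : pzRingType) (U V : lmodType R) (f : {linear U -> V}) :
  submodule V.
Proof.
exists (fun y => exists x, f x = y).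
- by exists 0; rewrite linear0.
- by move=> _ _ [x <-] [y <-]; exists (x + y); rewrite linearD.
- by move=> a _ [x <-]; exists (a *: x); rewrite linearZ.
Defined.

(** * Left faithful flatness *)

Section LeftFlat.
Variables (k : fieldType) (H : algType k) (hH : hopfAlgebra H).
Variables (A : algType k) (iota : {lrmorphism A -> H}).
Hypothesis iota_inj : injective iota.
Hypothesis hA : right_coideal hH iota.
Hypothesis hflat : forall M : rmodType A,
  relHopfModule hH iota M -> right_flat M.
Local Notation eps := (eps hH).
Local Notation Delta := (comul hH).
Local Notation S := (antipode hH).
Variable T : H -> H.
Hypotheses (ST : cancel S T) (TS : cancel T S).
Local Notation delta := (delta iota_inj hA).
Local Notation NH N := (tensH N iota_inj hA).
Local Notation hNH N := (tensH_obj iota_inj hA N).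
Local Notation diag_act := (diag_act iota_inj hA).
Local Notation inH := (inH iota_inj hA).
Local Notation aug N := (aug_sub hH iota (NH N)).
Local Notation LH := (lregmod iota).

Section OneModule.
Variable N : rmodType A.

Definition psi0 (n : kspace N) (h : H) : tensA N LH := pureA n (S h : LH).

Lemma psi0_kbal : kbal psi0.
Proof.
split=> [n n' h|n h h'|c n h]; rewrite /psi0; first exact: pureADl.
  by rewrite antiD -pureADr.
rewrite [c *: n]kspaceE pureA_bal antiZ; congr pureA.
by rewrite -[LHS]/(iota c%:A * S h) linearZ /= rmorph1 -scalerAl mul1r.
Qed.

Definition psi (t : tens (kspace N) H) : tensA N LH := tlift psi0 t.

Lemma psiD t u : psi (t + u) = psi t + psi u.
Proof. exact/tliftDr/psi0_kbal. Qed.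

(** As in [theta_act], a_(1) and S(a_(2)) meet across the tensor sign over A. *)
Lemma psi_act t a :
  psi (diag_act t a) = tlift (fun n h => pureA n ((eps (iota a))%:A * S h :
    LH)) t.
Proof.
have bp := psi0_kbal.
rewrite /psi tlift_tmap2 //; apply: eq_tlift => n h.
rewrite -(delta_antipoder iota_inj hA (g := fun z => pureA n (z * S h : LH))).
  apply: eq_tlift => b g; rewrite /psi0 /rt pureA_bal antipodeM; congr pureA.
  exact: mulrA.
by move=> x y; rewrite mulrDl -pureADr.
Qed.

Lemma psi_aug t : aug N (inH N t) -> psi t = 0.
Proof.
have bp := psi0_kbal => -[n [v [a [a0 tE]]]].
have -> : t = \sum_i diag_act (v i : tens (kspace N) H) (a i) by exact: tE.
rewrite /psi tlift_sum // big1 // => i _.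
rewrite -/(psi _) psi_act a0 /tlift big1 // => p _.
by rewrite scale0r mul0r pureA0r.
Qed.

Lemma psi_surj w : exists t, psi t = w.
Proof.
have bp := psi0_kbal.
exists (\sum_(p <- trepr w) tensor (p.1 : kspace N) (T p.2)).
rewrite /psi tlift_sum // [RHS]pureA_expand; apply: eq_bigr => p _.
by rewrite tliftT // /psi0 TS.
Qed.

(* Makes n (x) h |-> n (x) S^-1(h) well defined on N (x)_A H, modulo
   (N (x) H) A+. *)
Lemma aug_bal (n : kspace N) g a :
  aug N (inH N (tensor (rt n a) g) - inH N (tensor n (g * T (iota a)))).
Proof.
(* Since T(a_(3)) a_(2) contracts to the counit, n a (x) g is the sum of the diagonal actions of
   a_(1) on n (x) g T(a_(2)). *)
have -> : tensor (rt n a) g = tlift (fun b f => tlift (fun b' f' =>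
    tensor (rt n b') (g * T f * f')) (delta b)) (delta a).
  rewrite (delta_coassoc iota_inj hA (f := fun b f1 f2 => tensor (rt n b) (g *
    T f2 * f1))).
    rewrite -(delta_counitr iota_inj hA (g := fun a => tensor (rt n a) g)).
      apply: eq_tlift => b f.
      transitivity (tlift (fun f1 f2 => tensor (rt n b) (g * (T f2 * f1)))
        (Delta f)).
        rewrite (comul_invantipode ST TS (g := fun z => tensor (rt n b) (g *
          z))).
          by rewrite algZr mulr1 /rt rtimesZr tensorZl' tensorZr'.
        by move=> x y; rewrite mulrDr tensorDr.
      by apply: eq_tlift => f1 f2; rewrite mulrA.
    by move=> x y; rewrite /rt rtimesDr tensorDl.
  split=> [f|b]; split=> *; rewrite /rt.
  - by rewrite rtimesDr tensorDl.
  - by rewrite mulrDr tensorDr.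
  - by rewrite rtimesZr algZr tensorZl' tensorZr'.
  - by rewrite mulrDr tensorDr.
  - by rewrite (invantiD ST TS) mulrDr mulrDl tensorDr.
  - by rewrite (invantiZ ST TS) !(algZl, algZr).
(* The same sum with the counit of a_(1) in place of its action. Termwise the difference is the
   action of a_(1) - eps(a_(1)) 1, an element of A+. *)
have -> : tensor n (g * T (iota a)) =
    tlift (fun b f => eps (iota b) *: tensor n (g * T f)) (delta a).
  rewrite -(delta_counitl iota_inj hA (g := fun z => tensor n (g * T z))).
    by apply: eq_tlift => b f; rewrite (invantiZ ST TS) algZr tensorZr'.
  by move=> x y; rewrite (invantiD ST TS) mulrDr tensorDr.
rewrite -linearB /tlift -sumrB linear_sum; apply: sub_sum => p _.
set t := tensor n (g * T p.2).
have -> : \sum_(q <- trepr (delta p.1)) tensor (rt n q.1) (g * T p.2 * q.2) =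
    diag_act t p.1.
  rewrite /diag_act /tmap2 tliftT //.
  apply/bilinear_balanced/tmap2_outer_bilinear; last exact: mul_bilinear.
  exact: rtimes_bilinear.
have -> : inH N (diag_act t p.1 - eps (iota p.1) *: t) =
    rtimes (inH N t : NH N) (p.1 - (eps (iota p.1))%:A).
  rewrite rtimesDr rtimesNr linearB linearZ; congr (_ - _).
apply: aug_sub_in.
pose c : {linear A -> k^o} := counit hH \o (iota : {linear A -> H}).
rewrite -[LHS]/(c _) linearB linearZ -[c 1]/(eps (iota 1)) rmorph1 eps1.
rewrite -[X in X - _]/(eps (iota p.1)).
by apply/eqP; rewrite subr_eq0; apply/eqP/esym; exact: mulr1.
Qed.

(** The map n (x) h |-> n (x) T(h), taken modulo (N (x) H) A+, is balanced by [aug_bal] and thus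
    defined on N (x)_A H; it inverts psi on classes. *)
Lemma psi_ker t : psi t = 0 -> aug N (inH N t).
Proof.
move=> t0; apply/qproj_eq0.
pose phi (n : N) (h : LH) := qproj (aug N) (inH N (tensor (n : kspace N) (T
  h))).
have phi_bal : balA phi.
  split=> [n n' h|n h h'|a n h]; rewrite /phi.
  - by rewrite tensorDl !linearD.
  - by rewrite (invantiD ST TS) tensorDr !linearD.
  - apply/eqP; rewrite -subr_eq0 -linearB; apply/eqP/qproj_eq0.
    have := aug_bal n (T h) a; congr (aug N (_ - inH N (tensor _ _))).
    by rewrite -(invantiM ST TS).
have <- : tlift phi (psi t) = qproj (aug N) (inH N t).
  rewrite /psi [tlift psi0 t]/tlift (tliftA_sum _ _ _ phi_bal).
  rewrite -[t in RHS]tlift_tensorK [in RHS]/tlift !linear_sum;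
    apply: eq_bigr => p _.
  by rewrite tliftA_pure // /phi ST.
by rewrite t0 tliftA0.
Qed.

(** The element n (x) 1 of N (x) H is coinvariant and, by [psi_ker], lies in (N (x) H) A+; Nakayama
    over the zero subobject makes it vanish, and the counit recovers n. *)
Lemma pureA1_inj (n : N) : pureA n (1 : LH) = 0 -> n = 0.
Proof.
move=> n0; pose t : tens (kspace N) H := tensor (n : kspace N) 1.
have psit : psi t = 0.
  by rewrite /psi tliftT; [rewrite /psi0 antipode1|exact: psi0_kbal].
have c0 : costable (hNH N) sub_zero by move=> x -> xi; rewrite linear0 slice0.
have flat0 := hflat (quot_obj iota_inj hA c0).
have t0 : inH N t = 0.
  apply: (nakayama_rep iota_inj hA c0 flat0 (l := [:: tt])
    (F := fun=> inH N t) (h := fun=> 1)) => [|_].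
    rewrite big_seq1 coac_tensH -[LHS]/(inH_coac_fun iota_inj hA t).
    rewrite /inH_coac_fun tliftT; last exact: inH_coac_kbal.
    rewrite comul1 tliftT //; exact: (proj2 (inH_tri iota_inj hA N)).
  by exists 0, (inH N t); rewrite add0r; split=> //; exact: psi_ker.
have : slice (counit hH) t = 0 by rewrite [t]t0 slice0.
by rewrite sliceT -/(eps 1) eps1 scale1r.
Qed.

End OneModule.

Section Functor.
Variables (N N' : rmodType A) (u : {linear N -> N'}).

Definition tensH_map_fun (t : NH N) : NH N' :=
  tmap (klinear u) id (t : tens (kspace N) H) : tens (kspace N') H.
Lemma tensH_map_linear : linear tensH_map_fun.
Proof.
move=> a x y; rewrite -[a *: x]/(diag_act (x : tens (kspace N) H) a).
have := tmap_linear (klinear u) 1 (diag_act (x : tens (kspace N) H) a) y.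
rewrite !scale1r => e; rewrite [LHS]e.
by congr (_ + _); exact: diag_act_tmap.
Qed.
HB.instance Definition _ :=
  GRing.isLinear.Build _ _ _ _ tensH_map_fun tensH_map_linear.
Definition tensH_map : {linear NH N -> NH N'} := tensH_map_fun.

Lemma coac_tensH_map t :
  coac (hNH N') (tensH_map t) = tmap (klinear tensH_map) id (coac (hNH N) t).
Proof.
rewrite !coac_tensH.
rewrite -[LHS]/(inH_coac_fun iota_inj hA (tmap (klinear u) id (t : tens (kspace
  N) H))).
rewrite -[t in RHS]/(inH N t).
rewrite /inH_coac_fun tlift_tmap; last exact: inH_coac_kbal.
rewrite tmapk tlift_tensH_coac; last exact: map_tensor_kbal.
apply: eq_tlift => n h; apply: eq_tlift => h1 h2.
rewrite /inH_tensor; congr tensor.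
apply/esym; rewrite -[LHS]/(tmap (klinear u) id (tensor n h1)).
by rewrite tmapk tliftT //; exact: map_tensor_kbal.
Qed.

Lemma psi_map (t : NH N) :
  psi (tensH_map t) = tmapA u idfun (psi t).
Proof.
rewrite /psi -[tensH_map t]/(tmap (klinear u) id (t : tens (kspace N) H)).
rewrite tlift_tmap; last exact: psi0_kbal.
rewrite [tlift (@psi0 N) t]/tlift tmapA_sum; apply: eq_bigr => p _.
by rewrite tmapA_pure.
Qed.

End Functor.

(** The slices of t lie in the kernel of v, so they lift along u, and [slice_rep] reassembles the
    lifts. *)
Lemma tensH_exact (X Y Z : rmodType A) (u : {linear X -> Y}) (v : {linear Y ->
  Z}) t :
  exact_at u v -> tensH_map v t = 0 -> exists x, tensH_map u x = t.
Proof.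
move=> ex t0; have [l lE] := slice_rep (t : tens (kspace Y) H).
have pre (p : {linear H -> k^o} * H) : exists x, u x = slice p.1 (t : tens
  (kspace Y) H).
  apply/ex; rewrite -[LHS]/(klinear v _) -slice_tmap.
  by rewrite -[tmap _ _ _]/(tensH_map v t) t0 slice0.
have [x xE] := choice pre.
exists (\sum_(p <- l) tensor (x p : kspace X) p.2).
rewrite lE -[LHS]/(tmap (klinear u) id _) tmapk tlift_sum;
  last exact: map_tensor_kbal.
apply: eq_bigr => p _; rewrite tliftT; last exact: map_tensor_kbal.
by congr tensor; exact: xE.
Qed.

Lemma tmapA_comp0 (X Y Z : rmodType A) (u : {linear X -> Y}) (v : {linear Y ->
  Z})
    (w : tensA X LH) : (forall x, v (u x) = 0) ->
  tmapA v idfun (tmapA u idfun w) = 0.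
Proof.
move=> vu; rewrite [tmapA u _ w]tmapAE tmapA_sum big1 // => p _.
by rewrite tmapA_pure vu pureA0l.
Qed.

(** Preservation of exactness is carried over to the objects N (x) H by psi. For reflection,
    [pureA1_inj] is applied to Y modulo the image of u, and to Z. *)
Lemma left_ff : left_faithfully_flat LH.
Proof.
move=> X Y Z u v; split=> ex.
- move=> w; split=> [w0|[x <-]]; last first.
    by apply: tmapA_comp0 => y; apply/ex; exists y.
  have [y yE] := psi_surj w.
  have : psi (tensH_map v y) = 0 by rewrite psi_map yE.
  move=> /psi_ker[n [z [a [a0 vyE]]]].
  pose L := sub_image (tensH_map v).
  have cL : costable (hNH Z) L.
    move=> _ [q <-] xi; rewrite coac_tensH_map slice_tmap.
    by exists (slice xi (coac (hNH Y) q)).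
  have flatQ := hflat (quot_obj iota_inj hA cL).
  pose B : 'M[A]_(n, 1) := \matrix_(i, _) a i.
  have zB (zz : 'I_n -> NH Z) j : comb zz B j = \sum_i rtimes (zz i) (a i).
    by apply: eq_bigr => i _; rewrite mxE.
  (* Purity of the image of v: an element of the image that lies in (Z (x) H) A+ already lies in the
     image times A+, hence comes from some y' in (Y (x) H) A+. Then y - y' is killed by v and psi
     does not see y'. *)
  have [j|kap Lkap kapE] := @flat_quotient_relation _ _ _ _ flatQ _ _ z B.
    by rewrite zB -vyE; exists y.
  have [y1 y1E] := choice Lkap.
  pose y' : NH Y := \sum_i rtimes (y1 i) (a i).
  have vy' : tensH_map v y' = tensH_map v y.
    have -> : tensH_map v y = \sum_i rtimes (z i) (a i) by exact: vyE.
    rewrite -(zB z ord0) kapE zB linear_sum; apply: eq_bigr => i _.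
    by rewrite rtimes_linear y1E.
  have [|x xE] := @tensH_exact _ _ _ u v ((y : NH Y) - y') ex.
    by rewrite linearB vy' subrr.
  exists (psi x); rewrite -psi_map xE -yE.
  have : psi y' = 0 by apply: psi_aug; exists n, y1, a.
  have := psiD ((y : NH Y) - y') y'; rewrite subrK => -> ->.
  by rewrite addr0.
- move=> y; split=> [vy|[x <-]].
  + have [|w wE] := proj1 (ex (pureA y (1 : LH))).
      by rewrite tmapA_pure vy pureA0l.
    pose L := sub_image u.
    have : pureA (qproj L y) (1 : LH) = 0.
      have <- : tmapA (qproj L) idfun (pureA y (1 : LH)) = pureA (qproj L y) (1
        : LH).
        exact: tmapA_pure.
      by rewrite -wE; apply: tmapA_comp0 => x; apply/qproj_eq0; exists x.
    by move=> /pureA1_inj/qproj_eq0.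
  + apply: pureA1_inj.
    have : tmapA v idfun (tmapA u idfun (pureA x (1 : LH))) = 0.
      by apply/ex; exists (pureA x (1 : LH)).
    by rewrite !tmapA_pure.
Qed.

End LeftFlat.

Theorem lemma8p1 (k : fieldType) (H : algType k) (hH : hopfAlgebra H)
    (hS : bijective (antipode hH))
    (P : {pred H}) (A : subAlgType P)
    (hA : right_coideal hH (incl A))
    (hflat : forall M : rmodType A,
       relHopfModule hH (incl A) M -> right_flat M) :
  (forall M : rmodType A,
     relHopfModule hH (incl A) M ->
     (exists m : M, m <> 0) ->
     projective_module M /\ module_generator M) /\
  (left_faithfully_flat (lregmod (incl A)) /\
   right_faithfully_flat (rregmod (incl A))).
Proof.
have inj : injective (incl A) by exact: val_inj.
have [T ST TS] := hS.
split=> [M hM M0|]; last split.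
- split; first exact: (object_projective inj hA hflat hM).
  exact: (object_module_generator inj hA hM hflat M0).
- exact: (left_ff inj hA hflat ST TS).
- apply: (object_faithfully_flat inj hA (reg_obj inj hA) hflat).
  by exists (1 : H); apply/eqP; exact: oner_neq0.
Qed.
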